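(* Let $\mathbf{C}$ be a category with a finite presentation $\Sigma$ (a finite $2$-polygraph with $\overline{\Sigma}\simeq\mathbf{C}$). The following conditions are equivalent: (i) the category $\mathbf{C}$ is of homological type $\mathrm{FP}_3$; (ii) the natural system $h_2(\Sigma)$ on $\mathbf{C}$ is finitely generated; (iii) the natural system $\Pi(\Sigma)$ on $\mathbf{C}$ is finitely generated; (iv) the category $\mathbf{C}$ is $\mathrm{FDT}_{\mathrm{ab}}$.
   Context: A $2$-polygraph $\Sigma$ consists of a set $\Sigma_0$, a graph $\Sigma_1$ over $\Sigma_0$ with free category $\Sigma_1^*$, and a set $\Sigma_2$ of $2$-cells $\varphi:u\Rightarrow v$ between parallel $1$-cells of $\Sigma_1^*$; it is finite when $\Sigma_0,\Sigma_1,\Sigma_2$ are finite. $\Sigma^{\top}$ is the free $(2,1)$-category it generates ($2$-cells freely generated by $\Sigma_2$ and formal inverses). $\star_1$ is vertical composition of $2$-cells, concatenation is $0$-composition. $\overline{\Sigma}=\Sigma_1^*/\Sigma_2$ is the presented category; $\overline{u}$ is the image of a $1$-cell $u$, and $\overline{f}=\overline{u}=\overline{v}$ for $f:u\Rightarrow v$. $\Sigma$ presents $\mathbf{C}$ when $\overline{\Sigma}\simeq\mathbf{C}$. A $2$-cell is closed when its source and target coincide. Natural systems. The category of factorisations $F\mathbf{C}$ has the $1$-cells of $\mathbf{C}$ as objects and as morphisms $w\to w'$ the pairs $(u,v)$ of $1$-cells with $uwv=w'$, composed by $(u,v)(u',v')=(u'u,vv')$. A natural system on $\mathbf{C}$ is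 a functor $D:F\mathbf{C}\to\mathbf{Ab}$, with values $D_w$; $uav$ denotes $D(u,v)(a)$. It is finitely generated when it is a quotient of a finite coproduct of functors $\mathbb{Z}F\mathbf{C}(w,-)$. $\mathbf{C}$ is of homological type $\mathrm{FP}_3$ when the constant natural system $\mathbb{Z}$ admits a partial resolution $P_3\to P_2\to P_1\to P_0\to\mathbb{Z}\to0$ (exact) by finitely generated projective natural systems. $h_2(\Sigma)$. For $k=1,2$, $F_{\mathbf{C}}[\Sigma_k]_w$ is the free abelian group on the symbols $u[\varphi]v$ with $\varphi\in\Sigma_k$ and $u,v$ $1$-cells of $\mathbf{C}$ such that $u\overline{\varphi}v=w$. For a $1$-cell $u$ of $\Sigma_1^*$, $[u]\in F_{\mathbf{C}}[\Sigma_1]_{\overline{u}}$ extends $x\mapsto[x]$ by $[1_x]=0$, $[uv]=[u]\overline{v}+\overline{u}[v]$. $\delta_2:F_{\mathbf{C}}[\Sigma_2]\to F_{\mathbf{C}}[\Sigma_1]$ is given by $\delta_2[\alpha]=[s(\alpha)]-[t(\alpha)]$, and $h_2(\Sigma)=\ker\delta_2$. $\Pi(\Sigma)$ (identities among relations). $\Pi(\Sigma)_u$ is the abelian group generated by elements $\lfloor f\rfloor$, one for each closed $2$-cell $f:v\Rightarrow v$ of $\Sigma^{\top}$ with $\overline{v}=u$, subject to $\lfloor f\star_1 g\rfloor=\lfloor f\rfloor+\lfloor g\rfloor$ for $f,g:v\Rightarrow v$, and $\lfloor f\star_1 g\rfloor=\lfloor g\star_1 f\rfloor$ for $f:v\Rightarrow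 w$, $g:w\Rightarrow v$ with $\overline{v}=\overline{w}=u$. A morphism $(a,b)$ of $F\mathbf{C}$ acts by $\lfloor f\rfloor\mapsto\lfloor\widehat{a}f\widehat{b}\rfloor$ for any representatives $\widehat{a},\widehat{b}$ of $a,b$ in $\Sigma_1^*$ (independent of the choice). $\mathrm{FDT}_{\mathrm{ab}}$. The abelian $(2,1)$-category $\Sigma^{\top}_{\mathrm{ab}}$ is the quotient of $\Sigma^{\top}$ by the relations $f\star_1 g=g\star_1 f$ for all closed $2$-cells $f,g$ with the same source. A homotopy basis of a $(2,1)$-category $\mathcal{C}$ is a set $\Gamma$ of pairs of parallel $2$-cells of $\mathcal{C}$ (attached as $3$-cells) such that in the quotient $\mathcal{C}/\Gamma$ any two parallel $2$-cells are equal. A $2$-polygraph $\Sigma$ is $\mathrm{FDT}_{\mathrm{ab}}$ when $\Sigma^{\top}_{\mathrm{ab}}$ admits a finite homotopy basis; a category is $\mathrm{FDT}_{\mathrm{ab}}$ when it admits a presentation by a finite $2$-polygraph that is $\mathrm{FDT}_{\mathrm{ab}}$. *)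

(* Defs.v *)
From HB Require Import structures.
From Stdlib Require Import Relation_Operators.
From mathcomp Require Import all_boot.
From mathcomp Require Import ssralg ssrint ring_quotient.
From mathcomp Require Import boolp classical_sets cardinality.
From mathcomp Require Import freeg.

Set Implicit Arguments.
Unset Strict Implicit.
Unset Printing Implicit Defensive.

Import GRing.Theory.
Local Open Scope ring_scope.
Local Open Scope quotient_scope.

(* Quotient of a type by the equivalence relation generated by [R].           *)
Section ClassicalQuotient.
Variables (T : Type) (R : T -> T -> Prop).

Definition quo_rel (x y : {classic T}) : bool :=
  `[< clos_refl_sym_trans T R x y >].

Lemma quo_rel_refl : reflexive quo_rel.
Proof. by move=> x; apply/asboolP/rst_refl. Qed.

Lemma quo_rel_sym : symmetric quo_rel.
Proof. by move=> x y; apply/idP/idP => /asboolP xy; apply/asboolP/rst_sym. Qed.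

Lemma quo_rel_trans : transitive quo_rel.
Proof.
move=> y x z /asboolP xy /asboolP yz; apply/asboolP.
exact: rst_trans xy yz.
Qed.

Canonical quo_equiv := EquivRel quo_rel quo_rel_refl quo_rel_sym quo_rel_trans.
Canonical quo_encModRel := defaultEncModRel quo_rel.

Definition quo : Type := {eq_quot quo_rel}.
Definition cls (x : T) : quo := \pi_{eq_quot quo_rel} (x : {classic T}).
Definition rep (q : quo) : T := repr (q : {eq_quot quo_rel}).

Lemma repK q : cls (rep q) = q. Proof. exact: (@reprK _ {eq_quot quo_rel}). Qed.

Lemma cls_eq x y : R x y -> cls x = cls y.
Proof. by move=> xy; apply/eqmodP/asboolP/rst_step. Qed.

Lemma clsP x y : cls x = cls y <-> clos_refl_sym_trans T R x y.
Proof.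
by split=> [/eqmodP/asboolP|xy] //; apply/eqmodP/asboolP.
Qed.

Lemma rep_cls x : clos_refl_sym_trans T R (rep (cls x)) x.
Proof. by apply/clsP; rewrite repK. Qed.
End ClassicalQuotient.

Lemma rst_equiv T (R : T -> T -> Prop) :
    (forall x, R x x) -> (forall x y, R x y -> R y x) ->
    (forall x y z, R x y -> R y z -> R x z) ->
  forall x y, clos_refl_sym_trans T R x y -> R x y.
Proof.
move=> rr rs rt x y; elim=> {x y} [//|//|x y _|x y z _ xy _ yz].
  exact: rs.
exact: rt xy yz.
Qed.

Definition mk_additive (V W : zmodType) (f : V -> W) (fB : zmod_morphism f) :
    {additive V -> W} :=
  HB.pack f (GRing.isZmodMorphism.Build V W f fB).
Section FreeAbelianGroup.
Variable X : Type.

Definition freeab : zmodType := {freeg {classic X} / int}.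

Definition fgen (x : X) : freeab := [freeg [:: (1 : int, x : {classic X})]].

Section Lift.
Variables (V : zmodType) (f : X -> V).

Definition freeab_lift_fun : freeab -> V :=
  fglift (fun x : {classic X} => f x : zmodule V).

Lemma freeab_lift_subproof : zmod_morphism freeab_lift_fun.
Proof. by move=> x y; apply: (@lift_is_additive int {classic X} (zmodule V)). Qed.

Definition freeab_lift : {additive freeab -> V} :=
  mk_additive freeab_lift_subproof.

Lemma freeab_liftE x : freeab_lift (fgen x) = f x.
Proof.
by rewrite -[LHS]/(freeab_lift_fun (fgen x)) /freeab_lift_fun liftU scale1r.
Qed.
End Lift.

Lemma freeab_ind (P : freeab -> Prop) :
    P 0 -> (forall x y, P x -> P y -> P (x - y)) -> (forall x, P (fgen x)) ->
  forall x, P x.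
Proof.
move=> P0 PB Pg x.
have PN y : P y -> P (- y) by move=> Py; rewrite -[- y]add0r; apply: PB.
have PD y z : P y -> P z -> P (y + z).
  by move=> Py Pz; rewrite -[z]opprK; apply: PB => //; apply: PN.
have Pn (n : nat) y : P y -> P (y *+ n).
  by move=> Py; elim: n => [|n IH]; rewrite ?mulr0n // mulrS; apply: PD.
rewrite -(freeg_sumE x); elim/big_ind: _ => // i _.
suff -> : [freeg [:: (coeff i x, i)]] = fgen i *~ coeff i x.
  by case: (coeff i x) => n; [|rewrite NegzE mulrNz; apply: PN]; apply: Pn.
apply/eqP/freeg_eqP => k; rewrite coeffU.
have -> : coeff k (fgen i *~ coeff i x) = coeff k (fgen i) *~ coeff i x.
  exact: raddfMz.
by rewrite coeffU mul1r -mulrzr intz mulrC.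
Qed.

Lemma freeab_ext (V : zmodType) (f g : {additive freeab -> V}) :
  (forall x, f (fgen x) = g (fgen x)) -> f =1 g.
Proof.
by move=> fg; apply: freeab_ind => [|x y fx fy|//]; rewrite ?raddf0 // !raddfB fx fy.
Qed.
End FreeAbelianGroup.

(* The abelian group with generators [X] and relators [R].                    *)
Section PresentedAbelianGroup.
Variables (X : Type) (R : freeab X -> Prop).

Inductive relator_span : freeab X -> Prop :=
| span_rel r of R r : relator_span r
| span_zero : relator_span 0
| span_sub r s of relator_span r & relator_span s : relator_span (r - s).

Definition relator_pred (r : freeab X) : bool := `[< relator_span r >].

Lemma relator_zmod_closed : zmod_closed relator_pred.
Proof.
split=> [|r s /asboolP hr /asboolP hs]; first exact/asboolP/span_zero.
exact/asboolP/span_sub.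
Qed.

Definition relators : zmodClosed (freeab X) :=
  HB.pack relator_pred
    (GRing.isZmodClosed.Build (freeab X) relator_pred relator_zmod_closed).

Definition presab : zmodType := Quotient.quot relators.

Lemma presab_cls_subproof :
  zmod_morphism (\pi_(Quotient.quot relators) : freeab X -> presab).
Proof. by move=> r s; rewrite !piE. Qed.

Definition presab_cls : {additive freeab X -> presab} :=
  mk_additive presab_cls_subproof.

Definition pgen (x : X) : presab := presab_cls (fgen x).

Lemma presab_rel r : R r -> presab_cls r = 0.
Proof.
move=> Rr; rewrite -(raddf0 presab_cls); apply/eqP.
suff : r - 0 \in relators by rewrite Quotient.idealrBE.
by apply/asboolP; rewrite subr0; apply: span_rel.
Qed.

Section Lift.
Variables (V : zmodType) (f : X -> V).
Hypothesis fR : forall r, R r -> freeab_lift f r = 0.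

Definition presab_lift_fun (q : presab) : V :=
  freeab_lift f (repr (q : Quotient.quot relators)).

Lemma presab_lift_pi (r : freeab X) :
  presab_lift_fun (\pi_(Quotient.quot relators) r) = freeab_lift f r.
Proof.
have span0 s : relator_span s -> freeab_lift f s = 0.
  by elim=> {s} [||s t _ s0 _ t0]; rewrite ?raddf0 // raddfB s0 t0 subr0.
apply/eqP; rewrite -subr_eq0 -raddfB; apply/eqP/span0/asboolP.
pose q : Quotient.quot relators := \pi r.
have := Quotient.idealrBE relators (repr q) r.
by rewrite reprK eqxx.
Qed.

Lemma presab_lift_subproof : zmod_morphism presab_lift_fun.
Proof.
move=> x y; rewrite -[x](@reprK _ (Quotient.quot relators)).
rewrite -[y](@reprK _ (Quotient.quot relators)).
set r := repr x; set s := repr y.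
have -> : \pi_(Quotient.quot relators) r - \pi_(Quotient.quot relators) s
   = \pi_(Quotient.quot relators) (r - s) :> presab by rewrite !piE.
by rewrite !presab_lift_pi raddfB.
Qed.

Definition presab_lift : {additive presab -> V} :=
  mk_additive presab_lift_subproof.

Lemma presab_liftE x : presab_lift (pgen x) = f x.
Proof. by rewrite -[LHS]/(presab_lift_fun _) presab_lift_pi freeab_liftE. Qed.
End Lift.

Lemma presab_ext (V : zmodType) (f g : {additive presab -> V}) :
  (forall x, f (pgen x) = g (pgen x)) -> f =1 g.
Proof.
move=> fg q; rewrite -[q](@reprK _ (Quotient.quot relators)).
exact: (@freeab_ext _ _ (f \o presab_cls) (g \o presab_cls)).
Qed.

End PresentedAbelianGroup.

Reserved Notation "f ;; g" (at level 50, left associativity).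

(* Composition is written in diagrammatic order, as for words: [u ;; v] is    *)
(* the concatenation uv.                                                      *)
Record category := Category {
  obj :> Type;
  hom : obj -> obj -> Type;
  idc : forall x, hom x x;
  comp : forall x y z, hom x y -> hom y z -> hom x z;
  comp1l : forall x y (f : hom x y), comp (idc x) f = f;
  comp1r : forall x y (f : hom x y), comp f (idc y) = f;
  compA : forall x y z t (f : hom x y) (g : hom y z) (h : hom z t),
    comp f (comp g h) = comp (comp f g) h
}.
Arguments idc {c} x.
Notation "f ;; g" := (comp f g).

Record functor (C D : category) := Functor {
  fobj :> C -> D;
  fmap : forall x y, hom x y -> hom (fobj x) (fobj y);
  fmap1 : forall x, fmap (idc x) = idc (fobj x);
  fmapM : forall x y z (f : hom x y) (g : hom y z),
    fmap (f ;; g) = fmap f ;; fmap g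
}.

Definition functor_id (C : category) : functor C C :=
  @Functor C C id (fun _ _ => id) (fun=> erefl) (fun _ _ _ _ _ => erefl).

Section FunctorComp.
Variables (C D E : category) (F : functor C D) (G : functor D E).

Lemma functor_comp1 x : fmap G (fmap F (idc x)) = idc (G (F x)).
Proof. by rewrite !fmap1. Qed.

Lemma functor_compM x y z (f : hom x y) (g : hom y z) :
  fmap G (fmap F (f ;; g)) = fmap G (fmap F f) ;; fmap G (fmap F g).
Proof. by rewrite !fmapM. Qed.

Definition functor_comp : functor C E := Functor functor_comp1 functor_compM.
End FunctorComp.

Record category_iso (C D : category) := CategoryIso {
  iso_to : functor C D;
  iso_from : functor D C;
  iso_toK : functor_comp iso_to iso_from = functor_id C;
  iso_fromK : functor_comp iso_from iso_to = functor_id D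
}.

Section QuotientCategory.
Variables (C : category) (R : forall x y : C, hom x y -> hom x y -> Prop).

Inductive cat_cong : forall x y : C, hom x y -> hom x y -> Prop :=
| cc_rel x y (f g : hom x y) of R f g : cat_cong f g
| cc_refl x y (f : hom x y) : cat_cong f f
| cc_sym x y (f g : hom x y) of cat_cong f g : cat_cong g f
| cc_trans x y (f g h : hom x y) of cat_cong f g & cat_cong g h : cat_cong f h
| cc_comp x y z (f f' : hom x y) (g g' : hom y z)
    of cat_cong f f' & cat_cong g g' : cat_cong (f ;; g) (f' ;; g').

Lemma cat_congP x y (f g : hom x y) :
  cls (@cat_cong x y) f = cls (@cat_cong x y) g <-> cat_cong f g.
Proof.
split=> [/clsP|]; last exact: cls_eq.
by apply: rst_equiv => [u|u v|u v w]; [apply: cc_refl|apply: cc_sym|apply: cc_trans].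
Qed.

Lemma rep_cong x y (f : hom x y) : cat_cong (rep (cls (@cat_cong x y) f)) f.
Proof. by apply/cat_congP; rewrite repK. Qed.

Definition qhom (x y : C) := quo (@cat_cong x y).
Definition qclass x y (f : hom x y) : qhom x y := cls (@cat_cong x y) f.
Definition qcomp x y z (f : qhom x y) (g : qhom y z) : qhom x z :=
  qclass (rep f ;; rep g).

Lemma qclass_comp x y z (f : hom x y) (g : hom y z) :
  qcomp (qclass f) (qclass g) = qclass (f ;; g).
Proof. by apply/cat_congP/cc_comp; apply: rep_cong. Qed.

Lemma qcomp1l x y (f : qhom x y) : qcomp (qclass (idc x)) f = f.
Proof. by rewrite -[f]repK [LHS]qclass_comp comp1l. Qed.

Lemma qcomp1r x y (f : qhom x y) : qcomp f (qclass (idc y)) = f.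
Proof. by rewrite -[f]repK [LHS]qclass_comp comp1r. Qed.

Lemma qcompA x y z t (f : qhom x y) (g : qhom y z) (h : qhom z t) :
  qcomp f (qcomp g h) = qcomp (qcomp f g) h.
Proof.
rewrite -[f]repK -[g]repK -[h]repK -!/(qclass _).
by rewrite !qclass_comp compA.
Qed.

Definition quotient_category : category := Category qcomp1l qcomp1r qcompA.
End QuotientCategory.

Section FactorisationCategory.
Variable C : category.

Record arrow := Arrow { asrc : C; atgt : C; acell : hom asrc atgt }.

(* The 1-cells are bundled with their endpoints, and the equation uwv = w' is *)
(* part of a morphism (u, v) : w -> w'.                                       *)
Record fact (w w' : arrow) := Fact {
  factl : hom (asrc w') (asrc w);
  factr : hom (atgt w) (atgt w');
  factE : factl ;; acell w ;; factr = acell w'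
}.

Lemma fact_eq w w' (f g : fact w w') :
  factl f = factl g -> factr f = factr g -> f = g.
Proof.
case: f g => [fl fr fE] [gl gr gE] /= el er.
by case: _ / el in gE *; case: _ / er in gE *; rewrite (Prop_irrelevance fE gE).
Qed.

Lemma fact_id_subproof (w : arrow) :
  idc (asrc w) ;; acell w ;; idc (atgt w) = acell w.
Proof. by rewrite comp1l comp1r. Qed.

Definition fact_id w : fact w w := Fact (fact_id_subproof w).

Lemma fact_comp_subproof w w' w'' (f : fact w w') (g : fact w' w'') :
  (factl g ;; factl f) ;; acell w ;; (factr f ;; factr g) = acell w''.
Proof. by rewrite -(factE g) -(factE f) !compA. Qed.

Definition fact_comp w w' w'' (f : fact w w') (g : fact w' w'') : fact w w'' :=
  Fact (fact_comp_subproof f g).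

Lemma fact_comp1l w w' (f : fact w w') : fact_comp (fact_id w) f = f.
Proof. by apply: fact_eq; rewrite /= ?comp1l ?comp1r. Qed.

Lemma fact_comp1r w w' (f : fact w w') : fact_comp f (fact_id w') = f.
Proof. by apply: fact_eq; rewrite /= ?comp1l ?comp1r. Qed.

Lemma fact_compA w w' w'' w''' (f : fact w w') (g : fact w' w'')
    (h : fact w'' w''') :
  fact_comp f (fact_comp g h) = fact_comp (fact_comp f g) h.
Proof. by apply: fact_eq; rewrite /= ?compA. Qed.

Definition factorisations : category :=
  Category fact_comp1l fact_comp1r fact_compA.
End FactorisationCategory.

Section FactorisationsFunctor.
Variables (C D : category) (F : functor C D).

Definition arrow_map (w : factorisations C) : factorisations D :=
  Arrow (fmap F (acell w)).

Lemma fact_map_subproof (w w' : factorisations C) (f : hom w w') :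
  fmap F (factl f) ;; acell (arrow_map w) ;; fmap F (factr f) =
    acell (arrow_map w').
Proof. by rewrite /= -!fmapM factE. Qed.

Definition fact_map (w w' : factorisations C) (f : hom w w') :
    hom (arrow_map w) (arrow_map w') :=
  @Fact D (arrow_map w) (arrow_map w') _ _ (fact_map_subproof f).

Lemma fact_map1 (w : factorisations C) : fact_map (idc w) = idc (arrow_map w).
Proof. by apply: fact_eq; rewrite /= fmap1. Qed.

Lemma fact_mapM (w w' w'' : factorisations C) (f : hom w w') (g : hom w' w'') :
  fact_map (f ;; g) = fact_map f ;; fact_map g.
Proof. by apply: fact_eq; rewrite /= fmapM. Qed.

Definition factorisations_functor :
    functor (factorisations C) (factorisations D) :=
  Functor fact_map1 fact_mapM.
End FactorisationsFunctor.

(* Functors to abelian groups and their natural transformations.              *)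
Record abfunctor (C : category) := AbFunctor {
  abval :> C -> zmodType;
  abmap : forall x y, hom x y -> {additive abval x -> abval y};
  abmap1 : forall x (a : abval x), abmap (idc x) a = a;
  abmapM : forall x y z (f : hom x y) (g : hom y z) (a : abval x),
    abmap (f ;; g) a = abmap g (abmap f a)
}.

Record abnat (C : category) (D E : abfunctor C) := AbNat {
  abcomp :> forall x, {additive D x -> E x};
  abnatE : forall x y (f : hom x y) (a : D x),
    abcomp y (abmap D f a) = abmap E f (abcomp x a)
}.

Section AbFunctors.
Variable C : category.

(* Epimorphisms, exactness and kernels in the category of functors to abelian *)
(* groups are computed pointwise.                                             *)
Definition pointwise_surjective (D E : abfunctor C) (p : abnat D E) :=
  forall x (b : E x), exists a, p x a = b.

Definition pointwise_exact (D E F : abfunctor C) (p : abnat D E)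
    (q : abnat E F) :=
  forall x (b : E x), q x b = 0 <-> exists a, p x a = b.

Definition projective (P : abfunctor C) :=
  forall (D E : abfunctor C) (p : abnat D E) (f : abnat P E),
    pointwise_surjective p ->
    exists g : abnat P D, forall x a, p x (g x a) = f x a.

Section Constant.
Variable V : zmodType.

Lemma id_zmod_morphism : zmod_morphism (@id V). Proof. by []. Qed.

Definition constant_abfunctor : abfunctor C :=
  @AbFunctor C (fun=> V) (fun _ _ _ => mk_additive id_zmod_morphism)
    (fun _ _ => erefl) (fun _ _ _ _ _ _ => erefl).
End Constant.

(* The free functor to abelian groups on a family [s] of objects: its value   *)
(* at [x] is free on the pairs of an index [i] and a morphism [s i -> x].     *)
Section Free.
Variables (I : Type) (s : I -> C).

Record symbol (x : C) := Symbol { sym_idx : I; sym_mor : hom (s sym_idx) x }.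

Definition symbol_map x y (f : hom x y) (a : symbol x) : symbol y :=
  Symbol (sym_mor a ;; f).

Definition free_map x y (f : hom x y) :
    {additive freeab (symbol x) -> freeab (symbol y)} :=
  freeab_lift (fun a => fgen (symbol_map f a)).

Lemma free_mapE x y (f : hom x y) a :
  free_map f (fgen a) = fgen (symbol_map f a).
Proof. exact: freeab_liftE. Qed.

Lemma free_map1 x a : free_map (idc x) a = a.
Proof.
move: a; apply: (@freeab_ext _ _ _ (mk_additive (@id_zmod_morphism _))).
by case=> i f; rewrite free_mapE /symbol_map /= comp1r.
Qed.

Lemma free_mapM x y z (f : hom x y) (g : hom y z) a :
  free_map (f ;; g) a = free_map g (free_map f a).
Proof.
move: a; apply: (@freeab_ext _ _ _ (free_map g \o free_map f)).
move=> a; rewrite -[RHS]/(free_map g (free_map f (fgen a))) !free_mapE.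
by rewrite /symbol_map /= compA.
Qed.

Definition free_abfunctor : abfunctor C := AbFunctor free_map1 free_mapM.

Variables (D : abfunctor C) (v : forall i, D (s i)).

Definition free_lift x : {additive free_abfunctor x -> D x} :=
  freeab_lift (fun a : symbol x => abmap D (sym_mor a) (v (sym_idx a))).

Lemma free_liftE x (a : symbol x) :
  free_lift x (fgen a) = abmap D (sym_mor a) (v (sym_idx a)).
Proof. exact: freeab_liftE. Qed.

Lemma free_lift_subproof x y (f : hom x y) (a : free_abfunctor x) :
  free_lift y (abmap free_abfunctor f a) = abmap D f (free_lift x a).
Proof.
move: a.
apply: (@freeab_ext _ _ (free_lift y \o free_map f) (abmap D f \o free_lift x)).
move=> a; rewrite -[LHS]/(free_lift y (free_map f (fgen a))).
by rewrite -[RHS]/(abmap D f (free_lift x (fgen a))) free_mapE !free_liftE abmapM.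
Qed.

Definition free_abnat : abnat free_abfunctor D := AbNat free_lift_subproof.
End Free.

Section Representable.
Variable w : C.

Definition repr_map x y (f : hom x y) :
    {additive freeab (hom w x) -> freeab (hom w y)} :=
  freeab_lift (fun g => fgen (g ;; f)).

Lemma repr_mapE x y (f : hom x y) g : repr_map f (fgen g) = fgen (g ;; f).
Proof. exact: freeab_liftE. Qed.

Lemma repr_map1 x a : repr_map (idc x) a = a.
Proof.
move: a; apply: (@freeab_ext _ _ _ (mk_additive (@id_zmod_morphism _))).
by move=> g; rewrite repr_mapE comp1r.
Qed.

Lemma repr_mapM x y z (f : hom x y) (g : hom y z) a :
  repr_map (f ;; g) a = repr_map g (repr_map f a).
Proof.
move: a; apply: (@freeab_ext _ _ _ (repr_map g \o repr_map f)).
move=> h; rewrite -[RHS]/(repr_map g (repr_map f (fgen h))) !repr_mapE.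
by rewrite compA.
Qed.

Definition representable : abfunctor C := AbFunctor repr_map1 repr_mapM.
End Representable.

Section DirectSum.
Variables (n : nat) (D : 'I_n -> abfunctor C).

Definition dsum (x : C) : Type := forall i, D i x.
HB.instance Definition _ x := Choice.on (dsum x).

Definition dsum_zero x : dsum x := fun=> 0.
Definition dsum_opp x (a : dsum x) : dsum x := fun i => - a i.
Definition dsum_add x (a b : dsum x) : dsum x := fun i => a i + b i.

Lemma dsum_addA x : associative (@dsum_add x).
Proof. by move=> a b c; apply: functional_extensionality_dep => i; apply: addrA. Qed.
Lemma dsum_addC x : commutative (@dsum_add x).
Proof. by move=> a b; apply: functional_extensionality_dep => i; apply: addrC. Qed.
Lemma dsum_add0 x : left_id (@dsum_zero x) (@dsum_add x).
Proof. by move=> a; apply: functional_extensionality_dep => i; apply: add0r. Qed.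
Lemma dsum_addN x : left_inverse (@dsum_zero x) (@dsum_opp x) (@dsum_add x).
Proof. by move=> a; apply: functional_extensionality_dep => i; apply: addNr. Qed.

HB.instance Definition _ x := GRing.isZmodule.Build (dsum x)
  (@dsum_addA x) (@dsum_addC x) (@dsum_add0 x) (@dsum_addN x).

Definition dsum_map_fun x y (f : hom x y) (a : dsum x) : dsum y :=
  fun i => abmap (D i) f (a i).

Lemma dsum_map_subproof x y (f : hom x y) : zmod_morphism (dsum_map_fun f).
Proof. by move=> a b; apply: functional_extensionality_dep => i; apply: raddfB. Qed.

Definition dsum_map x y (f : hom x y) := mk_additive (dsum_map_subproof f).

Lemma dsum_map1 x a : dsum_map (idc x) a = a.
Proof. by apply: functional_extensionality_dep => i; apply: abmap1. Qed.

Lemma dsum_mapM x y z (f : hom x y) (g : hom y z) a :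
  dsum_map (f ;; g) a = dsum_map g (dsum_map f a).
Proof. by apply: functional_extensionality_dep => i; apply: abmapM. Qed.

(* Finite coproducts of functors to abelian groups are computed pointwise,    *)
(* as direct sums; for finitely many summands these are the products.         *)
Definition direct_sum : abfunctor C := AbFunctor dsum_map1 dsum_mapM.
End DirectSum.

Definition finitely_generated (D : abfunctor C) :=
  exists (n : nat) (w : 'I_n -> C)
      (p : abnat (direct_sum (fun i => representable (w i))) D),
    pointwise_surjective p.

Section Kernel.
Variables (D E : abfunctor C) (p : abnat D E).

Definition ker_pred x : {pred D x} := fun a => p x a == 0.
Arguments ker_pred x : clear implicits.

Lemma ker_zmod_closed x : zmod_closed (ker_pred x).
Proof.
split=> [|a b]; rewrite !unfold_in /ker_pred ?raddf0 //.
by move=> /eqP pa /eqP pb; rewrite raddfB pa pb subr0.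
Qed.

HB.instance Definition _ x :=
  GRing.isZmodClosed.Build (D x) (ker_pred x) (ker_zmod_closed x).

Record ker x := Ker { ker_val : D x; _ : ker_val \in ker_pred x }.
HB.instance Definition _ x := [isSub for @ker_val x].
HB.instance Definition _ x := [Choice of ker x by <:].
HB.instance Definition _ x := [SubChoice_isSubZmodule of ker x by <:].

Lemma ker_map_subproof x y (f : hom x y) (a : ker x) :
  abmap D f (ker_val a) \in ker_pred y.
Proof.
case: a => a /= /eqP pa; apply/eqP.
by rewrite abnatE pa raddf0.
Qed.

Definition ker_map_fun x y (f : hom x y) (a : ker x) : ker y :=
  Ker (ker_map_subproof f a).

Lemma ker_map_additive x y (f : hom x y) : zmod_morphism (ker_map_fun f).
Proof. by move=> a b; apply: val_inj; rewrite /= !raddfB. Qed.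

Definition ker_map x y (f : hom x y) := mk_additive (ker_map_additive f).

Lemma ker_map1 x a : ker_map (idc x) a = a.
Proof. by apply: val_inj; apply: abmap1. Qed.

Lemma ker_mapM x y z (f : hom x y) (g : hom y z) a :
  ker_map (f ;; g) a = ker_map g (ker_map f a).
Proof. by apply: val_inj; apply: abmapM. Qed.

Definition kernel : abfunctor C := AbFunctor ker_map1 ker_mapM.
End Kernel.

End AbFunctors.

Section Pullback.
Variables (C C' : category) (F : functor C C') (D : abfunctor C').

Lemma pullback1 x (a : D (F x)) : abmap D (fmap F (idc x)) a = a.
Proof. by rewrite fmap1 abmap1. Qed.

Lemma pullbackM x y z (f : hom x y) (g : hom y z) (a : D (F x)) :
  abmap D (fmap F (f ;; g)) a = abmap D (fmap F g) (abmap D (fmap F f) a).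
Proof. by rewrite fmapM abmapM. Qed.

Definition pullback : abfunctor C :=
  @AbFunctor C (fun x => D (F x)) (fun x y f => abmap D (fmap F f))
    pullback1 pullbackM.
End Pullback.

Definition natural_system (C : category) := abfunctor (factorisations C).

Definition homological_FP3 (C : category) :=
  exists (P3 P2 P1 P0 : natural_system C)
      (d3 : abnat P3 P2) (d2 : abnat P2 P1) (d1 : abnat P1 P0)
      (d0 : abnat P0 (constant_abfunctor (factorisations C) int)),
    (finitely_generated P3 /\ projective P3) /\
    (finitely_generated P2 /\ projective P2) /\
    (finitely_generated P1 /\ projective P1) /\
    (finitely_generated P0 /\ projective P0) /\
    pointwise_exact d3 d2 /\ pointwise_exact d2 d1 /\ pointwise_exact d1 d0 /\
    pointwise_surjective d0.

Section FreeCategory.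
Variables (V : Type) (E : V -> V -> Type).

Inductive path : V -> V -> Type :=
| pnil x : path x x
| pcons x y z of E x y & path y z : path x z.

Fixpoint pcat x y z (p : path x y) : path y z -> path x z :=
  match p in path x y return path y z -> path x z with
  | pnil _ => id
  | pcons _ _ _ e p' => fun q => pcons e (pcat p' q)
  end.

Lemma pcat1l x y (p : path x y) : pcat (pnil x) p = p. Proof. by []. Qed.

Lemma pcat1r x y (p : path x y) : pcat p (pnil y) = p.
Proof. by elim: p => //= {}x {}y z e p ->. Qed.

Lemma pcatA x y z t (p : path x y) (q : path y z) (r : path z t) :
  pcat p (pcat q r) = pcat (pcat p q) r.
Proof. by elim: p q => //= {}x {}y z' e p IH q; rewrite IH. Qed.

Definition free_category : category := Category pcat1l pcat1r pcatA.
End FreeCategory.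

Record polygraph2 := Polygraph2 {
  cell0 : Type;
  cell1 : cell0 -> cell0 -> Type;
  cell2 : forall x y : cell0, path cell1 x y -> path cell1 x y -> Type
}.

Definition words (S : polygraph2) : category := free_category (@cell1 S).

Record gen1 (S : polygraph2) := Gen1 {
  src1 : cell0 S;
  tgt1 : cell0 S;
  gen1_cell : cell1 src1 tgt1
}.

Record gen2 (S : polygraph2) := Gen2 {
  gen2_src0 : cell0 S;
  gen2_tgt0 : cell0 S;
  src2 : path (@cell1 S) gen2_src0 gen2_tgt0;
  tgt2 : path (@cell1 S) gen2_src0 gen2_tgt0;
  gen2_cell : cell2 src2 tgt2
}.

Definition finite_polygraph (S : polygraph2) :=
  [/\ finite_set [set: cell0 S], finite_set [set: gen1 S]
    & finite_set [set: gen2 S]].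

(* The congruence is generated by the pairs of parallel 1-cells that are the  *)
(* source and the target of some 2-cell.                                      *)
Definition presented (S : polygraph2) : category :=
  @quotient_category (words S) (fun x y u v => inhabited (@cell2 S x y u v)).

Definition wclass (S : polygraph2) (x y : cell0 S) (u : path (@cell1 S) x y) :
    @hom (presented S) x y :=
  @qclass (words S) _ x y u.

(* The 0-composition of 2-cells is given by whiskering: [whisk a b e e' f] is *)
(* the 2-cell a f b, for f : u => v. Its source u' and target v' are only     *)
(* required to be provably equal to aub and avb, so that the axioms need no   *)
(* transport. The 0-composite of f : u => v and g : u' => v' is               *)
(* fu' *1 vg = ug *1 fv', the two sides being equal by [whisk_exchange].      *)
Record cat21 := Cat21 {
  cat21_base :> category;
  cell : forall x y : cat21_base, hom x y -> hom x y -> Type;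
  vid : forall x y (u : hom x y), cell u u;
  vcomp : forall x y (u v w : hom x y), cell u v -> cell v w -> cell u w;
  vinv : forall x y (u v : hom x y), cell u v -> cell v u;
  whisk : forall x' x y y' (a : hom x' x) (b : hom y y') (u v : hom x y)
    (u' v' : hom x' y'), a ;; u ;; b = u' -> a ;; v ;; b = v' ->
    cell u v -> cell u' v';
  vcomp1l : forall x y (u v : hom x y) (f : cell u v), vcomp (vid u) f = f;
  vcomp1r : forall x y (u v : hom x y) (f : cell u v), vcomp f (vid v) = f;
  vcompA : forall x y (u v w t : hom x y)
    (f : cell u v) (g : cell v w) (h : cell w t),
    vcomp f (vcomp g h) = vcomp (vcomp f g) h;
  vcompV : forall x y (u v : hom x y) (f : cell u v), vcomp f (vinv f) = vid u;
  vcompVl : forall x y (u v : hom x y) (f : cell u v), vcomp (vinv f) f = vid v;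
  whisk_vid : forall x' x y y' (a : hom x' x) (b : hom y y') (u : hom x y)
    (u' : hom x' y') (e e' : a ;; u ;; b = u'), whisk e e' (vid u) = vid u';
  whisk_vcomp : forall x' x y y' (a : hom x' x) (b : hom y y')
    (u v w : hom x y) (u' v' w' : hom x' y')
    (eu : a ;; u ;; b = u') (ev : a ;; v ;; b = v') (ew : a ;; w ;; b = w')
    (f : cell u v) (g : cell v w),
    whisk eu ew (vcomp f g) = vcomp (whisk eu ev f) (whisk ev ew g);
  whisk1 : forall x y (u v : hom x y)
    (eu : idc x ;; u ;; idc y = u) (ev : idc x ;; v ;; idc y = v)
    (f : cell u v), whisk eu ev f = f;
  whiskM : forall x'' x' x y y' y'' (a' : hom x'' x') (a : hom x' x)
    (b : hom y y') (b' : hom y' y'') (u v : hom x y) (u' v' : hom x' y')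
    (u'' v'' : hom x'' y'')
    (eu : a ;; u ;; b = u') (ev : a ;; v ;; b = v')
    (eu' : a' ;; u' ;; b' = u'') (ev' : a' ;; v' ;; b' = v'')
    (eu'' : (a' ;; a) ;; u ;; (b ;; b') = u'')
    (ev'' : (a' ;; a) ;; v ;; (b ;; b') = v'') (f : cell u v),
    whisk eu' ev' (whisk eu ev f) = whisk eu'' ev'' f;
  whisk_exchange : forall x y z (u v : hom x y) (u' v' : hom y z)
    (euu' : idc x ;; u ;; u' = u ;; u') (evu' : idc x ;; v ;; u' = v ;; u')
    (euv' : idc x ;; u ;; v' = u ;; v') (evv' : idc x ;; v ;; v' = v ;; v')
    (euu'1 : u ;; u' ;; idc z = u ;; u') (euv'1 : u ;; v' ;; idc z = u ;; v')
    (evu'1 : v ;; u' ;; idc z = v ;; u') (evv'1 : v ;; v' ;; idc z = v ;; v')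
    (f : cell u v) (g : cell u' v'),
    vcomp (whisk euu' evu' f) (whisk evu'1 evv'1 g) =
    vcomp (whisk euu'1 euv'1 g) (whisk euv' evv' f)
}.

Section Whiskering.
Variable C : cat21.

Lemma whisk_eq (x' x y y' : C) (a a' : hom x' x) (b b' : hom y y')
    (u v : hom x y) (u' v' : hom x' y')
    (eu : a ;; u ;; b = u') (ev : a ;; v ;; b = v')
    (eu' : a' ;; u ;; b' = u') (ev' : a' ;; v ;; b' = v') (f : cell u v) :
  a = a' -> b = b' -> whisk eu ev f = whisk eu' ev' f.
Proof.
move=> ea eb; case: _ / ea in eu' ev' *; case: _ / eb in eu' ev' *.
by rewrite (Prop_irrelevance eu eu') (Prop_irrelevance ev ev').
Qed.

Lemma whisk_exchange_eq (x y z : C) (u v : hom x y) (u' v' : hom y z)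
    (p q r s : hom x z)
    (ep : idc x ;; u ;; u' = p) (eq : idc x ;; v ;; u' = q)
    (er : idc x ;; u ;; v' = r) (es : idc x ;; v ;; v' = s)
    (ep1 : u ;; u' ;; idc z = p) (eq1 : v ;; u' ;; idc z = q)
    (er1 : u ;; v' ;; idc z = r) (es1 : v ;; v' ;; idc z = s)
    (f : cell u v) (g : cell u' v') :
  vcomp (whisk ep eq f) (whisk eq1 es1 g) =
  vcomp (whisk ep1 er1 g) (whisk er es f).
Proof.
have Ep : u ;; u' = p by rewrite -ep1 comp1r.
have Eq : v ;; u' = q by rewrite -eq1 comp1r.
have Er : u ;; v' = r by rewrite -er1 comp1r.
have Es : v ;; v' = s by rewrite -es1 comp1r.
by destruct Ep, Eq, Er, Es; apply: whisk_exchange.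
Qed.

Lemma whisk_conjl (x' x y y' : C) (a a' : hom x' x) (b : hom y y')
    (u : hom x y) (p p' : hom x' y')
    (e : a ;; u ;; b = p) (e' : a' ;; u ;; b = p')
    (f : cell u u) (h : cell a a') :
  exists k : cell p p', vcomp (whisk e e f) k = vcomp k (whisk e' e' f).
Proof.
have eub : idc x ;; u ;; b = u ;; b by rewrite comp1l.
have e1 : idc x' ;; a ;; (u ;; b) = p by rewrite comp1l compA.
have e1' : idc x' ;; a' ;; (u ;; b) = p' by rewrite comp1l compA.
have e2 : a ;; (u ;; b) ;; idc y' = p by rewrite comp1r compA.
have e2' : a' ;; (u ;; b) ;; idc y' = p' by rewrite comp1r compA.
have e3 : (a ;; idc x) ;; u ;; (b ;; idc y') = p by rewrite !comp1r.
have e3' : (a' ;; idc x) ;; u ;; (b ;; idc y') = p' by rewrite !comp1r.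
exists (whisk e1 e1' h).
have -> : whisk e e f = whisk e2 e2 (whisk eub eub f).
  by rewrite (whiskM _ _ _ _ e3 e3); apply: whisk_eq; rewrite comp1r.
have -> : whisk e' e' f = whisk e2' e2' (whisk eub eub f).
  by rewrite (whiskM _ _ _ _ e3' e3'); apply: whisk_eq; rewrite comp1r.
by symmetry; apply: whisk_exchange_eq.
Qed.

Lemma whisk_conjr (x' x y y' : C) (a : hom x' x) (b b' : hom y y')
    (u : hom x y) (p p' : hom x' y')
    (e : a ;; u ;; b = p) (e' : a ;; u ;; b' = p')
    (f : cell u u) (h : cell b b') :
  exists k : cell p p', vcomp (whisk e e f) k = vcomp k (whisk e' e' f).
Proof.
have eau : a ;; u ;; idc y = a ;; u by rewrite comp1r.
have e1 : a ;; u ;; b ;; idc y' = p by rewrite comp1r.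
have e1' : a ;; u ;; b' ;; idc y' = p' by rewrite comp1r.
have e2 : idc x' ;; (a ;; u) ;; b = p by rewrite comp1l.
have e2' : idc x' ;; (a ;; u) ;; b' = p' by rewrite comp1l.
have e3 : (idc x' ;; a) ;; u ;; (idc y ;; b) = p by rewrite !comp1l.
have e3' : (idc x' ;; a) ;; u ;; (idc y ;; b') = p' by rewrite !comp1l.
exists (whisk e1 e1' h).
have -> : whisk e e f = whisk e2 e2 (whisk eau eau f).
  by rewrite (whiskM _ _ _ _ e3 e3); apply: whisk_eq; rewrite comp1l.
have -> : whisk e' e' f = whisk e2' e2' (whisk eau eau f).
  by rewrite (whiskM _ _ _ _ e3' e3'); apply: whisk_eq; rewrite comp1l.
exact: whisk_exchange_eq.
Qed.
End Whiskering.

Section QuotientCat21.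
Variables (C : cat21).
Variable (R : forall (x y : C) (u v : hom x y), cell u v -> cell u v -> Prop).

Inductive cell_cong :
    forall (x y : C) (u v : hom x y), cell u v -> cell u v -> Prop :=
| cell_rel x y (u v : hom x y) (f g : cell u v) of R f g : cell_cong f g
| cell_refl x y (u v : hom x y) (f : cell u v) : cell_cong f f
| cell_sym x y (u v : hom x y) (f g : cell u v) of cell_cong f g :
    cell_cong g f
| cell_trans x y (u v : hom x y) (f g h : cell u v)
    of cell_cong f g & cell_cong g h : cell_cong f h
| cell_vcomp x y (u v w : hom x y) (f f' : cell u v) (g g' : cell v w)
    of cell_cong f f' & cell_cong g g' : cell_cong (vcomp f g) (vcomp f' g')
| cell_vinv x y (u v : hom x y) (f f' : cell u v)
    of cell_cong f f' : cell_cong (vinv f) (vinv f')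
| cell_whisk x' x y y' (a : hom x' x) (b : hom y y') (u v : hom x y)
    (u' v' : hom x' y') (eu : a ;; u ;; b = u') (ev : a ;; v ;; b = v')
    (f f' : cell u v)
    of cell_cong f f' : cell_cong (whisk eu ev f) (whisk eu ev f').

Lemma cell_congP x y (u v : hom x y) (f g : cell u v) :
  cls (@cell_cong x y u v) f = cls (@cell_cong x y u v) g <-> cell_cong f g.
Proof.
split=> [/clsP|]; last exact: cls_eq.
apply: rst_equiv => [a|a b|a b c].
- exact: cell_refl.
- exact: cell_sym.
- exact: cell_trans.
Qed.

Lemma rep_cell_cong x y (u v : hom x y) (f : cell u v) :
  cell_cong (rep (cls (@cell_cong x y u v) f)) f.
Proof. by apply/cell_congP; rewrite repK. Qed.

Definition qcell x y (u v : hom x y) := quo (@cell_cong x y u v).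
Definition qcls x y (u v : hom x y) (f : cell u v) : qcell u v :=
  cls (@cell_cong x y u v) f.
Definition qvcomp x y (u v w : hom x y) (f : qcell u v) (g : qcell v w) :
  qcell u w := qcls (vcomp (rep f) (rep g)).
Definition qvinv x y (u v : hom x y) (f : qcell u v) : qcell v u :=
  qcls (vinv (rep f)).
Definition qwhisk x' x y y' (a : hom x' x) (b : hom y y') (u v : hom x y)
    (u' v' : hom x' y') (eu : a ;; u ;; b = u') (ev : a ;; v ;; b = v')
    (f : qcell u v) : qcell u' v' := qcls (whisk eu ev (rep f)).

Lemma qvcompE x y (u v w : hom x y) (f : cell u v) (g : cell v w) :
  qvcomp (qcls f) (qcls g) = qcls (vcomp f g).
Proof. by apply/cell_congP/cell_vcomp; apply: rep_cell_cong. Qed.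

Lemma qvinvE x y (u v : hom x y) (f : cell u v) :
  qvinv (qcls f) = qcls (vinv f).
Proof. by apply/cell_congP/cell_vinv; apply: rep_cell_cong. Qed.

Lemma qwhiskE x' x y y' (a : hom x' x) (b : hom y y') (u v : hom x y)
    (u' v' : hom x' y') (eu : a ;; u ;; b = u') (ev : a ;; v ;; b = v')
    (f : cell u v) : qwhisk eu ev (qcls f) = qcls (whisk eu ev f).
Proof. by apply/cell_congP/cell_whisk; apply: rep_cell_cong. Qed.

Lemma qcls_surj x y (u v : hom x y) (q : qcell u v) : exists f, q = qcls f.
Proof. by exists (rep q); rewrite /qcls repK. Qed.

Definition quotient_cat21 : cat21.
Proof.
refine (@Cat21 C qcell (fun x y u => qcls (vid u)) qvcomp qvinv qwhisk
  _ _ _ _ _ _ _ _ _ _).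
- by move=> x y u v q; have [f ->] := qcls_surj q; rewrite qvcompE vcomp1l.
- by move=> x y u v q; have [f ->] := qcls_surj q; rewrite qvcompE vcomp1r.
- move=> x y u v w t q r s; have [f ->] := qcls_surj q.
  have [g ->] := qcls_surj r; have [h ->] := qcls_surj s.
  by rewrite !qvcompE vcompA.
- move=> x y u v q; have [f ->] := qcls_surj q.
  by rewrite qvinvE qvcompE vcompV.
- move=> x y u v q; have [f ->] := qcls_surj q.
  by rewrite qvinvE qvcompE vcompVl.
- by move=> *; rewrite qwhiskE whisk_vid.
- move=> x' x y y' a b u v w u' v' w' eu ev ew q r.
  have [f ->] := qcls_surj q; have [g ->] := qcls_surj r.
  by rewrite qvcompE !qwhiskE qvcompE (whisk_vcomp eu ev ew).
- move=> x y u v eu ev q; have [f ->] := qcls_surj q.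
  by rewrite qwhiskE whisk1.
- move=> x'' x' x y y' y'' a' a b b' u v u' v' u'' v''.
  move=> eu ev eu' ev' eu'' ev'' q; have [f ->] := qcls_surj q.
  by rewrite !qwhiskE (whiskM _ _ _ _ eu'' ev'').
- move=> x y z u v u' v' e1 e2 e3 e4 e5 e6 e7 e8 q r.
  have [f ->] := qcls_surj q; have [g ->] := qcls_surj r.
  by rewrite !qwhiskE !qvcompE (whisk_exchange e1 e2 e3 e4 e5 e6 e7 e8).
Defined.
End QuotientCat21.

Section Abelianisation.
Variable C : cat21.

Inductive closed_comm :
    forall (x y : C) (u v : hom x y), cell u v -> cell u v -> Prop :=
| ClosedComm x y (u : hom x y) (f g : cell u u) :
    closed_comm (vcomp f g) (vcomp g f).

Definition abelianised : cat21 := quotient_cat21 closed_comm.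
End Abelianisation.

Section HomotopyBasis.
Variable C : cat21.

Record sphere := Sphere {
  sph_src0 : C;
  sph_tgt0 : C;
  sph_src1 : hom sph_src0 sph_tgt0;
  sph_tgt1 : hom sph_src0 sph_tgt0;
  sph_src2 : cell sph_src1 sph_tgt1;
  sph_tgt2 : cell sph_src1 sph_tgt1
}.

(* A sphere is a pair of parallel 2-cells; quotienting by a set of spheres    *)
(* identifies the two sides of each of them.                                  *)
Definition cells_mod (G : set sphere) : cat21 :=
  @quotient_cat21 C (fun x y u v f g => G (Sphere f g)).

Definition homotopy_basis (G : set sphere) :=
  forall (x y : cells_mod G) (u v : hom x y) (f g : cell u v), f = g.
End HomotopyBasis.

Section FreeCat21.
Variable S : polygraph2.
Local Notation W := (words S).

(* The free (2,1)-category: formal composites of the generating 2-cells and   *)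
(* of formal inverses, modulo the congruence generated by the axioms of       *)
(* [cat21].                                                                   *)
Inductive expr : forall x y : W, hom x y -> hom x y -> Type :=
| egen (x y : W) (u v : hom x y) of @cell2 S x y u v : expr u v
| eid (x y : W) (u : hom x y) : expr u u
| ecomp (x y : W) (u v w : hom x y) of expr u v & expr v w : expr u w
| einv (x y : W) (u v : hom x y) of expr u v : expr v u
| ewhisk (x' x y y' : W) (a : hom x' x) (b : hom y y') (u v : hom x y)
    (u' v' : hom x' y') of a ;; u ;; b = u' & a ;; v ;; b = v' & expr u v :
    expr u' v'.

Inductive expr_eq : forall (x y : W) (u v : hom x y),
    expr u v -> expr u v -> Prop :=
| ee_refl (x y : W) (u v : hom x y) (f : expr u v) : expr_eq f f
| ee_sym (x y : W) (u v : hom x y) (f g : expr u v) of expr_eq f g :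
    expr_eq g f
| ee_trans (x y : W) (u v : hom x y) (f g h : expr u v)
    of expr_eq f g & expr_eq g h : expr_eq f h
| ee_comp (x y : W) (u v w : hom x y) (f f' : expr u v) (g g' : expr v w)
    of expr_eq f f' & expr_eq g g' : expr_eq (ecomp f g) (ecomp f' g')
| ee_inv (x y : W) (u v : hom x y) (f f' : expr u v)
    of expr_eq f f' : expr_eq (einv f) (einv f')
| ee_whisk (x' x y y' : W) (a : hom x' x) (b : hom y y') (u v : hom x y)
    (u' v' : hom x' y') (eu : a ;; u ;; b = u') (ev : a ;; v ;; b = v')
    (f f' : expr u v)
    of expr_eq f f' : expr_eq (ewhisk eu ev f) (ewhisk eu ev f')
| ee_comp1l (x y : W) (u v : hom x y) (f : expr u v) :
    expr_eq (ecomp (eid u) f) f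
| ee_comp1r (x y : W) (u v : hom x y) (f : expr u v) :
    expr_eq (ecomp f (eid v)) f
| ee_compA (x y : W) (u v w t : hom x y)
    (f : expr u v) (g : expr v w) (h : expr w t) :
    expr_eq (ecomp f (ecomp g h)) (ecomp (ecomp f g) h)
| ee_compV (x y : W) (u v : hom x y) (f : expr u v) :
    expr_eq (ecomp f (einv f)) (eid u)
| ee_compVl (x y : W) (u v : hom x y) (f : expr u v) :
    expr_eq (ecomp (einv f) f) (eid v)
| ee_whisk_id (x' x y y' : W) (a : hom x' x) (b : hom y y') (u : hom x y)
    (u' : hom x' y') (e e' : a ;; u ;; b = u') :
    expr_eq (ewhisk e e' (eid u)) (eid u')
| ee_whisk_comp (x' x y y' : W) (a : hom x' x) (b : hom y y')
    (u v w : hom x y) (u' v' w' : hom x' y')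
    (eu : a ;; u ;; b = u') (ev : a ;; v ;; b = v') (ew : a ;; w ;; b = w')
    (f : expr u v) (g : expr v w) :
    expr_eq (ewhisk eu ew (ecomp f g))
            (ecomp (ewhisk eu ev f) (ewhisk ev ew g))
| ee_whisk1 (x y : W) (u v : hom x y)
    (eu : idc x ;; u ;; idc y = u) (ev : idc x ;; v ;; idc y = v)
    (f : expr u v) : expr_eq (ewhisk eu ev f) f
| ee_whiskM (x'' x' x y y' y'' : W) (a' : hom x'' x') (a : hom x' x)
    (b : hom y y') (b' : hom y' y'') (u v : hom x y) (u' v' : hom x' y')
    (u'' v'' : hom x'' y'')
    (eu : a ;; u ;; b = u') (ev : a ;; v ;; b = v')
    (eu' : a' ;; u' ;; b' = u'') (ev' : a' ;; v' ;; b' = v'')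
    (eu'' : (a' ;; a) ;; u ;; (b ;; b') = u'')
    (ev'' : (a' ;; a) ;; v ;; (b ;; b') = v'') (f : expr u v) :
    expr_eq (ewhisk eu' ev' (ewhisk eu ev f)) (ewhisk eu'' ev'' f)
| ee_exchange (x y z : W) (u v : hom x y) (u' v' : hom y z)
    (euu' : idc x ;; u ;; u' = u ;; u') (evu' : idc x ;; v ;; u' = v ;; u')
    (euv' : idc x ;; u ;; v' = u ;; v') (evv' : idc x ;; v ;; v' = v ;; v')
    (euu'1 : u ;; u' ;; idc z = u ;; u') (euv'1 : u ;; v' ;; idc z = u ;; v')
    (evu'1 : v ;; u' ;; idc z = v ;; u') (evv'1 : v ;; v' ;; idc z = v ;; v')
    (f : expr u v) (g : expr u' v') :
    expr_eq (ecomp (ewhisk euu' evu' f) (ewhisk evu'1 evv'1 g))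
            (ecomp (ewhisk euu'1 euv'1 g) (ewhisk euv' evv' f)).

Lemma expr_eqP (x y : W) (u v : hom x y) (f g : expr u v) :
  cls (@expr_eq x y u v) f = cls (@expr_eq x y u v) g <-> expr_eq f g.
Proof.
split=> [/clsP|]; last exact: cls_eq.
apply: rst_equiv => [a|a b|a b c].
- exact: ee_refl.
- exact: ee_sym.
- exact: ee_trans.
Qed.

Lemma rep_expr_eq (x y : W) (u v : hom x y) (f : expr u v) :
  expr_eq (rep (cls (@expr_eq x y u v) f)) f.
Proof. by apply/expr_eqP; rewrite repK. Qed.

Definition fcell (x y : W) (u v : hom x y) := quo (@expr_eq x y u v).
Definition ecls (x y : W) (u v : hom x y) (f : expr u v) : fcell u v :=
  cls (@expr_eq x y u v) f.
Definition fcomp (x y : W) (u v w : hom x y) (f : fcell u v) (g : fcell v w) :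
  fcell u w := ecls (ecomp (rep f) (rep g)).
Definition finv (x y : W) (u v : hom x y) (f : fcell u v) : fcell v u :=
  ecls (einv (rep f)).
Definition fwhisk (x' x y y' : W) (a : hom x' x) (b : hom y y') (u v : hom x y)
    (u' v' : hom x' y') (eu : a ;; u ;; b = u') (ev : a ;; v ;; b = v')
    (f : fcell u v) : fcell u' v' := ecls (ewhisk eu ev (rep f)).

Lemma fcompE (x y : W) (u v w : hom x y) (f : expr u v) (g : expr v w) :
  fcomp (ecls f) (ecls g) = ecls (ecomp f g).
Proof. by apply/expr_eqP/ee_comp; apply: rep_expr_eq. Qed.

Lemma finvE (x y : W) (u v : hom x y) (f : expr u v) :
  finv (ecls f) = ecls (einv f).
Proof. by apply/expr_eqP/ee_inv; apply: rep_expr_eq. Qed.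

Lemma fwhiskE (x' x y y' : W) (a : hom x' x) (b : hom y y') (u v : hom x y)
    (u' v' : hom x' y') (eu : a ;; u ;; b = u') (ev : a ;; v ;; b = v')
    (f : expr u v) : fwhisk eu ev (ecls f) = ecls (ewhisk eu ev f).
Proof. by apply/expr_eqP/ee_whisk; apply: rep_expr_eq. Qed.

Lemma ecls_surj (x y : W) (u v : hom x y) (q : fcell u v) :
  exists f, q = ecls f.
Proof. by exists (rep q); rewrite /ecls repK. Qed.

Definition free_cat21 : cat21.
Proof.
refine (@Cat21 W fcell (fun x y u => ecls (eid u)) fcomp finv fwhisk
  _ _ _ _ _ _ _ _ _ _).
- move=> x y u v q; have [f ->] := ecls_surj q.
  by rewrite fcompE; apply/expr_eqP/ee_comp1l.
- move=> x y u v q; have [f ->] := ecls_surj q.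
  by rewrite fcompE; apply/expr_eqP/ee_comp1r.
- move=> x y u v w t q r s; have [f ->] := ecls_surj q.
  have [g ->] := ecls_surj r; have [h ->] := ecls_surj s.
  by rewrite !fcompE; apply/expr_eqP/ee_compA.
- move=> x y u v q; have [f ->] := ecls_surj q.
  by rewrite finvE fcompE; apply/expr_eqP/ee_compV.
- move=> x y u v q; have [f ->] := ecls_surj q.
  by rewrite finvE fcompE; apply/expr_eqP/ee_compVl.
- by move=> *; rewrite fwhiskE; apply/expr_eqP/ee_whisk_id.
- move=> x' x y y' a b u v w u' v' w' eu ev ew q r.
  have [f ->] := ecls_surj q; have [g ->] := ecls_surj r.
  by rewrite fcompE !fwhiskE fcompE; apply/expr_eqP/ee_whisk_comp.
- move=> x y u v eu ev q; have [f ->] := ecls_surj q.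
  by rewrite fwhiskE; apply/expr_eqP/ee_whisk1.
- move=> x'' x' x y y' y'' a' a b b' u v u' v' u'' v''.
  move=> eu ev eu' ev' eu'' ev'' q; have [f ->] := ecls_surj q.
  by rewrite !fwhiskE; apply/expr_eqP/ee_whiskM.
- move=> x y z u v u' v' e1 e2 e3 e4 e5 e6 e7 e8 q r.
  have [f ->] := ecls_surj q; have [g ->] := ecls_surj r.
  by rewrite !fwhiskE !fcompE; apply/expr_eqP/ee_exchange.
Defined.
End FreeCat21.

Definition FDTab (S : polygraph2) :=
  exists G : set (sphere (abelianised (free_cat21 S))),
    finite_set G /\ homotopy_basis G.

Definition category_FDTab (C : category) :=
  exists S : polygraph2,
    [/\ finite_polygraph S, inhabited (category_iso (presented S) C) & FDTab S].

Section HomologicalSyzygies.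
Variable S : polygraph2.
Local Notation FC := (factorisations (presented S)).

(* The symbol u[phi]v of F_C[S_k] is the pair of phi and of the morphism      *)
(* (u, v) of FC from the class of phi to u phi v.                             *)
Definition bar1 (a : gen1 S) : FC :=
  @Arrow (presented S) _ _ (wclass (pcons (gen1_cell a) (pnil _ _))).

Definition bar2 (a : gen2 S) : FC := @Arrow (presented S) _ _ (wclass (src2 a)).

Definition F1 : natural_system (presented S) := free_abfunctor bar1.
Definition F2 : natural_system (presented S) := free_abfunctor bar2.

Definition warrow (x y : cell0 S) (u : path (@cell1 S) x y) : FC :=
  @Arrow (presented S) x y (wclass u).

Lemma wclass_cat (x y z : cell0 S) (u : path (@cell1 S) x y)
    (v : path (@cell1 S) y z) :
  @comp (presented S) _ _ _ (wclass u) (wclass v) = wclass (pcat u v).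
Proof. exact: qclass_comp. Qed.

Lemma mulr_fact_subproof (x y z : cell0 S) (u : path (@cell1 S) x y)
    (v : path (@cell1 S) y z) :
  @idc (presented S) x ;; acell (warrow u) ;; wclass v = wclass (pcat u v).
Proof. by rewrite comp1l wclass_cat. Qed.

Lemma mull_fact_subproof (x y z : cell0 S) (u : path (@cell1 S) x y)
    (v : path (@cell1 S) y z) :
  @comp (presented S) _ _ _ (wclass u) (acell (warrow v)) ;;
    @idc (presented S) z = wclass (pcat u v).
Proof. by rewrite comp1r wclass_cat. Qed.

Definition mulr_fact (x y z : cell0 S) (u : path (@cell1 S) x y)
    (v : path (@cell1 S) y z) : @hom FC (warrow u) (warrow (pcat u v)) :=
  @Fact (presented S) (warrow u) (warrow (pcat u v)) _ _ (mulr_fact_subproof u v).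

Definition mull_fact (x y z : cell0 S) (u : path (@cell1 S) x y)
    (v : path (@cell1 S) y z) : @hom FC (warrow v) (warrow (pcat u v)) :=
  @Fact (presented S) (warrow v) (warrow (pcat u v)) _ _ (mull_fact_subproof u v).

Definition bracket_gen (a : gen1 S) : F1 (bar1 a) :=
  fgen (@Symbol FC _ bar1 _ a (idc (bar1 a))).

(* Defined by recursion on words; [bracket_cat] is the general rule           *)
(* [uv] = [u]v + u[v].                                                        *)
Fixpoint bracket (x y : cell0 S) (u : path (@cell1 S) x y) : F1 (warrow u) :=
  match u in path _ x y return F1 (warrow u) with
  | pnil _ => 0
  | pcons _ _ _ e v =>
      abmap F1 (mulr_fact (pcons e (pnil _ _)) v) (bracket_gen (Gen1 e)) +
      abmap F1 (mull_fact (pcons e (pnil _ _)) v) (bracket v)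
  end.

Lemma bracket_cat (x y z : cell0 S) (u : path (@cell1 S) x y)
    (v : path (@cell1 S) y z) :
  bracket (pcat u v) =
    abmap F1 (mulr_fact u v) (bracket u) + abmap F1 (mull_fact u v) (bracket v).
Proof.
elim: u v => [{}x|{}x {}y y' e u IH] v.
  have -> : abmap F1 (mulr_fact (pnil _ x) v) (bracket (pnil _ x)) = 0.
    exact: raddf0.
  rewrite add0r -[LHS]abmap1.
  by congr (abmap F1 _ _); apply: fact_eq.
rewrite -[LHS]/(abmap F1 (mulr_fact (pcons e (pnil _ _)) (pcat u v)) _ +
  abmap F1 (mull_fact (pcons e (pnil _ _)) (pcat u v)) (bracket (pcat u v))).
rewrite IH -[bracket (pcons e u)]/(
  abmap F1 (mulr_fact (pcons e (pnil _ _)) u) (bracket_gen (Gen1 e)) +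
  abmap F1 (mull_fact (pcons e (pnil _ _)) u) (bracket u)).
rewrite 2!raddfD addrA -!abmapM.
have fE k k' t : k = k' -> abmap F1 k t = abmap F1 k' t by move=> ->.
congr (_ + _ + _).
- by apply/fE/fact_eq; [exact/esym/comp1l|exact/esym/wclass_cat].
- apply/fE/fact_eq; first exact: etrans (comp1r _) (esym (comp1l _)).
  exact: etrans (comp1r _) (esym (comp1l _)).
- by apply/fE/fact_eq; [exact: wclass_cat|exact: comp1l].
Qed.

Lemma wclass_cell (a : gen2 S) : wclass (tgt2 a) = wclass (src2 a).
Proof. by apply/esym/cat_congP/cc_rel; split; apply: gen2_cell. Qed.

Lemma tgt_fact_subproof (a : gen2 S) :
  @idc (presented S) _ ;; acell (warrow (tgt2 a)) ;; @idc (presented S) _ =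
    acell (bar2 a).
Proof. by rewrite comp1l comp1r /= wclass_cell. Qed.

(* The source and the target of a 2-cell have equal classes, but not by       *)
(* computation: this isomorphism of FC, whose components are identities,      *)
(* moves [t(a)] to the fibre of [s(a)].                                       *)
Definition tgt_fact (a : gen2 S) : @hom FC (warrow (tgt2 a)) (bar2 a) :=
  @Fact (presented S) (warrow (tgt2 a)) (bar2 a) _ _ (tgt_fact_subproof a).

Definition delta2 : abnat F2 F1 :=
  @free_abnat FC _ bar2 F1 (fun a =>
    bracket (src2 a) - abmap F1 (tgt_fact a) (bracket (tgt2 a))).

Definition h2 : natural_system (presented S) := kernel delta2.
End HomologicalSyzygies.

Section IdentitiesAmongRelations.
Variable S : polygraph2.
Local Notation W := (words S).
Local Notation C := (presented S).
Local Notation T := (free_cat21 S).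
Local Notation "u ;;; v" := (@comp W _ _ _ u v) (at level 50, left associativity).

Lemma wclass_rep (x y : cell0 S) (q : @hom C x y) : wclass (rep q) = q.
Proof. exact: repK. Qed.

Section Values.
Variable w : arrow C.

Record closed_cell := ClosedCell {
  closed_base : @hom W (asrc w) (atgt w);
  closed_class : wclass closed_base = acell w;
  closed_2cell : @cell T _ _ closed_base closed_base
}.

Inductive identity_relation : freeab closed_cell -> Prop :=
| ir_add v (e : wclass v = acell w) (f g : @cell T _ _ v v) :
    identity_relation (fgen (ClosedCell e (vcomp f g)) -
      (fgen (ClosedCell e f) + fgen (ClosedCell e g)))
| ir_comm v v' (e : wclass v = acell w) (e' : wclass v' = acell w)
    (f : @cell T _ _ v v') (g : @cell T _ _ v' v) :
    identity_relation (fgen (ClosedCell e (vcomp f g)) -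
      fgen (ClosedCell e' (vcomp g f))).

Definition identities : zmodType := presab identity_relation.

Definition floor (c : closed_cell) : identities := pgen identity_relation c.

Lemma floor_add v (e : wclass v = acell w) (f g : @cell T _ _ v v) :
  floor (ClosedCell e (vcomp f g)) =
    floor (ClosedCell e f) + floor (ClosedCell e g).
Proof.
rewrite /floor /pgen -raddfD; apply/eqP; rewrite -subr_eq0 -raddfB.
by apply/eqP/presab_rel/ir_add.
Qed.

Lemma floor_comm v v' (e : wclass v = acell w) (e' : wclass v' = acell w)
    (f : @cell T _ _ v v') (g : @cell T _ _ v' v) :
  floor (ClosedCell e (vcomp f g)) = floor (ClosedCell e' (vcomp g f)).
Proof.
rewrite /floor /pgen; apply/eqP; rewrite -subr_eq0 -raddfB.
by apply/eqP/presab_rel/ir_comm.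
Qed.

Lemma floor_conj v v' (e : wclass v = acell w) (e' : wclass v' = acell w)
    (f : @cell T _ _ v v) (f' : @cell T _ _ v' v') (h : @cell T _ _ v v') :
  vcomp f h = vcomp h f' -> floor (ClosedCell e f) = floor (ClosedCell e' f').
Proof.
move=> fh; have -> : f = vcomp h (vcomp f' (vinv h)).
  by rewrite vcompA -fh -vcompA vcompV vcomp1r.
by rewrite (floor_comm e e') -vcompA vcompVl vcomp1r.
Qed.

Lemma floor_pirr v (e e' : wclass v = acell w) (f : @cell T _ _ v v) :
  floor (ClosedCell e f) = floor (ClosedCell e' f).
Proof. by rewrite (Prop_irrelevance e e'). Qed.

Lemma floor_whisk_eq (x y : W) (a : hom _ x) (b : hom y _) (u : hom x y)
    (v v' : @hom W (asrc w) (atgt w))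
    (e : wclass v = acell w) (e' : wclass v' = acell w)
    (E : a ;; u ;; b = v) (E' : a ;; u ;; b = v') (f : @cell T _ _ u u) :
  floor (ClosedCell e (@whisk T _ _ _ _ _ _ _ _ _ _ E E f)) =
  floor (ClosedCell e' (@whisk T _ _ _ _ _ _ _ _ _ _ E' E' f)).
Proof. by destruct E, E'; apply: floor_pirr. Qed.

Lemma floor_whisk1 (v v' : @hom W (asrc w) (atgt w))
    (e : wclass v = acell w) (e' : wclass v' = acell w)
    (E : @idc W _ ;; v ;; @idc W _ = v') (f : @cell T _ _ v v) :
  floor (ClosedCell e' (@whisk T _ _ _ _ _ _ _ _ _ _ E E f)) =
  floor (ClosedCell e f).
Proof.
have E1 : @idc W _ ;; v ;; @idc W _ = v by rewrite comp1l comp1r.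
by rewrite (floor_whisk_eq _ e _ E1) whisk1.
Qed.
End Values.

Lemma whisk_class_subproof (w w' : arrow C) (k : fact w w')
    (a : @hom W (asrc w') (asrc w)) (b : @hom W (atgt w) (atgt w'))
    (ea : wclass a = factl k) (eb : wclass b = factr k) (c : closed_cell w) :
  wclass (a ;; closed_base c ;; b) = acell w'.
Proof. by rewrite -!wclass_cat ea eb (closed_class c) (factE k). Qed.

Definition whisk_closed (w w' : arrow C) (k : fact w w')
    (a : @hom W (asrc w') (asrc w)) (b : @hom W (atgt w) (atgt w'))
    (ea : wclass a = factl k) (eb : wclass b = factr k) (c : closed_cell w) :
    closed_cell w' :=
  ClosedCell (whisk_class_subproof ea eb c)
    (@whisk T _ _ _ _ a b _ _ _ _ erefl erefl (closed_2cell c)).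

Lemma whisk_closedE (w w' : arrow C) (k : fact w w') a b
    (ea : wclass a = factl k) (eb : wclass b = factr k)
    (v : @hom W (asrc w) (atgt w)) (e : wclass v = acell w)
    (f : @cell T _ _ v v) (E : wclass (a ;;; v ;;; b) = acell w') :
  whisk_closed ea eb (ClosedCell e f) =
    ClosedCell E (@whisk T _ _ _ _ a b _ _ _ _ erefl erefl f).
Proof. by rewrite (Prop_irrelevance E (whisk_class_subproof ea eb (ClosedCell e f))). Qed.

Lemma wclass_eq_cell (x y : W) (u v : hom x y) :
  @wclass S x y u = wclass v -> inhabited (@cell T x y u v).
Proof.
move/cat_congP; elim=> {x y u v}.
- by move=> x y u v [a]; split; apply: ecls; apply: egen a.
- by move=> x y u; split; apply: vid.
- by move=> x y u v _ [f]; split; apply: vinv f.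
- by move=> x y u v w _ [f] _ [g]; split; apply: vcomp f g.
- move=> x y z u u' v v' _ [f] _ [g]; split.
  apply: (@vcomp T _ _ _ (u' ;; v)).
    by apply: (@whisk T x x y z (idc x) v u u' _ _ _ _ f); rewrite comp1l.
  by apply: (@whisk T x y z z u' (idc z) v v' _ _ _ _ g); rewrite comp1r.
Qed.

Lemma whisk_closed_indep (w w' : arrow C) (k : fact w w') a a' b b'
    (ea : wclass a = factl k) (ea' : wclass a' = factl k)
    (eb : wclass b = factr k) (eb' : wclass b' = factr k) (c : closed_cell w) :
  floor (whisk_closed ea eb c) = floor (whisk_closed ea' eb' c).
Proof.
have [h] : inhabited (@cell T _ _ a a') by apply: wclass_eq_cell; rewrite ea ea'.
have [g] : inhabited (@cell T _ _ b b') by apply: wclass_eq_cell; rewrite eb eb'.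
pose d := whisk_closed ea' eb c.
transitivity (floor d).
  have [l hl] := @whisk_conjl T _ _ _ _ a a' b _ _ _ erefl erefl
    (closed_2cell c) h.
  exact: floor_conj hl.
have [l hl] := @whisk_conjr T _ _ _ _ a' b b' _ _ _ erefl erefl
  (closed_2cell c) g.
exact: floor_conj hl.
Qed.

Section Action.
Variables (w w' : arrow C) (k : fact w w').

(* The representatives are the ones chosen by [rep]; [identity_actE] shows    *)
(* that any others define the same action.                                    *)
Definition identity_act_gen (c : closed_cell w) : identities w' :=
  floor (whisk_closed (wclass_rep (factl k)) (wclass_rep (factr k)) c).

Lemma identity_act_rel r :
  identity_relation r -> freeab_lift identity_act_gen r = 0.
Proof.
have E v : wclass v = acell w -> wclass (rep (factl k) ;;; v ;;; rep (factr k)) = acell w'.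
  by move=> e; rewrite -!wclass_cat e !wclass_rep factE.
case=> [v e f g|v v' e e' f g].
  rewrite raddfB raddfD !freeab_liftE /identity_act_gen !(whisk_closedE _ _ _ _ (E _ e)).
  by rewrite (whisk_vcomp _ erefl) floor_add subrr.
rewrite raddfB !freeab_liftE /identity_act_gen.
rewrite (whisk_closedE _ _ _ _ (E _ e)) (whisk_closedE _ _ _ _ (E _ e')).
rewrite (whisk_vcomp _ erefl) [in X in _ - X](whisk_vcomp _ erefl).
by rewrite (floor_comm _ (E _ e')) subrr.
Qed.

Definition identity_act : {additive identities w -> identities w'} :=
  presab_lift identity_act_rel.

Lemma identity_actE a b (ea : wclass a = factl k) (eb : wclass b = factr k)
    (c : closed_cell w) :
  identity_act (floor c) = floor (whisk_closed ea eb c).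
Proof. by rewrite [LHS]presab_liftE; apply: whisk_closed_indep. Qed.
End Action.

Lemma identity_act1 (w : factorisations C) (q : identities w) :
  identity_act (idc w) q = q.
Proof.
move: q; apply: (@presab_ext _ _ _ _ (mk_additive (@id_zmod_morphism _))) => c.
rewrite (@identity_actE _ _ _ (@idc W _) (@idc W _)) //.
by case: c => v e f; apply: floor_whisk1.
Qed.

Lemma identity_actM (w w' w'' : factorisations C) (k : hom w w') (l : hom w' w'')
    (q : identities w) :
  identity_act (k ;; l) q = identity_act l (identity_act k q).
Proof.
move: q.
apply: (@presab_ext _ _ _ _ (identity_act l \o identity_act k)) => c.
have ea : wclass (rep (factl l) ;;; rep (factl k)) = factl (k ;; l).
  by rewrite -wclass_cat !wclass_rep.
have eb : wclass (rep (factr k) ;;; rep (factr l)) = factr (k ;; l).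
  by rewrite -wclass_cat !wclass_rep.
rewrite (identity_actE ea eb) -[RHS]/(identity_act l (identity_act k (floor c))).
rewrite (identity_actE (wclass_rep _) (wclass_rep _)) (identity_actE (wclass_rep _) (wclass_rep _)).
case: c => v e f.
have E : (rep (factl l) ;;; rep (factl k)) ;;; v ;;;
      (rep (factr k) ;;; rep (factr l)) =
    rep (factl l) ;;; (rep (factl k) ;;; v ;;; rep (factr k)) ;;;
      rep (factr l) by rewrite !compA.
have E' := whisk_class_subproof (wclass_rep (factl l)) (wclass_rep (factr l))
  (whisk_closed (wclass_rep (factl k)) (wclass_rep (factr k)) (ClosedCell e f)).
transitivity (floor (ClosedCell E' (@whisk T _ _ _ _ _ _ _ _ _ _ E E f))).
  exact: floor_whisk_eq.
rewrite -(@whiskM T _ _ _ _ _ _ _ _ _ _ _ _ _ _ _ _ erefl erefl erefl erefl E E f).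
exact: floor_pirr.
Qed.

Definition Pi : natural_system C := @AbFunctor (factorisations C) identities
  identity_act identity_act1 identity_actM.
End IdentitiesAmongRelations.

(* The category presented by [S] is only isomorphic to [C]; a natural system  *)
(* on it becomes one on [C] by precomposition with the induced isomorphism    *)
(* between the categories of factorisations.                                  *)
Definition along_presentation (S : polygraph2) (C : category)
    (I : category_iso (presented S) C) (D : natural_system (presented S)) :
    natural_system C :=
  pullback (factorisations_functor (iso_from I)) D.

(* Main.v *)
(* Write ^u for a chosen word in the class of u. The complex                  *)
(* F2 -> F1 -> F0 -> Z of a presentation has a contraction, additive but not  *)
(* natural, given by chosen words and by chosen 2-cells                       *)
(* kappa_(e,q) : e ^q => ^(eq) for each letter e. Hence it is exact, and a    *)
(* comparison of resolutions relates FP3 to the finite generation of its      *)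
(* kernel h2. Composing the kappa gives 2-cells sigma_u : u => ^u, and        *)
(* psi(f) = floor(sigma_u^-1 f sigma_v), for f : u => v, is additive and      *)
(* compatible with whiskering up to classes. The additive map                 *)
(* a[alpha]b |-> psi(^a alpha ^b) from F2 to Pi is a left inverse of          *)
(* floor f |-> [f], and the other composite is 1 - eta delta2 with eta the    *)
(* contraction; so Pi is isomorphic to h2. Finally Pi at the class of u is    *)
(* mapped to the automorphisms of ^u in any quotient of the abelian free      *)
(* (2,1)-category, which turns generators of Pi into a homotopy basis;        *)
(* conversely, 2-cells f, g such that psi(f) - psi(g) lies in a given         *)
(* subsystem of Pi form a congruence, so the spheres of a homotopy basis      *)
(* generate Pi. The homological condition (i) transports the properties from  *)
(* one presentation to another.                                               *)
From HB Require Import structures.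
Require Import Defs.
From mathcomp Require Import all_boot.
From mathcomp Require Import ssralg ssrint.
From mathcomp Require Import boolp classical_sets cardinality.

Set Implicit Arguments.
Unset Strict Implicit.
Unset Printing Implicit Defensive.

Import GRing.Theory.
Local Open Scope ring_scope.

(** * Functors to abelian groups *)

(** Everything passes through [h2 S]. The complex F2 -> F1 -> F0 -> Z of a finite presentation
    consists of finitely generated free natural systems and is exact ([exact_delta2_delta1],
    [exact_delta1_augmentation], [augmentation_surjective]). If its kernel [h2 S] is finitely
    generated, a finite generating family splices one more free term onto the complex ([fg_h2_FP3]).
    Conversely, comparison with an arbitrary partial resolution, as in Schanuel's lemma, bounds the
    generators of [h2 S] ([fg_kernel_comparison], [FP3_fg_h2]).

    The derivation f |-> [f] is a Fox calculus for 2-cells: its boundary is [u] - [v]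
    ([delta2_bracket2]), so closed cells give syzygies and there is a map from [Pi S] to [h2 S]. It
    is invertible. Chosen cells from each word to the chosen word of its class close any 2-cell into
    a loop, which defines [phi] from F2 to [Pi S]; one composite is the identity
    ([phi_identity_bracket]), the other differs from it by a term that vanishes on the kernel
    ([identity_bracket_phi]).

    Parallel cells f, g amount to the loop f g^-1, and every element of [Pi S] is the class of one
    loop ([floor_surj]). Since loops at a word commute after abelianisation, [Pi S] maps to them,
    and killing generators of [Pi S] kills all loops ([fg_Pi_FDTab]). Conversely, the loops of the
    spheres of a homotopy basis generate [Pi S] ([FDTab_fg_Pi]).

    The four conditions are proved in a cycle. The return from the last to the first works with
    whichever presentation witnesses it; as the first condition mentions no presentation, this also
    gives independence of the presentation. Finite generation is moved between C and the presented
    category by [fg_pullback]. *)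

Lemma comp_zmod_morphism (U V W : zmodType) (f : {additive U -> V})
    (g : {additive V -> W}) : zmod_morphism (g \o f).
Proof. by move=> a b; rewrite /= !raddfB. Qed.

Lemma sub_zmod_morphism (U V : zmodType) (f g : {additive U -> V}) :
  zmod_morphism (fun a => f a - g a).
Proof. by move=> a b /=; rewrite (raddfB f) (raddfB g) !opprD addrACA. Qed.

Lemma sum_eq1 (V : zmodType) (I : finType) (F : I -> V) j :
  (forall i, i != j -> F i = 0) -> \sum_i F i = F j.
Proof. by move=> F0; rewrite (bigD1 j) //= big1 ?addr0. Qed.

Lemma finite_set_enum (T : Type) (A : set T) :
  finite_set A -> exists n (f : 'I_n -> T), A = range f.
Proof.
move=> /(@finite_seqP {classic T}) [s sE]; exists (size s), (tnth (in_tuple s)).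
rewrite [LHS]sE; apply/seteqP; split=> [a /= sa|_ [i _ <-]].
  by have /tnthP [i ->] : a \in in_tuple s by []; exists i.
exact: (mem_tnth i (in_tuple s)).
Qed.

Section AbNat.
Variable C : category.

Section Comp.
Variables (D E F : abfunctor C) (p : abnat D E) (q : abnat E F).

Lemma abnat_comp_subproof x y (f : hom x y) (a : D x) :
  mk_additive (comp_zmod_morphism (p y) (q y)) (abmap D f a) =
    abmap F f (mk_additive (comp_zmod_morphism (p x) (q x)) a).
Proof. by rewrite /= !abnatE. Qed.

Definition abnat_comp : abnat D F := AbNat abnat_comp_subproof.
End Comp.

Section Sub.
Variables (D E : abfunctor C) (p q : abnat D E).

Lemma abnat_sub_subproof x y (f : hom x y) (a : D x) :
  mk_additive (sub_zmod_morphism (p y) (q y)) (abmap D f a) =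
    abmap E f (mk_additive (sub_zmod_morphism (p x) (q x)) a).
Proof. by rewrite /= !abnatE raddfB. Qed.

Definition abnat_sub : abnat D E := AbNat abnat_sub_subproof.
End Sub.

Section Id.
Variable D : abfunctor C.

Definition abnat_id : abnat D D :=
  @AbNat C D D (fun x => mk_additive (@id_zmod_morphism (D x)))
    (fun _ _ _ _ => erefl).
End Id.

Section Corestrict.
Variables (D E F : abfunctor C) (q : abnat E F) (p : abnat D E).
Hypothesis qp0 : forall x a, q x (p x a) = 0.

Lemma corestrict_in x (a : D x) : p x a \in @ker_pred _ _ _ q x.
Proof. by rewrite unfold_in /ker_pred qp0. Qed.

Definition corestrict_fun x (a : D x) : kernel q x := Ker (corestrict_in a).

Lemma corestrict_zmod_morphism x : zmod_morphism (@corestrict_fun x).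
Proof. by move=> a b; apply: val_inj; rewrite /= !raddfB. Qed.

Lemma corestrict_subproof x y (f : hom x y) (a : D x) :
  mk_additive (@corestrict_zmod_morphism y) (abmap D f a) =
    abmap (kernel q) f (mk_additive (@corestrict_zmod_morphism x) a).
Proof. by apply: val_inj; rewrite /= abnatE. Qed.

Definition corestrict : abnat D (kernel q) := AbNat corestrict_subproof.
End Corestrict.

Lemma ker_valP (D E : abfunctor C) (p : abnat D E) x (a : kernel p x) :
  p x (ker_val a) = 0.
Proof. by case: a => a /= /eqP. Qed.

Section KernelInclusion.
Variables (D E : abfunctor C) (p : abnat D E).

Lemma ker_val_zmod_morphism x : zmod_morphism (@ker_val C D E p x).
Proof. by []. Qed.

Definition kernel_incl : abnat (kernel p) D :=
  @AbNat C (kernel p) D (fun x => mk_additive (@ker_val_zmod_morphism x))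
    (fun _ _ _ _ => erefl).
End KernelInclusion.

(** By exactness [p] corestricts to an epimorphism onto [kernel q], and [f] also lands in that
    kernel, so projectivity applies there. *)
Lemma lift_exact (P D E F : abfunctor C) (p : abnat D E) (q : abnat E F)
    (f : abnat P E) :
  projective P -> pointwise_exact p q -> (forall x a, q x (f x a) = 0) ->
  exists g : abnat P D, forall x a, p x (g x a) = f x a.
Proof.
move=> Pproj ex qf0.
have qp0 x a : q x (p x a) = 0 by apply/ex; exists a.
have sp : pointwise_surjective (corestrict qp0).
  move=> x b; have [a pa] := (ex x (ker_val b)).1 (ker_valP b).
  by exists a; apply: val_inj.
have [g gE] := Pproj _ _ _ (corestrict qf0) sp.
by exists g => x a; have /(congr1 (@ker_val _ _ _ _ _)) := gE x a.
Qed.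

Lemma free_abfunctor_ind I (s : I -> C) x (P : free_abfunctor s x -> Prop) :
    P 0 -> (forall y z, P y -> P z -> P (y - z)) ->
    (forall i (f : hom (s i) x), P (fgen (Symbol f))) -> forall z, P z.
Proof. by move=> P0 PB Pg; apply: freeab_ind => // -[i f]; apply: Pg. Qed.

Section FreeSurjections.
Variables (I : Type) (s : I -> C).

Lemma free_abnat_comp (D E : abfunctor C) (p : abnat D E)
    (d : forall i, D (s i)) x (z : free_abfunctor s x) :
  p x (free_abnat d x z) = free_abnat (fun i => p _ (d i)) x z.
Proof.
move: z; apply: (@freeab_ext _ _ (p x \o free_abnat d x)) => a.
by rewrite -[LHS]/(p x (free_abnat d x (fgen a))) !free_liftE abnatE.
Qed.

Lemma free_abnat_gen (D : abfunctor C) (d : forall i, D (s i)) i :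
  free_abnat d _ (fgen (Symbol (idc (s i)))) = d i.
Proof. by rewrite free_liftE abmap1. Qed.

Lemma free_abnat_surj_mor (D : abfunctor C) (d : forall i, D (s i))
    x y (f : hom x y) (a : D x) :
  (exists z, free_abnat d x z = a) ->
  exists z, free_abnat d y z = abmap D f a.
Proof.
by case=> z <-; exists (abmap (free_abfunctor s) f z); rewrite abnatE.
Qed.

Lemma free_generators : pointwise_surjective
  (@free_abnat C I s (free_abfunctor s) (fun i => fgen (Symbol (idc (s i))))).
Proof.
move=> x z; exists z; move: z.
pose idz := mk_additive (@id_zmod_morphism (free_abfunctor s x)).
apply: (@freeab_ext _ _ (free_abnat _ x) idz) => -[i f].
by rewrite free_liftE [LHS]free_mapE /symbol_map /= comp1l.
Qed.
End FreeSurjections.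

Lemma free_abnat_reindex (I J : Type) (h : J -> I) (s : I -> C)
    (D : abfunctor C) (d : forall i, D (s i)) :
  (forall i, exists j, h j = i) -> pointwise_surjective (free_abnat d) ->
  pointwise_surjective (free_abnat (fun j => d (h j))).
Proof.
move=> hs ds x a; have [z <-] := ds x a.
elim/freeab_ind: z => [|y z [y' yE] [z' zE]|[i f]].
- by exists 0; rewrite !raddf0.
- by exists (y' - z'); rewrite !raddfB yE zE.
- case: (hs i) f => j <- f.
  by exists (fgen (Symbol (s := fun j => s (h j)) f)); rewrite !free_liftE.
Qed.

Lemma free_abnat_surj_comp (D E : abfunctor C) (p : abnat D E) I (s : I -> C)
    (d : forall i, D (s i)) :
  pointwise_surjective p -> pointwise_surjective (free_abnat d) ->
  pointwise_surjective (free_abnat (fun i => p _ (d i))).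
Proof.
move=> ps ds x b; have [a <-] := ps x b; have [z <-] := ds x a.
by exists z; rewrite free_abnat_comp.
Qed.

(** * Finite direct sums of representables and generating families *)

Section DirectSumRepresentables.
Variables (n : nat) (w : 'I_n -> C).
Local Notation R := (direct_sum (fun i => representable (w i))).

(** Inclusion of a summand. The type of the summand depends on the index, so the test i = j must
    return an equality along which [z] is transported. *)
Definition single i x (z : representable (w i) x) : R x :=
  fun j => if eqP is ReflectT e then ecast k (representable (w k) x) e z else 0
    : representable (w j) x.

Lemma single_same i x z : @single i x z i = z.
Proof. by rewrite /single; case: eqP => // e; rewrite eq_axiomK. Qed.

Lemma single_neq i j x z : i != j -> @single i x z j = 0.
Proof. by rewrite /single; case: eqP. Qed.

Lemma single_is_zmod_morphism i x : zmod_morphism (@single i x).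
Proof.
move=> a b; apply: functional_extensionality_dep => j.
rewrite -[RHS]/(single a j - single b j).
have [<-|ij] := eqVneq i j; first by rewrite !single_same.
by rewrite !single_neq ?subr0.
Qed.

Lemma dsum_sumE (J : finType) x (F : J -> R x) j :
  (\sum_i F i : R x) j = \sum_i F i j.
Proof. by elim/big_rec2: _ => // i a b _ <-. Qed.

Lemma sum_single x (b : R x) : b = \sum_i single (b i).
Proof.
apply: functional_extensionality_dep => j; rewrite dsum_sumE.
apply: esym; rewrite (@sum_eq1 (representable (w j) x) _ _ j) ?single_same //.
by move=> i ij; rewrite single_neq.
Qed.

Lemma abmap_single i x y (f : hom x y) z :
  abmap R f (@single i x z) = single (abmap (representable (w i)) f z).
Proof.
apply: functional_extensionality_dep => j.
rewrite -[LHS]/(abmap (representable (w j)) f (single z j)).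
have [<-|ij] := eqVneq i j; first by rewrite !single_same.
by rewrite !single_neq ?raddf0.
Qed.

Variable D : abfunctor C.

Section ToD.
Variable d : forall i, D (w i).

Definition dsum_lift_fun x (b : R x) : D x :=
  \sum_i (freeab_lift (fun f : hom (w i) x => abmap D f (d i)) (b i)).

Lemma dsum_lift_zmod_morphism x : zmod_morphism (@dsum_lift_fun x).
Proof.
move=> a b; rewrite /dsum_lift_fun -sumrB; apply: eq_bigr => i _.
by rewrite -raddfB.
Qed.

Lemma dsum_lift_subproof x y (f : hom x y) (a : R x) :
  mk_additive (@dsum_lift_zmod_morphism y) (abmap R f a) =
    abmap D f (mk_additive (@dsum_lift_zmod_morphism x) a).
Proof.
rewrite -[LHS]/(dsum_lift_fun _) -[X in abmap D f X]/(dsum_lift_fun _).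
rewrite /dsum_lift_fun raddf_sum; apply: eq_bigr => i _.
rewrite -[abmap R f a i]/(repr_map (w i) f (a i)).
move: (a i); set l := freeab_lift _; set r := freeab_lift _.
apply: (@freeab_ext _ _ (l \o repr_map (w i) f) (abmap D f \o r)) => g.
rewrite -[LHS]/(l (repr_map (w i) f (fgen g))) -[RHS]/(abmap D f (r (fgen g))).
by rewrite repr_mapE !freeab_liftE abmapM.
Qed.

Definition dsum_lift : abnat R D := AbNat dsum_lift_subproof.

Lemma dsum_lift_single i x (f : hom (w i) x) :
  dsum_lift x (single (fgen f)) = abmap D f (d i).
Proof.
rewrite -[LHS]/(dsum_lift_fun _) /dsum_lift_fun (sum_eq1 (j := i)).
  by rewrite single_same freeab_liftE.
by move=> j ij; rewrite single_neq ?raddf0 // eq_sym.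
Qed.
End ToD.

Lemma direct_sum_generators (p : abnat R D) :
  pointwise_surjective p ->
  pointwise_surjective
    (free_abnat (fun i => p _ (single (fgen (idc (w i)))))).
Proof.
move=> ps x a; have [b <-] := ps x a; rewrite (sum_single b) raddf_sum.
elim/big_ind: _ => [|y z [y' <-] [z' <-]|i _].
- by exists 0; rewrite raddf0.
- by exists (y' + z'); rewrite raddfD.
elim/freeab_ind: (b i) => [|y z [y' yE] [z' zE]|f].
- by exists 0; rewrite raddf0 (_ : single 0 = 0) ?raddf0 //;
    apply: (raddf0 (mk_additive (@single_is_zmod_morphism i x))).
- exists (y' - z'); rewrite raddfB yE zE -raddfB.
  by congr (p x _); apply/esym/single_is_zmod_morphism.
- exists (fgen (Symbol f)); rewrite free_liftE -abnatE abmap_single.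
  by congr (p x (single _)); apply: etrans (repr_mapE _ _) _; rewrite comp1l.
Qed.
End DirectSumRepresentables.

(** By Yoneda, maps out of a sum of representables are families of elements. Finite generation thus
    becomes the existence of finitely many elements whose translates span, the form used from here
    on. *)
Lemma fg_generators (D : abfunctor C) :
  finitely_generated D <->
  exists n (w : 'I_n -> C) (d : forall i, D (w i)),
    pointwise_surjective (free_abnat d).
Proof.
split=> [[n [w [p ps]]]|[n [w [d ds]]]].
  by exists n, w, (fun i => p _ (single (fgen (idc (w i)))));
    apply: direct_sum_generators.
exists n, w, (dsum_lift d) => x a; have [z <-] := ds x a.
elim/freeab_ind: z => [|y z [y' yE] [z' zE]|[i f]].
- by exists 0; rewrite !raddf0.
- by exists (y' - z'); rewrite !raddfB yE zE.
- by exists (single (fgen f)); rewrite dsum_lift_single free_liftE.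
Qed.

Lemma fg_of_finite (D : abfunctor C) I (s : I -> C) (d : forall i, D (s i)) :
  finite_set [set: I] -> pointwise_surjective (free_abnat d) ->
  finitely_generated D.
Proof.
move=> /finite_set_enum [n [h hE]] ds; apply/fg_generators.
exists n, (fun j => s (h j)), (fun j => d (h j)).
apply: free_abnat_reindex ds => i.
have : setT i by [].
by rewrite hE => -[j _ <-]; exists j.
Qed.

Lemma fg_surj (D E : abfunctor C) (p : abnat D E) :
  pointwise_surjective p -> finitely_generated D -> finitely_generated E.
Proof.
move=> ps /fg_generators [n [w [d ds]]]; apply/fg_generators.
by exists n, w, (fun i => p _ (d i)); apply: free_abnat_surj_comp.
Qed.

Lemma fg_bij (D E : abfunctor C) (p : abnat D E) :
  (forall x, injective (p x)) -> pointwise_surjective p ->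
  finitely_generated E -> finitely_generated D.
Proof.
move=> pinj ps /fg_generators [n [w [e es]]]; apply/fg_generators.
have [d dE] : {d : forall i, D (w i) & forall i, p _ (d i) = e i}.
  by exists (fun i => sval (cid (ps _ (e i)))) => i; case: cid.
exists n, w, d => x a; have [z zE] := es x (p x a); exists z.
apply: pinj; rewrite free_abnat_comp -zE.
by congr (free_abnat _ x z); apply: functional_extensionality_dep.
Qed.

Lemma free_projective I (s : I -> C) : projective (free_abfunctor s).
Proof.
move=> D E p f ps.
have [d dE] : {d : forall i, D (s i) &
    forall i, p _ (d i) = f _ (fgen (Symbol (idc (s i))))}.
  by exists (fun i => sval (cid (ps _ (f _ (fgen (Symbol (idc (s i)))))))) => i;
    case: cid.
exists (free_abnat d) => x; set r := f x; move=> a; rewrite free_abnat_comp.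
move: a; apply: (@freeab_ext _ _ (free_abnat _ x) r) => -[i g].
rewrite free_liftE /= dE -abnatE.
by congr (f x _); rewrite [LHS]free_mapE /symbol_map /= comp1l.
Qed.
End AbNat.

(** * Change of base *)

(** What is kept of an isomorphism of categories: no equation between objects, hence no transport of
    morphisms along one. *)
Definition fully_faithful_surjective (C D : category) (F : functor C D) :=
  [/\ forall x y (g : hom (F x) (F y)), exists f : hom x y, fmap F f = g,
      forall x y, injective (fmap F (x := x) (y := y))
    & forall b, exists a, F a = b].

Lemma ffs_id C : fully_faithful_surjective (functor_id C).
Proof. by split=> [x y g|x y|b]; [exists g|apply: inj_id|exists b]. Qed.

(** Both composites are identity functors and inherit the property by rewriting whole functors.
    Fullness of one factor then follows from fullness of one composite and faithfulness of the
    other. *)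
Lemma ffs_iso_from C D (I : category_iso C D) :
  fully_faithful_surjective (iso_from I).
Proof.
case: I => G F /= GF FG.
have [fullGF faithGF surjGF] : fully_faithful_surjective (functor_comp G F).
  by rewrite GF; apply: ffs_id.
have [fullFG faithFG surjFG] : fully_faithful_surjective (functor_comp F G).
  by rewrite FG; apply: ffs_id.
split=> [x y g|x y f g e|b].
- have [f fE] := fullFG x y (fmap G g); exists f.
  by apply: faithGF; apply: (congr1 (fun h => fmap F h) fE).
- by apply: faithFG; apply: (congr1 (fun h => fmap G h) e).
- by have [a aE] := surjGF b; exists (G a).
Qed.

Lemma ffs_factorisations C D (F : functor C D) :
  fully_faithful_surjective F ->
  fully_faithful_surjective (factorisations_functor F).
Proof.
case=> full faith surj; split=> [w w' k|w w' k l e|[x y f]].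
- have [l lE] := full _ _ (factl k); have [r rE] := full _ _ (factr k).
  have E : l ;; acell w ;; r = acell w'.
    by apply: faith; rewrite !fmapM lE rE; apply: (Defs.factE k).
  by exists (Fact E); apply: fact_eq.
- by apply: fact_eq; apply: faith; [have := congr1 (@factl _ _ _) e|
    have := congr1 (@factr _ _ _) e].
- have [a aE] := surj x; have [b bE] := surj y.
  case: _ / aE in f *; case: _ / bE in f *.
  by have [g <-] := full _ _ f; exists (Arrow g).
Qed.

Section Inverse.
Variables (C : category) (D E : abfunctor C) (q : abnat D E).
Hypotheses (q_inj : forall x, injective (q x)) (q_surj : pointwise_surjective
  q).

Definition abnat_inv_fun x (b : E x) : D x := sval (cid (q_surj b)).

Lemma abnat_inv_funK x (b : E x) : q x (abnat_inv_fun b) = b.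
Proof. by rewrite /abnat_inv_fun; case: cid. Qed.

Lemma abnat_inv_zmod_morphism x : zmod_morphism (@abnat_inv_fun x).
Proof. by move=> a b; apply: q_inj; rewrite raddfB !abnat_inv_funK. Qed.

Lemma abnat_inv_subproof x y (f : hom x y) (b : E x) :
  mk_additive (@abnat_inv_zmod_morphism y) (abmap E f b) =
    abmap D f (mk_additive (@abnat_inv_zmod_morphism x) b).
Proof. by apply: q_inj; rewrite /= abnatE !abnat_inv_funK. Qed.

Definition abnat_inv : abnat E D := AbNat abnat_inv_subproof.

Lemma projective_bij : projective D -> projective E.
Proof.
move=> Dproj U V p f ps.
have [h hE] := Dproj _ _ p (abnat_comp q f) ps.
exists (abnat_comp abnat_inv h) => x b.
by rewrite [LHS]hE /= abnat_inv_funK.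
Qed.
End Inverse.

Section Pullback.
Variables (A B : category) (F : functor A B).

Section PullbackNat.
Variables (D E : abfunctor B) (p : abnat D E).

Lemma pullback_abnat_subproof x y (f : hom x y) (a : pullback F D x) :
  p (F y) (abmap (pullback F D) f a) = abmap (pullback F E) f (p (F x) a).
Proof. exact: abnatE. Qed.

Definition pullback_abnat : abnat (pullback F D) (pullback F E) :=
  @AbNat A (pullback F D) (pullback F E) (fun x => p (F x))
    pullback_abnat_subproof.

Lemma ker_pullback_subproof x (a : kernel pullback_abnat x) :
  ker_val a \in @ker_pred _ _ _ p (F x).
Proof. by apply/eqP; apply: (ker_valP a). Qed.

Definition ker_pullback_fun x (a : kernel pullback_abnat x) :
    pullback F (kernel p) x :=
  Ker (ker_pullback_subproof a).

Lemma ker_pullback_zmod_morphism x : zmod_morphism (@ker_pullback_fun x).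
Proof. by move=> a b; apply: val_inj. Qed.

Lemma ker_pullback_nat_subproof x y (f : hom x y) (a : kernel pullback_abnat x)
  :
  mk_additive (@ker_pullback_zmod_morphism y) (abmap (kernel pullback_abnat) f
    a) =
    abmap (pullback F (kernel p)) f (mk_additive (@ker_pullback_zmod_morphism
      x) a).
Proof. exact: val_inj. Qed.

Definition ker_pullback :
    abnat (kernel pullback_abnat) (pullback F (kernel p)) :=
  AbNat ker_pullback_nat_subproof.

Lemma ker_pullback_surjective : pointwise_surjective ker_pullback.
Proof.
move=> x b; have b0 : ker_val b \in @ker_pred _ _ _ pullback_abnat x.
  by apply/eqP; apply: (ker_valP b).
by exists (@Ker A _ _ pullback_abnat x _ b0); apply: val_inj.
Qed.
End PullbackNat.

Definition pullback_constant (V : zmodType) (D : abfunctor B)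
    (p : abnat D (constant_abfunctor B V)) :
    abnat (pullback F D) (constant_abfunctor A V) :=
  @AbNat A (pullback F D) (constant_abfunctor A V) (fun x => p (F x))
    (fun x y f => abnatE p (fmap F f)).

Lemma pullback_exact (D E G : abfunctor B) (p : abnat D E) (q : abnat E G) :
  pointwise_exact p q ->
  pointwise_exact (pullback_abnat p) (pullback_abnat q).
Proof. by move=> ex x; apply: ex. Qed.

Hypothesis Fffs : fully_faithful_surjective F.

Lemma family_preimage I (s : I -> B) :
  exists s' : I -> A, s = (fun i => F (s' i)).
Proof.
have [_ _ surj] := Fffs.
exists (fun i => sval (cid (surj (s i)))).
by apply: functional_extensionality_dep => i; case: cid.
Qed.

Lemma pullback_generators (D : abfunctor B) I (s : I -> A)
    (d : forall i, D (F (s i))) :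
  pointwise_surjective (@free_abnat B I (fun i => F (s i)) D d) ->
  pointwise_surjective (@free_abnat A I s (pullback F D) d).
Proof.
have [full _ _] := Fffs => ds x a; have [z <-] := ds (F x) a.
elim/freeab_ind: z => [|y z [y' yE] [z' zE]|[i f]].
- by exists 0; rewrite !raddf0.
- by exists (y' - z'); rewrite !raddfB yE zE.
- by have [g <-] := full _ _ f; exists (fgen (Symbol g)); rewrite !free_liftE.
Qed.

Lemma fg_pullback (D : abfunctor B) :
  finitely_generated (pullback F D) <-> finitely_generated D.
Proof.
split=> /fg_generators [n [w [d ds]]]; apply/fg_generators.
  exists n, (fun i => F (w i)), d => b a; have [_ _ surj] := Fffs.
  have [x xE] := surj b; case: _ / xE in a *; have [z <-] := ds x a.
  elim/freeab_ind: z => [|y z [y' yE] [z' zE]|[i f]].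
  - by exists 0; rewrite !raddf0.
  - by exists (y' - z'); rewrite !raddfB yE zE.
  - exists (fgen (@Symbol _ _ (fun i => F (w i)) _ i (fmap F f))).
    by rewrite !free_liftE.
have [w' wE] := family_preimage w; subst w; exists n, w', d.
exact: pullback_generators.
Qed.

(** The pullback is itself free, on preimages of the generating objects: the comparison map from
    that free functor is bijective because [F] is fully faithful. *)
Lemma pullback_free_projective I (s : I -> B) :
  projective (pullback F (free_abfunctor s)).
Proof.
have [full faith _] := Fffs; have [s' ->] := family_preimage s.
set P := free_abfunctor _.
pose u i : P (F (s' i)) := fgen (@Symbol _ _ (fun i => F (s' i)) _ i (idc _)).
have us : pointwise_surjective (@free_abnat A I s' (pullback F P) u).
  exact/pullback_generators/free_generators.
have ui x : injective (@free_abnat A I s' (pullback F P) u x).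
  (* Fullness lifts the morphism of each symbol; faithfulness makes the lift a left inverse of the
     comparison map. *)
  pose inv x (a : symbol (fun i => F (s' i)) (F x)) : symbol s' x :=
    Symbol (sval (cid (full _ _ (sym_mor a)))).
  pose v x : {additive P (F x) -> free_abfunctor s' x} :=
    freeab_lift (fun a => fgen (inv x a)).
  apply: (can_inj (g := v x)).
  pose idz := mk_additive (@id_zmod_morphism (free_abfunctor s' x)).
  move=> a; move: a.
  pose vu := mk_additive (comp_zmod_morphism (@free_abnat A I s' (pullback F P)
    u x) (v x)).
  apply: (@freeab_ext _ _ vu idz) => -[i f].
  rewrite -[LHS]/(v x (@free_abnat A I s' (pullback F P) u x (fgen (Symbol
    f)))).
  rewrite free_liftE.
  rewrite -[abmap _ _ _]/(free_map _ (fmap F f) (fgen _)) free_mapE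
    freeab_liftE.
  congr fgen; rewrite /inv /symbol_map /=; congr Symbol.
  by apply: faith; case: cid => g /= ->; rewrite comp1l.
exact: projective_bij ui us (@free_projective A I s').
Qed.
End Pullback.

(** * Comparison of resolutions *)

Lemma finite_setT_fin (T : finType) : finite_set [set: T].
Proof.
rewrite (_ : [set: T]%classic = [set` enum T]%classic); first exact: finite_seq.
by apply/seteqP; split=> x //= _; rewrite mem_enum.
Qed.

Section Schanuel.
Variable C : category.

Lemma fg_two (D D' E : abfunctor C) (p : abnat D E) (q : abnat D' E) :
  (forall x (a : E x), exists b c, a = p x b - q x c) ->
  finitely_generated D -> finitely_generated D' -> finitely_generated E.
Proof.
move=> pq /fg_generators [n [w [d ds]]] /fg_generators [m [v [e es]]].
pose s (k : 'I_n + 'I_m) : C := match k with inl i => w i | inr j => v j end.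
pose g (k : 'I_n + 'I_m) : E (s k) :=
  match k with inl i => p _ (d i) | inr j => q _ (e j) end.
apply: (fg_of_finite (d := g)) => [|x a]; first exact: finite_setT_fin.
have pI b : exists z, free_abnat g x z = p x b.
  have [z <-] := ds x b; elim/freeab_ind: z => [|y z [y' yE] [z' zE]|[i f]].
  - by exists 0; rewrite !raddf0.
  - by exists (y' - z'); rewrite !raddfB yE zE.
  - exists (fgen (@Symbol _ _ s _ (inl i) f)).
    by rewrite !free_liftE abnatE.
have qI b : exists z, free_abnat g x z = q x b.
  have [z <-] := es x b; elim/freeab_ind: z => [|y z [y' yE] [z' zE]|[i f]].
  - by exists 0; rewrite !raddf0.
  - by exists (y' - z'); rewrite !raddfB yE zE.
  - exists (fgen (@Symbol _ _ s _ (inr i) f)).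
    by rewrite !free_liftE abnatE.
have [b [c ->]] := pq x a; have [y <-] := pI b; have [z <-] := qI c.
by exists (y - z); rewrite raddfB.
Qed.

Lemma exact0 (D E F : abfunctor C) (p : abnat D E) (q : abnat E F) :
  pointwise_exact p q -> forall x a, q x (p x a) = 0.
Proof. by move=> ex x a; apply/ex; exists a. Qed.

Variables (P3 P2 P1 P0 Q2 Q1 Q0 Z : abfunctor C).
Variables (d3 : abnat P3 P2) (d2 : abnat P2 P1) (d1 : abnat P1 P0)
  (d0 : abnat P0 Z) (e2 : abnat Q2 Q1) (e1 : abnat Q1 Q0) (e0 : abnat Q0 Z).

(* Comparison maps P -> Q -> P over Z and a homotopy h from the composite on  *)
(* Q to the identity write each z in ker e2 as al2 (be2 z) - w z, where w is  *)
(* an endomorphism of Q2 with values in ker e2 and be2 z lies in the image of *)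
(* d3.                                                                        *)
Lemma fg_kernel_comparison :
  projective P2 -> projective P1 -> projective P0 ->
  pointwise_exact d3 d2 -> pointwise_exact d2 d1 -> pointwise_exact d1 d0 ->
  pointwise_surjective d0 ->
  projective Q2 -> projective Q1 -> projective Q0 ->
  pointwise_exact e2 e1 -> pointwise_exact e1 e0 -> pointwise_surjective e0 ->
  finitely_generated P3 -> finitely_generated Q2 ->
  finitely_generated (kernel e2).
Proof.
move=> P2p P1p P0p x32 x21 x10 d0s Q2p Q1p Q0p y21 y10 e0s P3f Q2f.
have [al0 al0E] := P0p _ _ e0 d0 e0s.
have [al1 al1E] : exists g : abnat P1 Q1, forall x a, e1 x (g x a) = al0 x (d1
  x a).
  apply: (lift_exact (f := abnat_comp d1 al0) P1p y10) => x a /=.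
  by rewrite al0E (exact0 x10).
have [al2 al2E] : exists g : abnat P2 Q2, forall x a, e2 x (g x a) = al1 x (d2
  x a).
  apply: (lift_exact (f := abnat_comp d2 al1) P2p y21) => x a /=.
  by rewrite al1E (exact0 x21) raddf0.
have [be0 be0E] := Q0p _ _ d0 e0 d0s.
have [be1 be1E] : exists g : abnat Q1 P1, forall x a, d1 x (g x a) = be0 x (e1
  x a).
  apply: (lift_exact (f := abnat_comp e1 be0) Q1p x10) => x a /=.
  by rewrite be0E (exact0 y10).
have [be2 be2E] : exists g : abnat Q2 P2, forall x a, d2 x (g x a) = be1 x (e2
  x a).
  apply: (lift_exact (f := abnat_comp e2 be1) Q2p x21) => x a /=.
  by rewrite be1E (exact0 y21) raddf0.
have [h0 h0E] : exists g : abnat Q0 Q1,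
    forall x a, e1 x (g x a) = al0 x (be0 x a) - a.
  apply: (lift_exact (f := abnat_sub (abnat_comp be0 al0) (abnat_id Q0)) Q0p
    y10).
  by move=> x a; rewrite /= raddfB al0E be0E subrr.
have [h1 h1E] : exists g : abnat Q1 Q2,
    forall x a, e2 x (g x a) = al1 x (be1 x a) - a - h0 x (e1 x a).
  apply: (lift_exact (f := abnat_sub (abnat_sub (abnat_comp be1 al1) (abnat_id
    Q1))
    (abnat_comp e1 h0)) Q1p y21).
  by move=> x a; rewrite /= !raddfB al1E be1E h0E subrr.
pose w := abnat_sub (abnat_sub (abnat_comp be2 al2) (abnat_id Q2)) (abnat_comp
  e2 h1).
have e2w x a : e2 x (w x a) = 0.
  rewrite /= !raddfB al2E be2E h1E (exact0 y21) raddf0 subr0.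
  by rewrite subrr.
have e2ad x a : e2 x (abnat_comp d3 al2 x a) = 0.
  by rewrite /= al2E (exact0 x32) raddf0.
apply: (fg_two (p := corestrict e2ad) (q := corestrict e2w)) P3f Q2f => x z.
have z0 := ker_valP z.
have [y yE] : exists y, d3 x y = be2 x (ker_val z).
  by apply/x32; rewrite be2E z0 raddf0.
exists y, (ker_val z); apply: val_inj.
by rewrite /= yE z0 raddf0 subr0 subKr.
Qed.
End Schanuel.

(** * Brackets of 2-cells *)

Lemma eq_addr (V : zmodType) (a a' b b' : V) :
  a = a' -> b = b' -> a + b = a' + b'.
Proof. by move=> -> ->. Qed.

Lemma eq_opp (V : zmodType) (a a' : V) : a = a' -> - a = - a'.
Proof. by move=> ->. Qed.

Lemma eq_sub0 (V : zmodType) (a a' : V) : a = a' -> a - a' = 0.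
Proof. by move=> ->; apply: subrr. Qed.

Lemma eq_sub_mid (V : zmodType) (x y a b a' b' c c' d d' : V) :
  x = a + b + c -> y = a' + b' + c' -> a = a' -> b = d -> b' = d' -> c = c' ->
  x - y = d - d'.
Proof.
by move=> -> -> -> -> -> ->; rewrite [_ + d + _]addrAC [_ + d' + _]addrAC opprD
  addrACA subrr add0r.
Qed.

Lemma eq_telescope (V : zmodType) (a b c d a' b' : V) :
  a = d -> c = a' -> b = b' -> a - b + (c - d) = a' - b'.
Proof. by move=> -> -> ->; rewrite addrC addrA subrK. Qed.

Section Polygraph.
Variable S : polygraph2.
Local Notation W := (words S).
Local Notation C := (presented S).
Local Notation FC := (factorisations (presented S)).
Local Notation T := (free_cat21 S).
Local Notation "u ;;; v" := (@Defs.comp C _ _ _ u v)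
  (at level 50, left associativity).

Lemma wcat (x y z : W) (u : hom x y) (v : hom y z) :
  @wclass S _ _ (u ;; v) = wclass u ;;; wclass v.
Proof. exact/esym/wclass_cat. Qed.

Lemma wclass_whisk (x' x y y' : W) (a : hom x' x) (b : hom y y')
    (u : hom x y) (u' : hom x' y') : a ;; u ;; b = u' ->
  @wclass S _ _ u' = wclass a ;;; wclass u ;;; wclass b.
Proof. by move<-; rewrite !wcat. Qed.

Lemma expr_class (x y : W) (u v : hom x y) (f : expr u v) :
  @wclass S _ _ u = wclass v.
Proof.
elim: f => {x y u v} //.
- by move=> x y u v a; apply/cat_congP/cc_rel.
- by move=> x y u v w _ -> _ ->.
- by move=> x' x y y' a b u v u' v' /wclass_whisk -> /wclass_whisk -> _ ->.
Qed.

Lemma cell_class (x y : W) (u v : hom x y) (f : @cell T _ _ u v) :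
  @wclass S _ _ u = wclass v.
Proof. exact: expr_class (rep f). Qed.

Section Facts.
Variables (x y : W) (w : FC).

Lemma refact_subproof (u v : hom x y) (e : @wclass S _ _ u = wclass v)
    (k : @hom FC (warrow u) w) :
  factl k ;; acell (warrow v) ;; factr k = acell w.
Proof. by rewrite /= -e; apply: (Defs.factE k). Qed.

(** [wclass u] and [wclass v] are equal but not convertible, so morphisms out of [warrow u] and
    [warrow v] have different types; this changes the type and keeps both components. *)
Definition refact (u v : hom x y) (e : @wclass S _ _ u = wclass v)
    (k : @hom FC (warrow u) w) : @hom FC (warrow v) w :=
  @Fact C (warrow v) w _ _ (refact_subproof e k).
End Facts.

Lemma whisk_fact_subproof (w : FC) (x' x y y' : W) (a : hom x' x) (b : hom y y')
    (u : hom x y) (u' : hom x' y') (e : a ;; u ;; b = u')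
    (k : @hom FC (warrow u') w) :
  (factl k ;;; wclass a) ;;; acell (warrow u) ;;; (wclass b ;;;
    factr k) = acell w.
Proof.
by rewrite -(Defs.factE k) [acell (warrow u')](wclass_whisk e) !Defs.compA.
Qed.

Definition whisk_fact (w : FC) (x' x y y' : W) (a : hom x' x) (b : hom y y')
    (u : hom x y) (u' : hom x' y') (e : a ;; u ;; b = u')
    (k : @hom FC (warrow u') w) : @hom FC (warrow u) w :=
  @Fact C (warrow u) w _ _ (whisk_fact_subproof e k).

Lemma factl_comp (w w' w'' : FC) (f : hom w w') (g : hom w' w'') :
  factl (f ;; g) = factl g ;;; factl f.
Proof. by []. Qed.

Lemma factr_comp (w w' w'' : FC) (f : hom w w') (g : hom w' w'') :
  factr (f ;; g) = factr f ;;; factr g.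
Proof. by []. Qed.

Lemma factl_id (w : FC) : factl (idc w) = @idc C (asrc w).
Proof. by []. Qed.

Lemma factr_id (w : FC) : factr (idc w) = @idc C (atgt w).
Proof. by []. Qed.

Lemma factl_refact x y w (u v : @hom W x y) e k :
  factl (@refact x y w u v e k) = factl k.
Proof. by []. Qed.

Lemma factr_refact x y w (u v : @hom W x y) e k :
  factr (@refact x y w u v e k) = factr k.
Proof. by []. Qed.

Lemma factl_whisk w x' x y y' a b u u' e k :
  factl (@whisk_fact w x' x y y' a b u u' e k) = factl k ;;; wclass a.
Proof. by []. Qed.

Lemma factr_whisk w x' x y y' a b u u' e k :
  factr (@whisk_fact w x' x y y' a b u u' e k) = wclass b ;;; factr k.
Proof. by []. Qed.

Lemma factl_mulr (x y z : W) (u : hom x y) (v : hom y z) :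
  factl (@mulr_fact S x y z u v) = @idc C x.
Proof. by []. Qed.

Lemma factr_mulr (x y z : W) (u : hom x y) (v : hom y z) :
  factr (@mulr_fact S x y z u v) = wclass v.
Proof. by []. Qed.

Lemma factl_mull (x y z : W) (u : hom x y) (v : hom y z) :
  factl (@mull_fact S x y z u v) = wclass u.
Proof. by []. Qed.

Lemma factr_mull (x y z : W) (u : hom x y) (v : hom y z) :
  factr (@mull_fact S x y z u v) = @idc C z.
Proof. by []. Qed.

Lemma factl_tgt (a : gen2 S) : factl (tgt_fact a) = @idc C _.
Proof. by []. Qed.

Lemma factr_tgt (a : gen2 S) : factr (tgt_fact a) = @idc C _.
Proof. by []. Qed.

Definition fact_simplE := (factl_comp, factr_comp, factl_id, factr_id,
  factl_refact,
  factr_refact, factl_whisk, factr_whisk, factl_mulr, factr_mulr, factl_mull,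
  factr_mull, factl_tgt, factr_tgt).

(* The image under k of the derivation [f] : [fg] = [f] + [g] for vertical    *)
(* composites, [afb] = a[f]b for whiskerings.                                 *)
Fixpoint bracket2 (w : FC) (x y : W) (u v : hom x y) (f : expr u v) :
    @hom FC (warrow u) w -> F2 S w :=
  match f in expr u v return @hom FC (warrow u) w -> F2 S w with
  | egen _ _ _ _ a => fun k => fgen (@Symbol FC _ (@bar2 S) _ (Gen2 a) k)
  | eid _ _ _ => fun=> 0
  | ecomp _ _ _ _ _ f g =>
      fun k => bracket2 f k + bracket2 g (refact (expr_class f) k)
  | einv _ _ _ _ f => fun k => - bracket2 f (refact (esym (expr_class f)) k)
  | ewhisk _ _ _ _ _ _ _ _ _ _ eu _ f =>
      fun k => bracket2 f (whisk_fact eu k)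
  end.

Lemma bracket2_fact_eq (w : FC) (x y : W) (u v : hom x y) (f : expr u v)
    (k l : @hom FC (warrow u) w) :
  factl k = factl l -> factr k = factr l -> bracket2 f k = bracket2 f l.
Proof. by move=> el er; congr (bracket2 f _); apply: fact_eq. Qed.

(** The derivation respects every axiom, hence descends to cells. In the exchange law both sides are
    the sum of [f] whiskered on the right and [g] whiskered on the left, since a whiskering acts
    through its class and the source and target of a cell have the same class. *)
Lemma bracket2_expr_eq (w : FC) (x y : W) (u v : hom x y) (f g : expr u v)
    (k : @hom FC (warrow u) w) :
  expr_eq f g -> bracket2 f k = bracket2 g k.
Proof.
move=> fg; elim: fg k => {x y u v f g} //=.
- by move=> x y u v f g h _ IH1 _ IH2 k; rewrite IH1.
- move=> x y u v w' f f' g g' _ IH1 _ IH2 k; rewrite IH1 IH2.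
  by apply: (@eq_addr (F2 S w)); apply: bracket2_fact_eq.
- by move=> x y u v f f' _ IH k; rewrite IH; apply: (@eq_opp (F2 S w));
  apply: bracket2_fact_eq.
- by move=> x y u v f k; rewrite add0r; apply: bracket2_fact_eq.
- by move=> x y u v f k; rewrite addr0.
- move=> x y u v w' t f g h k; rewrite addrA.
  by apply: (@eq_addr (F2 S w)); first apply: (@eq_addr (F2 S w)) => //;
    apply: bracket2_fact_eq.
- move=> x y u v f k; apply: (@eq_sub0 (F2 S w)).
  exact: bracket2_fact_eq.
- move=> x y u v f k; apply: (etrans (@addrC (F2 S w) _ _));
  apply: (@eq_sub0 (F2 S w)).
  exact: bracket2_fact_eq.
- move=> x' x y y' a b u v w' u' v' w'' eu ev ew f g k.
  by apply: (@eq_addr (F2 S w)); apply: bracket2_fact_eq.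
- by move=> x y u v eu ev f k; apply: bracket2_fact_eq;
  [apply: comp1r|apply: comp1l].
- move=> x'' x' x y y' y'' a' a b b' u v u' v' u'' v'' eu ev eu' ev' eu'' ev''
  f k.
  apply: bracket2_fact_eq => /=; rewrite wcat.
    exact: esym (@Defs.compA C _ _ _ _ _ _ _).
  exact: (@Defs.compA C).
- move=> x y z u v u' v' e1 e2 e3 e4 e5 e6 e7 e8 f g k; rewrite [LHS]addrC.
  have fE := expr_class f; have gE := expr_class g.
  by apply: (@eq_addr (F2 S w)); apply: bracket2_fact_eq; rewrite /= ?fE ?gE.
Qed.

Lemma bracket2_nat (w w' : FC) (m : @hom FC w w') (x y : W) (u v : hom x y)
    (f : expr u v) (k : @hom FC (warrow u) w) :
  abmap (F2 S) m (bracket2 f k) = bracket2 f (k ;; m).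
Proof.
elim: f k => {x y u v}.
- by move=> x y u v a k; apply: free_mapE.
- by move=> *; apply: raddf0.
- move=> x y u v w'' f IHf g IHg k; rewrite [LHS]raddfD IHf IHg.
  apply: (@eq_addr (F2 S w') _ (bracket2 f (k ;; m)) _
    (bracket2 g (refact (expr_class f) (k ;; m)))) => //.
  exact: bracket2_fact_eq.
- move=> x y u v f IHf k; rewrite [LHS]raddfN IHf.
  apply: (@eq_opp (F2 S w') _
    (bracket2 f (refact (esym (expr_class f)) (k ;; m)))).
  exact: bracket2_fact_eq.
- move=> x' x y y' a b u v u' v' eu ev f IHf k.
  rewrite -[LHS]/(abmap _ m (bracket2 f (whisk_fact eu k))) IHf.
  rewrite -[RHS]/(bracket2 f (whisk_fact eu (k ;; m))).
  apply: bracket2_fact_eq; first exact: (@Defs.compA C).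
  exact: esym (@Defs.compA C _ _ _ _ _ _ _).
Qed.

Lemma abmap_fact_eq (D : natural_system C) (w w' : FC) (k l : @hom FC w w') a :
  factl k = factl l -> factr k = factr l -> abmap D k a = abmap D l a.
Proof. by move=> el er; rewrite (fact_eq el er). Qed.

(* Only the middle terms of [aub] = [a]ub + a[u]b + au[b] and [avb] differ.   *)
Lemma bracket_whisk (w : FC) (x' x y y' : W) (a : hom x' x) (b : hom y y')
    (u v : hom x y) (u' v' : hom x' y') (eu : a ;; u ;; b = u')
    (ev : a ;; v ;; b = v') (e : @wclass S _ _ u = wclass v)
    (e' : @wclass S _ _ u' = wclass v') (k : @hom FC (warrow u') w) :
  abmap (F1 S) k (bracket u') - abmap (F1 S) (refact e' k) (bracket v') =
  abmap (F1 S) (whisk_fact eu k) (bracket u) -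
    abmap (F1 S) (refact e (whisk_fact eu k)) (bracket v).
Proof.
destruct eu, ev.
have bE (t : hom x y) (l : @hom FC (warrow (a ;; t ;; b)) w) :
    abmap (F1 S) l (bracket (a ;; t ;; b)) =
    abmap (F1 S) (mulr_fact a t ;; (mulr_fact (a ;; t) b ;; l)) (bracket a) +
    abmap (F1 S) (mull_fact a t ;; (mulr_fact (a ;; t) b ;; l)) (bracket t) +
    abmap (F1 S) (mull_fact (a ;; t) b ;; l) (bracket b).
  by rewrite !bracket_cat !raddfD -!abmapM.
apply: (eq_sub_mid (bE u _) (bE v _)); apply: abmap_fact_eq.
all: by rewrite !fact_simplE ?comp1l ?comp1r ?wcat ?e.
Qed.

(** Fundamental formula of the Fox calculus. On generators it is the definition of [delta2],
    composites telescope, and whiskerings are [bracket_whisk]. For a closed cell it says that [f] is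
    a syzygy. *)
Lemma delta2_bracket2 (w : FC) (x y : W) (u v : hom x y) (f : expr u v)
    (e : @wclass S _ _ u = wclass v) (k : @hom FC (warrow u) w) :
  delta2 S w (bracket2 f k) =
    abmap (F1 S) k (bracket u) - abmap (F1 S) (refact e k) (bracket v).
Proof.
elim: f e k => {x y u v}.
- move=> x y u v a e k; rewrite [LHS]free_liftE raddfB -abmapM.
  apply: eq_addr => //; apply: eq_opp; apply: abmap_fact_eq;
    by rewrite !fact_simplE ?comp1l ?comp1r.
- move=> x y u e k; rewrite [LHS]raddf0; apply: esym; apply: eq_sub0.
  exact: abmap_fact_eq.
- move=> x y u v t f IHf g IHg e k.
  rewrite -[bracket2 _ _]/(bracket2 f k + bracket2 g (refact (expr_class f) k)).
  rewrite raddfD IHf; first exact: expr_class f.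
  move=> ef; rewrite IHg; first exact: expr_class g.
  move=> eg; rewrite addrA.
  have <- : abmap (F1 S) (refact ef k) (bracket v) =
    abmap (F1 S) (refact (expr_class f) k) (bracket v) by apply: abmap_fact_eq.
  rewrite subrK; apply: eq_addr => //; apply: eq_opp; exact: abmap_fact_eq.
- move=> x y u v f IHf e k.
  rewrite -[bracket2 _ _]/(- bracket2 f (refact (esym (expr_class f)) k)).
  rewrite raddfN IHf; first exact: expr_class f.
  move=> ef; rewrite opprB; apply: eq_addr; last apply: eq_opp;
    exact: abmap_fact_eq.
- move=> x' x y y' a b u v u' v' eu ev f IHf e k.
  rewrite -[bracket2 _ _]/(bracket2 f (whisk_fact eu k)).
  rewrite IHf; first exact: expr_class f.
  by move=> ef; rewrite (bracket_whisk eu ev ef e).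
Qed.

Definition cbracket (w : FC) (x y : W) (u v : hom x y) (f : @cell T _ _ u v)
  (k : @hom FC (warrow u) w) : F2 S w := bracket2 (rep f) k.

Section CellBrackets.
Variables (w : FC) (x y : W).

Lemma cbracket_cls (u v : hom x y) (f : expr u v) (k : @hom FC (warrow u) w) :
  cbracket (ecls f) k = bracket2 f k.
Proof. by apply: bracket2_expr_eq; apply: rep_expr_eq. Qed.

Lemma cbracket_fact_eq (u v : hom x y) (f : @cell T _ _ u v)
    (k l : @hom FC (warrow u) w) :
  factl k = factl l -> factr k = factr l -> cbracket f k = cbracket f l.
Proof. exact: bracket2_fact_eq. Qed.

Lemma cbracket_vcomp (u v t : hom x y) (f : @cell T _ _ u v)
    (g : @cell T _ _ v t) (e : @wclass S _ _ u = wclass v)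
    (k : @hom FC (warrow u) w) :
  cbracket (vcomp f g) k = cbracket f k + cbracket g (refact e k).
Proof.
rewrite [LHS]cbracket_cls; apply: (@eq_addr (F2 S w)) => //.
exact: bracket2_fact_eq.
Qed.

Lemma cbracket_vinv (u v : hom x y) (f : @cell T _ _ u v)
    (e : @wclass S _ _ v = wclass u) (k : @hom FC (warrow v) w) :
  cbracket (vinv f) k = - cbracket f (refact e k).
Proof.
by rewrite [LHS]cbracket_cls; apply: (@eq_opp (F2 S w));
  apply: bracket2_fact_eq.
Qed.

Lemma cbracket_whisk (x' y' : W) (a : hom x' x) (b : hom y y') (u v : hom x y)
    (u' v' : hom x' y') (eu : a ;; u ;; b = u') (ev : a ;; v ;; b = v')
    (f : @cell T _ _ u v) (k : @hom FC (warrow u') w) :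
  cbracket (@whisk T _ _ _ _ _ _ _ _ _ _ eu ev f) k = cbracket f (whisk_fact eu
    k).
Proof.
by apply: (etrans (bracket2_expr_eq (g := ewhisk eu ev (rep f)) _ _));
  first exact: rep_expr_eq.
Qed.

Lemma delta2_cbracket (u v : hom x y) (f : @cell T _ _ u v)
    (e : @wclass S _ _ u = wclass v) (k : @hom FC (warrow u) w) :
  delta2 S w (cbracket f k) =
    abmap (F1 S) k (bracket u) - abmap (F1 S) (refact e k) (bracket v).
Proof. exact: delta2_bracket2. Qed.

Lemma cbracket_nat (w' : FC) (m : @hom FC w w') (u v : hom x y)
    (f : @cell T _ _ u v) (k : @hom FC (warrow u) w) :
  abmap (F2 S) m (cbracket f k) = cbracket f (k ;; m).
Proof. exact: bracket2_nat. Qed.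
End CellBrackets.

(** * Degree zero of the complex and the augmentation *)

Definition bar0 (p : cell0 S) : FC := @Arrow C p p (@idc C p).

(** A morphism from [bar0 p] to w is a factorisation of w through p, so the symbol u[p]v marks a cut
    of w at the object p. *)
Definition F0 : natural_system C := free_abfunctor bar0.

Section Endpoints.
Variables (x y : W) (u : hom x y) (w : FC) (k : @hom FC (warrow u) w).

Lemma src_fact_subproof :
  factl k ;;; acell (bar0 x) ;;; (wclass u ;;; factr k) = acell w.
Proof. by rewrite comp1r Defs.compA; apply: (Defs.factE k). Qed.

(** For k = (a, b) this is the cut a[x]ub before [u], and [tgt0_fact] is the cut au[y]b after it;
    [delta1] is the second minus the first. *)
Definition src_fact : @hom FC (bar0 x) w := @Fact C (bar0 x) w _ _
  src_fact_subproof.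

Lemma tgt0_fact_subproof :
  (factl k ;;; wclass u) ;;; acell (bar0 y) ;;; factr k = acell w.
Proof. by rewrite comp1r; apply: (Defs.factE k). Qed.

Definition tgt0_fact : @hom FC (bar0 y) w := @Fact C (bar0 y) w _ _
  tgt0_fact_subproof.
End Endpoints.

Lemma factl_src (x y : W) (u : hom x y) (w : FC) (k : @hom FC (warrow u) w) :
  factl (src_fact k) = factl k.
Proof. by []. Qed.

Lemma factr_src (x y : W) (u : hom x y) (w : FC) (k : @hom FC (warrow u) w) :
  factr (src_fact k) = wclass u ;;; factr k.
Proof. by []. Qed.

Lemma factl_tgt0 (x y : W) (u : hom x y) (w : FC) (k : @hom FC (warrow u) w) :
  factl (tgt0_fact k) = factl k ;;; wclass u.
Proof. by []. Qed.

Lemma factr_tgt0 (x y : W) (u : hom x y) (w : FC) (k : @hom FC (warrow u) w) :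
  factr (tgt0_fact k) = factr k.
Proof. by []. Qed.

Definition sym0 (p : cell0 S) (w : FC) (k : @hom FC (bar0 p) w) : F0 w :=
  fgen (@Symbol FC _ bar0 _ p k).

Lemma sym0_eq p w (k l : @hom FC (bar0 p) w) :
  factl k = factl l -> factr k = factr l -> sym0 k = sym0 l.
Proof. by move=> el er; rewrite (fact_eq el er). Qed.

Lemma abmap_sym0 p w w' (k : @hom FC (bar0 p) w) (l : @hom FC w w') :
  abmap F0 l (sym0 k) = sym0 (k ;; l).
Proof. exact: free_mapE. Qed.

Definition letter (x y : W) (e : @cell1 S x y) : @hom W x y := pcons e (pnil _
  _).

Definition delta1 : abnat (F1 S) F0 :=
  @free_abnat FC _ (@bar1 S) F0 (fun a =>
    sym0 (tgt0_fact (u := letter (gen1_cell a)) (idc (bar1 a))) -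
    sym0 (src_fact (u := letter (gen1_cell a)) (idc (bar1 a)))).

Lemma delta1_gen a : delta1 _ (bracket_gen a) =
  sym0 (tgt0_fact (u := letter (gen1_cell a)) (idc (bar1 a))) -
  sym0 (src_fact (u := letter (gen1_cell a)) (idc (bar1 a))).
Proof. exact: (@free_abnat_gen FC _ (@bar1 S) F0). Qed.

Definition augmentation : abnat F0 (constant_abfunctor FC int) :=
  @free_abnat FC _ bar0 (constant_abfunctor FC int) (fun=> 1).

Lemma augmentation_sym0 p w (k : @hom FC (bar0 p) w) :
  augmentation w (sym0 k) = 1.
Proof. exact: free_liftE. Qed.

(** The sum over the letters of [u] telescopes: the cut after one letter is the cut before the
    next. *)
Lemma delta1_bracket (x y : W) (u : hom x y) (w : FC) (k : @hom FC (warrow u)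
  w) :
  delta1 w (abmap (F1 S) k (bracket u)) = sym0 (tgt0_fact k) - sym0 (src_fact
    k).
Proof.
elim: u w k => [{}x|{}x {}y z e u IH] w k.
  rewrite !raddf0; apply/esym/eq_sub0/sym0_eq => /=; first exact: (@comp1r C).
  exact: esym (@comp1l C _ _ _).
rewrite -[bracket _]/(abmap (F1 S) (mulr_fact (letter e) u) (bracket_gen (Gen1
  e)) +
  abmap (F1 S) (mull_fact (letter e) u) (bracket u)).
rewrite 2!raddfD -!abmapM IH abnatE (delta1_gen (Gen1 e)) raddfB !abmap_sym0.
have wcons : wclass (pcons e u) = wclass (letter e) ;;;
  wclass u by rewrite -wcat.
apply: eq_telescope; apply: sym0_eq; rewrite ?fact_simplE ?factl_tgt0
  ?factr_tgt0
  ?factl_src ?factr_src ?fact_simplE ?comp1l ?comp1r ?wcons ?Defs.compA //.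
Qed.

End Polygraph.

(** * The resolution of a presentation *)

Section Resolution.
Variable S : polygraph2.
Local Notation W := (words S).
Local Notation C := (presented S).
Local Notation FC := (factorisations (presented S)).
Local Notation T := (free_cat21 S).
Local Notation "u ;;; v" := (@Defs.comp C _ _ _ u v)
  (at level 50, left associativity).

Definition some_cell (x y : W) (u v : hom x y) (e : @wclass S _ _ u = wclass v)
  :
  @cell T _ _ u v := inhabited_witness (wclass_eq_cell e).

Definition word (x y : W) (q : @hom C x y) : @hom W x y := rep q.

Lemma wordK (x y : W) (q : @hom C x y) : wclass (word q) = q.
Proof. exact: wclass_rep. Qed.

Definition F0_ind (w : FC) (P : F0 S w -> Prop) :
    P 0 -> (forall y z, P y -> P z -> P (y - z)) ->
    (forall p k, P (@sym0 S p w k)) -> forall z, P z :=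
  @free_abfunctor_ind FC _ (@bar0 S) w P.

Definition sym1 (w : FC) (a : gen1 S) (k : @hom FC (bar1 a) w) : F1 S w :=
  fgen (Symbol k).

Definition F1_ind (w : FC) (P : F1 S w -> Prop) :
    P 0 -> (forall y z, P y -> P z -> P (y - z)) ->
    (forall a k, P (@sym1 w a k)) -> forall z, P z :=
  @free_abfunctor_ind FC _ (@bar1 S) w P.

Definition sym2 (w : FC) (a : gen2 S) (k : @hom FC (bar2 a) w) : F2 S w :=
  fgen (Symbol k).

Definition F2_ind (w : FC) (P : F2 S w -> Prop) :
    P 0 -> (forall y z, P y -> P z -> P (y - z)) ->
    (forall a k, P (@sym2 w a k)) -> forall z, P z :=
  @free_abfunctor_ind FC _ (@bar2 S) w P.

Section LeftFact.
Variables (w : FC) (p : C) (l : @hom C (asrc w) p) (u : @hom W p (atgt w)).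
Hypothesis lu : l ;;; wclass u = acell w.

Lemma left_fact_subproof : l ;;; acell (warrow u) ;;; @idc C (atgt w) = acell w.
Proof. by rewrite comp1r. Qed.

Definition left_fact : @hom FC (warrow u) w :=
  @Fact C (warrow u) w _ _ left_fact_subproof.

Lemma factl_left : factl left_fact = l. Proof. by []. Qed.
Lemma factr_left : factr left_fact = @idc C (atgt w). Proof. by []. Qed.
End LeftFact.

Definition factorsE := (factl_left, factr_left, factl_src, factr_src,
  factl_tgt0,
  factr_tgt0, fact_simplE).

(* Contraction of the augmented complex, additive in each degree but not      *)
(* natural: w |-> w[.], a[p]b |-> - a[b^], a[e]b |-> a[kappa_{e,b}], where b^ *)
(* is a chosen word for b and kappa_{e,b} a chosen 2-cell from e b^ to (eb)^. *)
Lemma contract0_subproof (w : FC) (s : symbol (@bar0 S) w) :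
  factl (sym_mor s) ;;; wclass (word (factr (sym_mor s))) = acell w.
Proof.
rewrite wordK -(Defs.factE (sym_mor s)) -Defs.compA; congr (_ ;; _).
exact/esym/(@comp1l C).
Qed.

Definition contract0 (w : FC) : {additive F0 S w -> F1 S w} :=
  freeab_lift (fun s => - abmap (F1 S) (left_fact (contract0_subproof s))
    (bracket (word (factr (sym_mor s))))).

Lemma contract0_sym0 (w : FC) (p : cell0 S) (k : @hom FC (bar0 p) w)
    (r : @hom C p (atgt w)) (l : @hom FC (warrow (word r)) w) :
  factr k = r -> factl l = factl k -> factr l = @idc C _ ->
  contract0 w (sym0 k) = - abmap (F1 S) l (bracket (word r)).
Proof.
move=> rE; case: _ / rE in l * => le re.
by rewrite /contract0 freeab_liftE; apply: eq_opp; apply: abmap_fact_eq.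
Qed.

(** The symbol w[y] at the target y of w, presented as a [tgt0_fact]; n |-> n w[y] is the
    contraction in the lowest degree. *)
Definition endpoint (w : FC) : F0 S w :=
  sym0 (tgt0_fact (u := word (acell w)) (left_fact (w := w) (l := @idc C _)
    (etrans (comp1l _) (wordK (acell w))))).

(** The boundary of -a[^b] is a[p]b - w[y]. The second symbol is the same for all generators, so its
    total multiplicity is the augmentation. *)
Lemma delta1_contract0 (w : FC) (z : F0 S w) :
  delta1 S w (contract0 w z) = z - endpoint w *~ augmentation S w z.
Proof.
pose aug : {additive F0 S w -> int} := augmentation S w.
rewrite -[augmentation S w z]/(aug z).
elim/F0_ind: z => [|y z IHy IHz|p k].
- by rewrite 2!raddf0 (raddf0 aug) mulr0z subr0.
- by rewrite 2!raddfB (raddfB aug) IHy IHz mulrzBr !opprD addrACA.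
have -> : aug (sym0 k) = 1 := augmentation_sym0 k.
rewrite mulr1z.
rewrite /contract0 freeab_liftE raddfN delta1_bracket opprB.
apply: eq_addr; first by apply: sym0_eq; rewrite ?factorsE ?comp1r ?wordK.
apply: eq_opp; apply: sym0_eq; rewrite ?factorsE //.
by rewrite comp1l wordK contract0_subproof.
Qed.

Lemma kappa_subproof (x y z : W) (e : @cell1 S x y) (q : @hom C y z)
    (q' : @hom C x z) : wclass (letter e) ;;; q = q' ->
  wclass (letter e ;; word q) = wclass (word q').
Proof. by move=> <-; rewrite wcat !wordK. Qed.

Definition kappa (x y z : W) (e : @cell1 S x y) (q : @hom C y z)
    (q' : @hom C x z) (E : wclass (letter e) ;;; q = q') :
  @cell T _ _ (letter e ;; word q) (word q') := some_cell (kappa_subproof E).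

Section Contract1.
Variables (w : FC) (s : symbol (@bar1 S) w).
Local Notation a := (gen1_cell (sym_idx s)).
Local Notation l := (factl (sym_mor s)).
Local Notation r := (factr (sym_mor s)).

Lemma contract1_subproof :
  l ;;; wclass (letter a ;; word r) = acell w.
Proof. by rewrite wcat wordK Defs.compA -(Defs.factE (sym_mor s)). Qed.

Definition contract1_gen : F2 S w :=
  cbracket (kappa (erefl (wclass (letter a) ;;;
    r))) (left_fact contract1_subproof).
End Contract1.

Definition contract1 (w : FC) : {additive F1 S w -> F2 S w} :=
  freeab_lift (@contract1_gen w).

Lemma contract1_sym (w : FC) (x y : W) (e : @cell1 S x y)
    (k : @hom FC (bar1 (Gen1 e)) w) (r : @hom C y (atgt w)) q'
    (E : wclass (letter e) ;;; r = q')
    (l : @hom FC (warrow (letter e ;; word r)) w) :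
  factr k = r -> factl l = factl k -> factr l = @idc C _ ->
  contract1 w (sym1 k) = cbracket (kappa E) l.
Proof.
case: _ / E; move=> rE; case: _ / rE in l * => le re.
by rewrite /contract1 freeab_liftE; apply: cbracket_fact_eq.
Qed.

Lemma bracket_letter (w : FC) (x y : W) (e : @cell1 S x y)
    (k : @hom FC (warrow (letter e)) w) :
  abmap (F1 S) k (bracket (letter e)) = @sym1 w (Gen1 e) k.
Proof.
rewrite -[bracket (letter e)]/(abmap (F1 S) (mulr_fact (letter e) (pnil _ _))
  (bracket_gen (Gen1 e)) + abmap (F1 S) (mull_fact (letter e) (pnil _ _)) 0).
rewrite raddf0 addr0 -abmapM [LHS]free_mapE; congr fgen; congr Symbol.
by apply: fact_eq; rewrite !fact_simplE ?comp1l ?comp1r.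
Qed.

Lemma bracket_catl (w : FC) (x y z : W) (u : hom x y) (v : hom y z)
    (k : @hom FC (warrow (u ;; v)) w) (l : @hom FC (warrow u) w)
    (m : @hom FC (warrow v) w) :
  factl l = factl k -> factr l = wclass v ;;; factr k ->
  factl m = factl k ;;; wclass u -> factr m = factr k ->
  abmap (F1 S) k (bracket (u ;; v)) =
    abmap (F1 S) l (bracket u) + abmap (F1 S) m (bracket v).
Proof.
move=> ll lr ml mr; rewrite bracket_cat raddfD -!abmapM.
by apply: eq_addr; apply: abmap_fact_eq; rewrite ?fact_simplE ?comp1l ?comp1r
  ?ll ?lr ?ml ?mr.
Qed.

(** For z = a[e]b, the boundary of a[kappa] is a[e ^b] - a[^(eb)] = a[e]b + ae[^b] - a[^(eb)], and
    the last two terms are minus the image under [contract0] of the two cuts in [delta1] z. *)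
Lemma delta2_contract1 (w : FC) (z : F1 S w) :
  delta2 S w (contract1 w z) = z - contract0 w (delta1 S w z).
Proof.
elim/F1_ind: z => [|y z IHy IHz|[x y e] k].
- by rewrite !raddf0 addr0.
- by rewrite !raddfB IHy IHz !opprD addrACA.
have lE : factl k ;;; wclass (letter e ;; word (factr k)) = acell w.
  by rewrite wcat wordK Defs.compA -(Defs.factE k).
have e' := kappa_subproof (erefl (wclass (letter e) ;;; factr k)).
rewrite (contract1_sym (erefl (wclass (letter e) ;;; factr k))
  (l := left_fact lE)) // (delta2_cbracket _ e').
have mE : (factl k ;;; wclass (letter e)) ;;; wclass (word (factr k)) = acell w.
  by rewrite wordK -(Defs.factE k).
rewrite (@bracket_catl w x y _ _ _ _ k (left_fact mE)) ?factorsE ?wordK ?comp1r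
  //.
rewrite bracket_letter -(@bracket_letter w x y e k) delta1_bracket raddfB.
rewrite (contract0_sym0 (r := factr k) (l := left_fact mE)) ?factorsE //.
rewrite (contract0_sym0 (r := wclass (letter e) ;;;
  factr k) (l := refact e' (left_fact lE))) ?factorsE //.
by rewrite opprB opprK addrA addrAC.
Qed.

Lemma delta1_delta2 (w : FC) (z : F2 S w) : delta1 S w (delta2 S w z) = 0.
Proof.
elim/F2_ind: z => [|y z IHy IHz|[x y u v a] k].
- by rewrite !raddf0.
- by rewrite !raddfB IHy IHz subr0.
have uv : @wclass S _ _ u = wclass v := expr_class (egen a).
have -> : sym2 k = bracket2 (egen a) k by [].
rewrite (delta2_bracket2 _ uv) raddfB !delta1_bracket.
by apply: eq_sub0; apply: eq_addr; last apply: eq_opp;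
  apply: sym0_eq; rewrite ?factorsE ?uv.
Qed.

Lemma augmentation_delta1 (w : FC) (z : F1 S w) :
  augmentation S w (delta1 S w z) = 0.
Proof.
elim/F1_ind: z => [|y z IHy IHz|[x y e] k].
- by rewrite !raddf0.
- by rewrite !raddfB IHy IHz subr0.
by rewrite -(@bracket_letter w x y e k) delta1_bracket raddfB
  !augmentation_sym0 subrr.
Qed.

Lemma exact_delta2_delta1 : pointwise_exact (delta2 S) (delta1 S).
Proof.
move=> w z; split=> [z0|[t <-]]; last exact: delta1_delta2.
by exists (contract1 w z); rewrite delta2_contract1 z0 raddf0 subr0.
Qed.

Lemma exact_delta1_augmentation : pointwise_exact (delta1 S) (augmentation S).
Proof.
move=> w z; split=> [z0|[t <-]]; last exact: augmentation_delta1.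
by exists (contract0 w z); rewrite delta1_contract0 z0 mulr0z subr0.
Qed.

Lemma augmentation_surjective : pointwise_surjective (augmentation S).
Proof.
move=> w n; exists (endpoint w *~ n).
by rewrite raddfMz augmentation_sym0 intz.
Qed.

End Resolution.

(** * Identities among relations and homological syzygies *)

Section Identities.
Variable S : polygraph2.
Local Notation W := (words S).
Local Notation C := (presented S).
Local Notation FC := (factorisations (presented S)).
Local Notation T := (free_cat21 S).
Local Notation "u ;;; v" := (@Defs.comp C _ _ _ u v)
  (at level 50, left associativity).

Lemma sigma_nil_subproof (x : W) (q : @hom C x x) (E : @wclass S _ _ (pnil _ x)
  = q) :
  @wclass S _ _ (pnil _ x) = wclass (word q).
Proof. by rewrite wordK. Qed.

(* The recursion sigma_(eu) = e sigma_u ; kappa_(e,u), whose second factor    *)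
(* depends only on the class of u, makes [psi] equivariant on the left.       *)
Fixpoint sigma (x y : W) (u : @hom W x y) :
    forall q : @hom C x y, wclass u = q -> @cell T x y u (word q) :=
  match u in Defs.path _ x y
    return forall q : @hom C x y, wclass u = q -> @cell T x y u (word q) with
  | pnil x => fun q E => some_cell (sigma_nil_subproof E)
  | pcons _ _ _ e v => fun q E =>
      vcomp (@whisk T _ _ _ _ (letter e) (@idc W _) _ _ _ _
        (comp1r (c := W) (letter e ;; v)) (comp1r (c := W) _)
        (sigma (erefl (wclass v))))
      (kappa (etrans (wclass_cat (letter e) v) E))
  end.

(** The recursion of [sigma] with all equality proofs arbitrary, so that it rewrites in any
    context. *)
Lemma sigma_cons (x y z : W) (e : @cell1 S x y) (v : @hom W y z) q0 q
    (E0 : wclass v = q0) (E : wclass (letter e ;; v) = q)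
    (e1 : letter e ;; v ;; idc z = letter e ;; v)
    (e2 : letter e ;; word q0 ;; idc z = letter e ;; word q0)
    (F : wclass (letter e) ;;; q0 = q) :
  sigma E = vcomp (@whisk T _ _ _ _ _ _ _ _ _ _ e1 e2 (sigma E0)) (kappa F).
Proof.
case: _ / E0 in e2 F *; rewrite -[LHS]/(vcomp (@whisk T _ _ _ _ _ _ _ _ _ _ _ _
  _) _).
congr (vcomp _ _); last by congr kappa; apply: Prop_irrelevance.
by congr (whisk _ _ _); apply: Prop_irrelevance.
Qed.

Section Psi.
Variables (w : FC) (u v : @hom W (asrc w) (atgt w)) (f : @cell T _ _ u v).
Variables (Eu : wclass u = acell w) (Ev : wclass v = acell w).

Definition loop : @cell T _ _ (word (acell w)) (word (acell w)) :=
  vcomp (vinv (sigma Eu)) (vcomp f (sigma Ev)).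

Definition psi : Pi S w := floor (ClosedCell (wordK (acell w)) loop).
End Psi.

Lemma vcomp_cancel (D : cat21) (x y : D) (u v t : hom x y) (h : cell u v)
  (f g : cell v t) : vcomp h f = vcomp h g -> f = g.
Proof.
move=> e; rewrite -[f]vcomp1l -[g]vcomp1l -(vcompVl h) -!vcompA.
by rewrite e.
Qed.

Lemma sigma_loop (w : FC) (u v : @hom W (asrc w) (atgt w)) (f : @cell T _ _ u v)
  Eu Ev : vcomp (sigma (q := acell w) Eu) (loop f Eu Ev) = vcomp f (sigma Ev).
Proof. by rewrite /loop vcompA vcompV vcomp1l. Qed.

Section PsiTheory.
Variable w : FC.
Implicit Types u v t : @hom W (asrc w) (atgt w).

Lemma psi_pirr u v (f : @cell T _ _ u v) Eu Eu' Ev Ev' :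
  psi (w := w) f Eu Ev = psi f Eu' Ev'.
Proof. by rewrite (Prop_irrelevance Eu Eu') (Prop_irrelevance Ev Ev'). Qed.

Lemma psi_vcomp u v t (f : @cell T _ _ u v) (g : @cell T _ _ v t) Eu Ev Et :
  psi (w := w) (vcomp f g) Eu Et = psi f Eu Ev + psi g Ev Et.
Proof.
rewrite /psi -floor_add; congr floor; congr ClosedCell; rewrite /loop.
rewrite -!vcompA; congr vcomp; congr vcomp; rewrite [in RHS]vcompA.
by rewrite vcompV vcomp1l.
Qed.

(** [loop] conjugates a closed cell by [sigma], and conjugate cells have the same class in [Pi S];
    thus [psi] extends [floor] to all 2-cells. *)
Lemma psi_closed u (f : @cell T _ _ u u) (e E E' : wclass u = acell w) :
  psi (w := w) f E E' = floor (ClosedCell e f).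
Proof.
rewrite (Prop_irrelevance E' E); apply: esym.
apply: (@floor_conj S w _ _ _ _ _ _ (sigma E)).
by rewrite /loop !vcompA vcompV vcomp1l.
Qed.

Lemma psi_vid u (E E' : wclass u = acell w) : psi (w := w) (@vid T _ _ u) E E'
  = 0.
Proof.
have: psi (w := w) (@vcomp T _ _ _ _ _ (@vid T _ _ u) (@vid T _ _ u)) E E =
  psi (@vid T _ _ u) E E + psi (@vid T _ _ u) E E by apply: psi_vcomp.
rewrite vcomp1l => /eqP; rewrite -subr_eq0 opprD addrA subrr add0r oppr_eq0.
by move/eqP; rewrite (Prop_irrelevance E' E).
Qed.
End PsiTheory.

(** By the recursion of [sigma], the loop of e f is the whiskered loop of f conjugated by [kappa],
    and [floor] does not see conjugation. *)
Lemma psi_letter (x p y : W) (e : @cell1 S x p) (u v : @hom W p y)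
    (f : @cell T _ _ u v) (q : @hom C p y) (r : @hom C x y)
    (k : @hom FC (Arrow q) (Arrow r)) (u' v' : @hom W x y)
    (eu : letter e ;; u ;; idc y = u') (ev : letter e ;; v ;; idc y = v')
    (Eu : wclass u = acell (Arrow q)) (Ev : wclass v = acell (Arrow q))
    (Eu' : wclass u' = acell (Arrow r)) (Ev' : wclass v' = acell (Arrow r)) :
  factl k = wclass (letter e) -> factr k = @idc C y ->
  psi (w := Arrow r) (@whisk T _ _ _ _ _ _ _ _ _ _ eu ev f) Eu' Ev' =
    identity_act k (psi (w := Arrow q) f Eu Ev).
Proof.
move=> le re.
have uE : u' = letter e ;; u by rewrite -eu comp1r.
have vE : v' = letter e ;; v by rewrite -ev comp1r.
move: eu ev Eu' Ev'; rewrite uE vE => eu ev Eu' Ev' {u' v' uE vE}.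
have F : wclass (letter e) ;;; q = r.
  by have := Defs.factE k; rewrite le re comp1r.
have ea : wclass (letter e) = factl k by [].
have eb : @wclass S _ _ (idc y) = factr k by [].
rewrite (@identity_actE S (Arrow q) (Arrow r) k _ _ ea eb).
have E1 : wclass (letter e ;; word q ;; idc y) = acell (Arrow r).
  by rewrite comp1r wcat wordK.
have E2 : wclass (letter e ;; word q) = acell (Arrow r).
  by rewrite wcat wordK.
have e2 : letter e ;; word q ;; idc y = letter e ;; word q by apply: comp1r.
rewrite (@whisk_closedE S (Arrow q) (Arrow r) k _ _ ea eb _ (wordK q)
  (@loop (Arrow q) _ _ f Eu Ev) E1).
rewrite (@floor_whisk_eq S (Arrow r) _ _ _ _ _ _ _ E1 E2 erefl e2).
apply: esym; apply: (@floor_conj S (Arrow r) _ _ _ _ _ _ (kappa F)).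
(* After composing on the left with e sigma_u, both sides reduce to the whiskered [f] followed by
   [sigma] of its target. *)
apply: (@vcomp_cancel _ _ _ _ _ _ (@whisk T _ _ _ _ _ _ _ _ _ _ eu e2 (sigma
  Eu))).
rewrite vcompA [RHS]vcompA -(@sigma_cons _ _ _ e u q r Eu Eu' eu e2 F)
  (@sigma_loop (Arrow r)).
rewrite -(@whisk_vcomp T _ _ _ _ _ _ _ _ _ _ _ _ eu e2 e2) (@sigma_loop (Arrow
  q)) (@whisk_vcomp T _ _ _ _ _ _ _ _ _ _ _ _ eu ev e2).
by rewrite -vcompA -(@sigma_cons _ _ _ e v q r Ev Ev' ev e2 F).
Qed.
Lemma psi_eq (w : FC) (u v : @hom W (asrc w) (atgt w)) (f g : @cell T _ _ u v)
    Eu Ev Eu' Ev' : f = g -> psi (w := w) f Eu Ev = psi g Eu' Ev'.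
Proof. by move=> ->; apply: psi_pirr. Qed.

(** Induction on the word [c], one letter at a time: [k] factors as the action of the tail [k1]
    followed by that of the first letter [k2]. *)
Lemma psi_left (x p y : W) (c : @hom W x p) (u v : @hom W p y)
    (f : @cell T _ _ u v) (q : @hom C p y) (r : @hom C x y)
    (k : @hom FC (Arrow q) (Arrow r)) (u' v' : @hom W x y)
    (eu : c ;; u ;; idc y = u') (ev : c ;; v ;; idc y = v')
    (Eu : wclass u = acell (Arrow q)) (Ev : wclass v = acell (Arrow q))
    (Eu' : wclass u' = acell (Arrow r)) (Ev' : wclass v' = acell (Arrow r)) :
  factl k = wclass c -> factr k = @idc C y ->
  psi (w := Arrow r) (@whisk T _ _ _ _ _ _ _ _ _ _ eu ev f) Eu' Ev' =
    identity_act k (psi (w := Arrow q) f Eu Ev).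
Proof.
elim: c u v f q r k u' v' eu ev Eu Ev Eu' Ev' => [{}x|{}x z {}p e c IH]
  u v f q r k u' v' eu ev Eu Ev Eu' Ev' le re.
  have uE : u' = u by rewrite -eu comp1r.
  have vE : v' = v by rewrite -ev comp1r.
  move: eu ev Eu' Ev'; rewrite uE vE => eu ev Eu' Ev' {u' v' uE vE}.
  have qr : q = r.
    have <- : factl k ;;; q ;;; factr k = r := Defs.factE k.
    by rewrite le re comp1r; apply/esym/(@comp1l C).
  case: _ / qr in k le re Eu' Ev' *.
  have -> : k = idc (Arrow q : FC) by apply: fact_eq.
  by rewrite identity_act1 (@whisk1 T); apply: psi_pirr.
pose q1 : @hom C z y := wclass c ;;; q.
have E1 : factl k ;;; acell (Arrow q) ;;; factr k = r := Defs.factE k.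
have wcons : wclass (pcons e c) = wclass (letter e) ;;;
  wclass c by rewrite -wcat.
have k1E : wclass c ;;; acell (Arrow q) ;;; @idc C y = acell (Arrow q1).
  by rewrite comp1r.
have k2E : wclass (letter e) ;;; acell (Arrow q1) ;;;
  @idc C y = acell (Arrow r).
  by apply: etrans E1; rewrite re !comp1r Defs.compA -wcons -le.
pose k1 : @hom FC (Arrow q) (Arrow q1) := @Fact C (Arrow q) (Arrow q1) _ _ k1E.
pose k2 : @hom FC (Arrow q1) (Arrow r) := @Fact C (Arrow q1) (Arrow r) _ _ k2E.
have -> : k = k1 ;; k2.
  apply: fact_eq; first exact: etrans le wcons.
  by apply: (etrans re); apply/esym/(@comp1l C).
rewrite identity_actM.
pose c' : @hom W z p := c.
have e1 : c' ;; u ;; idc y = c' ;; u by apply: comp1r.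
have e2 : c' ;; v ;; idc y = c' ;; v by apply: comp1r.
have e3 : letter e ;; (c' ;; u) ;; idc y = u' by exact: eu.
have e4 : letter e ;; (c' ;; v) ;; idc y = v' by exact: ev.
have E3 : wclass (c' ;; u) = acell (Arrow q1) by rewrite wcat Eu.
have E4 : wclass (c' ;; v) = acell (Arrow q1) by rewrite wcat Ev.
rewrite -(IH _ _ f q q1 k1 _ _ e1 e2 Eu Ev E3 E4) //.
rewrite -(@psi_letter _ _ _ e _ _ _ q1 r k2 _ _ e3 e4 E3 E4 Eu' Ev') //.
apply: psi_eq.
have e5 : (letter e ;; c') ;; u ;; (idc y ;; idc y) = u' by rewrite comp1r.
have e6 : (letter e ;; c') ;; v ;; (idc y ;; idc y) = v' by rewrite comp1r.
rewrite (@whiskM T _ _ _ _ _ _ _ _ _ _ _ _ _ _ _ _ e1 e2 e3 e4 e5 e6).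
by apply: whisk_eq; rewrite ?comp1r.
Qed.

(* Exchange with a 2-cell g : r => r' compares f r with f r' up to u g and    *)
(* v g, which have the same [psi] since u and v have the same class.          *)
Lemma psi_right_indep (x p y : W) (q : @hom C x y) (u v : @hom W x p)
    (r r' : @hom W p y) (f : @cell T _ _ u v) (u1 v1 u2 v2 : @hom W x y)
    (e1 : idc _ ;; u ;; r = u1) (e2 : idc _ ;; v ;; r = v1)
    (e3 : idc _ ;; u ;; r' = u2) (e4 : idc _ ;; v ;; r' = v2)
    (E1 : wclass u1 = acell (Arrow q)) (E2 : wclass v1 = acell (Arrow q))
    (E3 : wclass u2 = acell (Arrow q)) (E4 : wclass v2 = acell (Arrow q)) :
  wclass r = wclass r' ->
  psi (w := Arrow q) (@whisk T _ _ _ _ _ _ _ _ _ _ e1 e2 f) E1 E2 =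
    psi (w := Arrow q) (@whisk T _ _ _ _ _ _ _ _ _ _ e3 e4 f) E3 E4.
Proof.
move=> rr.
have g := some_cell rr.
have a1 : u ;; r ;; idc y = u1 by rewrite comp1r -e1 comp1l.
have a2 : v ;; r ;; idc y = v1 by rewrite comp1r -e2 comp1l.
have a3 : u ;; r' ;; idc y = u2 by rewrite comp1r -e3 comp1l.
have a4 : v ;; r' ;; idc y = v2 by rewrite comp1r -e4 comp1l.
have X := @whisk_exchange_eq T _ _ _ u v r r' _ _ _ _ e1 e2 e3 e4 a1 a2 a3 a4 f
  g.
have uv : @wclass S _ _ u = wclass v := cell_class f.
have kE : wclass u ;;; acell (Arrow (wclass r)) ;;; @idc C y = acell (Arrow q).
  by apply: etrans E1; rewrite comp1r -e1 comp1l wcat.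
pose k : @hom FC (Arrow (wclass r)) (Arrow q) := @Fact C (Arrow (wclass r))
  (Arrow q) _ _ kE.
have := congr1 (fun h => psi (w := Arrow q) h E1 E4) X.
rewrite (@psi_vcomp (Arrow q) _ _ _ _ _ E1 E2 E4) (@psi_vcomp (Arrow q) _ _ _ _
  _ E1 E3 E4).
rewrite (@psi_left _ _ _ u _ _ g _ q k _ _ a1 a3 erefl (esym rr)) //.
rewrite (@psi_left _ _ _ v _ _ g _ q k _ _ a2 a4 erefl (esym rr)) //.
by rewrite addrC => /addrI.
Qed.

(** The left context can be pulled out by [psi_left] as a morphism depending only on the class of
    [l]; what remains is a right whiskering, treated by [psi_right_indep]. *)
Lemma psi_whisk_indep (x p p' y : W) (q : @hom C x y) (u v : @hom W p p')
    (l l' : @hom W x p) (r r' : @hom W p' y) (f : @cell T _ _ u v)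
    (u1 v1 u2 v2 : @hom W x y)
    (e1 : l ;; u ;; r = u1) (e2 : l ;; v ;; r = v1)
    (e3 : l' ;; u ;; r' = u2) (e4 : l' ;; v ;; r' = v2)
    (E1 : wclass u1 = acell (Arrow q)) (E2 : wclass v1 = acell (Arrow q))
    (E3 : wclass u2 = acell (Arrow q)) (E4 : wclass v2 = acell (Arrow q)) :
  wclass l = wclass l' -> wclass r = wclass r' ->
  psi (w := Arrow q) (@whisk T _ _ _ _ _ _ _ _ _ _ e1 e2 f) E1 E2 =
    psi (w := Arrow q) (@whisk T _ _ _ _ _ _ _ _ _ _ e3 e4 f) E3 E4.
Proof.
move=> ll rr.
have uv : @wclass S _ _ u = wclass v := cell_class f.
pose q1 : @hom C p y := wclass u ;;; wclass r.
have kE : wclass l ;;; acell (Arrow q1) ;;; @idc C y = acell (Arrow q).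
  by apply: etrans E1; rewrite comp1r -e1 !wcat Defs.compA.
pose k : @hom FC (Arrow q1) (Arrow q) := @Fact C (Arrow q1) (Arrow q) _ _ kE.
have split (l0 : @hom W x p) (r0 : @hom W p' y) u0 v0 (a1 : l0 ;; u ;; r0 = u0)
    (a2 : l0 ;; v ;; r0 = v0) (A1 : wclass u0 = q) (A2 : wclass v0 = q)
    (b1 : idc p ;; u ;; r0 = u ;; r0) (b2 : idc p ;; v ;; r0 = v ;; r0)
    (B1 : wclass (u ;; r0) = acell (Arrow q1)) (B2 : wclass (v ;;
      r0) = acell (Arrow q1)) :
    wclass l = wclass l0 ->
    psi (w := Arrow q) (@whisk T _ _ _ _ _ _ _ _ _ _ a1 a2 f) A1 A2 =
    identity_act k (psi (w := Arrow q1) (@whisk T _ _ _ _ _ _ _ _ _ _ b1 b2 f)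
      B1 B2).
  move=> l0E.
  have c1 : l0 ;; (u ;; r0) ;; idc y = u0 by rewrite comp1r Defs.compA.
  have c2 : l0 ;; (v ;; r0) ;; idc y = v0 by rewrite comp1r Defs.compA.
  rewrite -(@psi_left _ _ _ l0 _ _ _ q1 q k _ _ c1 c2 B1 B2 A1 A2) //.
  apply: psi_eq.
  have d1 : (l0 ;; idc p) ;; u ;; (r0 ;; idc y) = u0 by rewrite !comp1r.
  have d2 : (l0 ;; idc p) ;; v ;; (r0 ;; idc y) = v0 by rewrite !comp1r.
  rewrite (@whiskM T _ _ _ _ _ _ _ _ _ _ _ _ _ _ _ _ b1 b2 c1 c2 d1 d2).
  by apply: whisk_eq; rewrite ?comp1r.
have b1 : idc p ;; u ;; r = u ;; r by rewrite comp1l.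
have b2 : idc p ;; v ;; r = v ;; r by rewrite comp1l.
have b3 : idc p ;; u ;; r' = u ;; r' by rewrite comp1l.
have b4 : idc p ;; v ;; r' = v ;; r' by rewrite comp1l.
have B1 : wclass (u ;; r) = acell (Arrow q1) by rewrite wcat.
have B2 : wclass (v ;; r) = acell (Arrow q1) by rewrite wcat -uv.
have B3 : wclass (u ;; r') = acell (Arrow q1) by rewrite wcat -rr.
have B4 : wclass (v ;; r') = acell (Arrow q1) by rewrite wcat -uv -rr.
rewrite (split _ _ _ _ e1 e2 E1 E2 b1 b2 B1 B2) //.
rewrite (split _ _ _ _ e3 e4 E3 E4 b3 b4 B3 B4) //.
by congr (identity_act k _); apply: psi_right_indep.
Qed.
Lemma whisk_in_class (w : FC) (x y : W) (u : @hom W x y) (k : @hom FC (warrow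
  u) w)
    (l : @hom W (asrc w) x) (r : @hom W y (atgt w)) :
  wclass l = factl k -> wclass r = factr k -> wclass (l ;; u ;; r) = acell w.
Proof. by move=> le re; rewrite !wcat le re; apply: (Defs.factE k). Qed.

Definition psi_gen (w : FC) (s : symbol (@bar2 S) w) : Pi S w :=
  let a := sym_idx s in let k := sym_mor s in
  let f : @cell T _ _ (src2 a) (tgt2 a) := ecls (egen (gen2_cell a)) in
  psi (@whisk T _ _ _ _ (word (factl k)) (word (factr k)) _ _ _ _ erefl erefl f)
    (@whisk_in_class w _ _ (src2 a) k _ _ (wordK _) (wordK _))
    (@whisk_in_class w _ _ (tgt2 a) (refact (cell_class f) k) _ _ (wordK _)
      (wordK _)).

Definition phi (w : FC) : {additive F2 S w -> Pi S w} :=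
  freeab_lift (@psi_gen w).

(** Each clause of [bracket2] is matched by a property of [psi]: additivity, units, inverses. The
    representatives [l] and [r] are arbitrary so that a whiskering in [f] can be absorbed into them;
    the generator case is then [psi_whisk_indep]. *)
Lemma phi_bracket2 (x y : W) (q : @hom C x y) (p p' : W) (u v : @hom W p p')
    (f : expr u v) (k : @hom FC (warrow u) (Arrow q)) (l : @hom W x p)
    (r : @hom W p' y) (u' v' : @hom W x y)
    (eu : l ;; u ;; r = u') (ev : l ;; v ;; r = v')
    (Eu : wclass u' = acell (Arrow q)) (Ev : wclass v' = acell (Arrow q)) :
  wclass l = factl k -> wclass r = factr k ->
  phi (Arrow q) (bracket2 f k) =
    psi (w := Arrow q) (@whisk T _ _ _ _ _ _ _ _ _ _ eu ev (ecls f)) Eu Ev.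
Proof.
elim: f k l r u' v' eu ev Eu Ev => {p p' u v}.
- move=> p p' u v a k l r u' v' eu ev Eu Ev le re.
  rewrite /phi freeab_liftE.
  by apply: psi_whisk_indep; rewrite wordK ?le ?re.
- move=> p p' u k l r u' v' eu ev Eu Ev le re; rewrite raddf0.
  have uv : u' = v' by rewrite -eu -ev.
  case: _ / uv in ev Ev *.
  rewrite -[ecls _]/(@vid T _ _ u) whisk_vid; exact/esym/psi_vid.
- move=> p p' u v t f IHf g IHg k l r u' v' eu ev Eu Ev le re.
  rewrite -[bracket2 _ _]/(bracket2 f k + bracket2 g (refact (expr_class f) k)).
  have em : l ;; v ;; r = l ;; v ;; r by [].
  have Em : wclass (l ;; v ;; r) = acell (Arrow q).
    by apply: (@whisk_in_class _ _ _ v (refact (expr_class f) k)).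
  rewrite raddfD (IHf k l r _ _ eu em Eu Em) // (IHg _ l r _ _ em ev Em Ev) //.
  rewrite -fcompE -[fcomp _ _]/(@vcomp T _ _ _ _ _ (ecls f) (ecls g)).
  rewrite (@whisk_vcomp T _ _ _ _ _ _ _ _ _ _ _ _ eu em ev).
  by rewrite (@psi_vcomp (Arrow q) _ _ _ _ _ Eu Em Ev).
- move=> p p' u v f IHf k l r u' v' eu ev Eu Ev le re.
  rewrite -[bracket2 _ _]/(- bracket2 f (refact (esym (expr_class f)) k)).
  rewrite raddfN (IHf _ l r _ _ ev eu Ev Eu) //.
  rewrite -finvE -[Defs.finv _]/(@vinv T _ _ _ _ (ecls f)).
  apply/eqP; rewrite eq_sym -addr_eq0 -(@psi_vcomp (Arrow q) _ _ _ _ _ Eu Ev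
    Eu).
  rewrite -(@whisk_vcomp T _ _ _ _ _ _ _ _ _ _ _ _ eu ev eu) vcompVl whisk_vid.
  by rewrite psi_vid.
- move=> p0 p p' p0' a b u v u1 v1 eu1 ev1 f IHf k l r u' v' eu ev Eu Ev le re.
  rewrite -[bracket2 _ _]/(bracket2 f (whisk_fact eu1 k)).
  have e1 : (l ;; a) ;; u ;; (b ;; r) = u' by rewrite -eu -eu1 !Defs.compA.
  have e2 : (l ;; a) ;; v ;; (b ;; r) = v' by rewrite -ev -ev1 !Defs.compA.
  rewrite (IHf _ (l ;; a) (b ;; r) _ _ e1 e2 Eu Ev) ?wcat ?le ?re //.
  apply: psi_eq; rewrite -fwhiskE -[fwhisk _ _ _]/(@whisk T _ _ _ _ _ _ _ _ _ _
    eu1 ev1 _).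
  by rewrite (@whiskM T _ _ _ _ _ _ _ _ _ _ _ _ _ _ _ _ eu1 ev1 eu ev e1 e2).
Qed.

(** * The derivation as a map from identities among relations to syzygies *)

Section ToF2.
Variable w : FC.

Lemma base_fact_subproof (u : @hom W (asrc w) (atgt w)) (e : wclass u = acell
  w) :
  @idc C (asrc w) ;;; wclass u = acell w.
Proof. by rewrite comp1l. Qed.

Definition base_fact (u : @hom W (asrc w) (atgt w)) (e : wclass u = acell w) :
  @hom FC (warrow u) w := left_fact (base_fact_subproof e).

Definition identity_bracket_gen (c : closed_cell w) : F2 S w :=
  cbracket (closed_2cell c) (base_fact (closed_class c)).

Lemma identity_bracket_rel r :
  identity_relation r -> freeab_lift identity_bracket_gen r = 0.
Proof.
case=> [v e f g|v v' e e' f g].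
  rewrite raddfB raddfD !freeab_liftE; apply: (@eq_sub0 (F2 S w)).
  apply: (etrans (cbracket_vcomp f g erefl _));
    apply: (@eq_addr (F2 S w)) => //.
  exact: cbracket_fact_eq.
have vv : wclass v = wclass v' by rewrite e e'.
rewrite raddfB !freeab_liftE; apply: (@eq_sub0 (F2 S w)).
apply: (etrans (cbracket_vcomp f g vv _));
  apply: (etrans (@addrC (F2 S w) _ _)).
apply: esym; apply: (etrans (cbracket_vcomp g f (esym vv) _)).
by apply: (@eq_addr (F2 S w)); apply: cbracket_fact_eq.
Qed.

Definition identity_bracket_at : {additive Pi S w -> F2 S w} :=
  presab_lift identity_bracket_rel.

Lemma identity_bracket_floor u (e : wclass u = acell w) (f : @cell T _ _ u u)
    (k : @hom FC (warrow u) w) :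
  factl k = @idc C _ -> factr k = @idc C _ ->
  identity_bracket_at (floor (ClosedCell e f)) = cbracket f k.
Proof.
by move=> le re; rewrite [LHS]presab_liftE; apply: cbracket_fact_eq.
Qed.
End ToF2.

Lemma identity_bracket_nat (w w' : FC) (k : @hom FC w w') (z : Pi S w) :
  identity_bracket_at w' (abmap (Pi S) k z) =
    abmap (F2 S) k (identity_bracket_at w z).
Proof.
move: z; pose D1 := mk_additive (comp_zmod_morphism (abmap (Pi S) k)
  (identity_bracket_at w')).
pose D2 := mk_additive (comp_zmod_morphism (identity_bracket_at w) (abmap (F2
  S) k)).
apply: (@presab_ext _ _ _ D1 D2) => -[v e f].
rewrite -[LHS]/(identity_bracket_at w' (identity_act k (floor (ClosedCell e
  f)))).
rewrite -[RHS]/(abmap (F2 S) k (identity_bracket_at w (floor (ClosedCell e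
  f)))).
rewrite (identity_bracket_floor e f (k := base_fact e)) // cbracket_nat.
rewrite (identity_actE (wordK (factl k)) (wordK (factr k))).
have E := whisk_class_subproof (wordK (factl k)) (wordK (factr k)) (ClosedCell
  e f).
rewrite (whisk_closedE _ _ _ _ E) (identity_bracket_floor _ _ (k := base_fact
  E)) // cbracket_whisk.
by apply: cbracket_fact_eq; rewrite !factorsE ?wordK ?comp1l ?comp1r //;
  apply/esym/(@comp1r C).
Qed.

Definition identity_bracket : abnat (Pi S) (F2 S) := AbNat identity_bracket_nat.
(** With empty contexts, [phi_bracket2] turns [f] into psi(f), which for a closed cell is its own
    class. *)
Lemma phi_identity_bracket (w : FC) (z : Pi S w) : phi w (identity_bracket w z)
  = z.
Proof.
case: w z => x y q z; pose w : FC := Arrow q; move: z.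
pose D1 := mk_additive (comp_zmod_morphism (identity_bracket w) (phi w)).
apply: (@presab_ext _ _ _ D1 (mk_additive (@id_zmod_morphism (Pi S w)))) => -[v
  e f].
rewrite -[LHS]/(phi w (identity_bracket_at w (floor (ClosedCell e f)))).
rewrite (identity_bracket_floor e f (k := base_fact e)) //.
have e1 : @idc W x ;; v ;; @idc W y = v by rewrite comp1l comp1r.
rewrite /cbracket (@phi_bracket2 x y q x y v v (rep f) (base_fact e) (@idc W _)
  (@idc W _) _ _ e1 e1 e e) //.
by rewrite [ecls _](repK f) whisk1 (psi_closed f e).
Qed.

(** [sigma] is a composite of whiskered [kappa] cells, one per letter, and [contract1] sends each
    letter to the bracket of its [kappa]. The remaining term comes from the empty word, since the
    word chosen for an identity need not be empty. *)
Lemma bracket_sigma (x y z : W) (r : @hom C x z) (u : @hom W y z)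
    (q : @hom C y z) (E : wclass u = q) (k : @hom FC (warrow u) (Arrow r))
    (k0 : @hom FC (warrow (pnil _ z)) (Arrow r)) :
  factr k = @idc C z -> factl k0 = factl k ;;;
    wclass u -> factr k0 = @idc C z ->
  cbracket (sigma E) k =
    contract1 (Arrow r) (abmap (F1 S) k (bracket u)) +
    cbracket (sigma (erefl (@wclass S _ _ (pnil _ z)))) k0.
Proof.
elim: u r q E k k0 => [{}y|{}y p {}z e u IH] r q E k k0 rk lk0 rk0.
  rewrite raddf0 raddf0 add0r; case: _ / E; apply: cbracket_fact_eq.
    by rewrite lk0 comp1r.
  by rewrite rk rk0.
pose u1 : @hom W p z := u.
have wcons : wclass (pcons e u) = wclass (letter e) ;;;
  wclass u1 by rewrite -wcat.
have e1 : letter e ;; u1 ;; @idc W z = letter e ;; u1 by apply: comp1r.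
have e2 : letter e ;; word (wclass u1) ;; @idc W z = letter e ;;
  word (wclass u1).
  exact: comp1r.
have F : wclass (letter e) ;;; wclass u1 = q by rewrite -E -wcons.
rewrite (@sigma_cons _ _ _ e u1 _ q erefl E e1 e2 F).
have uE : wclass (letter e ;; u1) = wclass (letter e ;; word (wclass u1)).
  by rewrite !wcat wordK.
rewrite (cbracket_vcomp _ _ uE) cbracket_whisk.
have rk1 : factr (whisk_fact e1 k) = @idc C z by rewrite !factorsE rk comp1r.
have lk1 : factl k0 = factl (whisk_fact e1 k) ;;; wclass u1.
  by rewrite !factorsE lk0 wcons Defs.compA.
rewrite (IH _ _ _ (whisk_fact e1 k) k0 rk1 lk1 rk0).
have e0 : @idc W y ;; letter e ;; u1 = letter e ;; u1 by [].
rewrite (@bracket_catl S (Arrow r) _ _ _ (letter e) u1 k (whisk_fact e0 k)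
  (whisk_fact e1 k)) ?factorsE ?comp1l ?comp1r ?rk //.
rewrite bracket_letter raddfD -[RHS]addrA [RHS]addrC; apply: eq_addr => //.
apply/esym/(@contract1_sym S (Arrow r) _ _ e _ _ _ F (refact uE k)) => //.
- by rewrite factr_whisk rk comp1r.
- exact/esym/(@comp1r C).
Qed.

(** On z = a[alpha]b the loop is sigma^-1, the whiskered alpha, sigma; its bracket is z plus the
    difference of two brackets of [sigma], which [bracket_sigma] rewrites as -[contract1] ([delta2]
    z). *)
Lemma identity_bracket_phi (w : FC) (z : F2 S w) :
  identity_bracket w (phi w z) = z - contract1 w (delta2 S w z).
Proof.
case: w z => x y q z; pose w : FC := Arrow q; rewrite -/w in z *.
elim/F2_ind: z => [|z t IHz IHt|[p p' u v a] k].
- by rewrite !raddf0 addr0.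
- by rewrite !raddfB IHz IHt !opprD addrACA.
pose f : @cell T _ _ u v := ecls (egen a).
have uv : @wclass S _ _ u = wclass v := cell_class f.
pose l := word (factl k); pose r := word (factr k).
pose u' : @hom W x y := l ;; u ;; r; pose v' : @hom W x y := l ;; v ;; r.
have E1 : wclass u' = acell w by apply: (@whisk_in_class w _ _ u k);
  rewrite wordK.
have E2 : wclass v' = acell w.
  by apply: (@whisk_in_class w _ _ v (refact uv k)); rewrite wordK.
have -> : phi w (sym2 k) =
    psi (w := w) (@whisk T _ _ _ _ l r u v u' v' erefl erefl f) E1 E2.
  by apply: (etrans (freeab_liftE _ _)); apply: psi_pirr.
have e := wordK q.
rewrite [LHS](identity_bracket_floor (w := w) _ _ (k := base_fact (w := w) e))
  //.
have E12 : wclass u' = wclass v' by rewrite E1 E2.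
pose k1 : @hom FC (warrow u') w := @base_fact w u' E1.
pose k2 : @hom FC (warrow v') w := @base_fact w v' E2.
have k3E : q ;;; wclass (pnil _ y) = acell w by apply: (@comp1r C).
pose k3 : @hom FC (warrow (pnil _ y)) w := @left_fact S w y q (pnil _ y) k3E.
(* The contribution of the empty word sits at the same place for source and target, so it
   cancels. *)
pose K := cbracket (sigma (erefl (@wclass S _ _ (pnil _ y)))) k3.
have Ew1 : wclass (word q) = wclass u' by rewrite wordK E1.
have s1 : cbracket (sigma E1) k1 = contract1 w (abmap (F1 S) k1 (bracket u')) +
  K.
  by apply: bracket_sigma => //; apply/esym/(etrans (@comp1l C _ _ _) E1).
have s2 : cbracket (sigma E2) k2 = contract1 w (abmap (F1 S) k2 (bracket v')) +
  K.
  by apply: bracket_sigma => //; apply/esym/(etrans (@comp1l C _ _ _) E2).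
rewrite (cbracket_vcomp _ _ Ew1) (cbracket_vinv _ Ew1) (cbracket_vcomp _ _ E12).
rewrite (@cbracket_fact_eq _ _ _ _ _ _ (sigma E1) _ k1) //.
rewrite (@cbracket_fact_eq _ _ _ _ _ _ (sigma E2) _ k2) //.
rewrite s1 s2.
have -> : cbracket (@whisk T _ _ _ _ l r u v u' v' erefl erefl f)
    (refact Ew1 (@base_fact w _ e)) = sym2 k.
  rewrite cbracket_whisk; apply: etrans (cbracket_cls (egen a) k).
  apply: cbracket_fact_eq.
  - by apply: (etrans (@comp1l C _ _ _)); apply: wordK.
  - by apply: (etrans (@comp1r C _ _ _)); apply: wordK.
have dE : delta2 S w (sym2 k) =
    abmap (F1 S) k1 (bracket u') - abmap (F1 S) k2 (bracket v').
  have -> : abmap (F1 S) k2 (bracket v') = abmap (F1 S) (refact E12 k1)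
    (bracket v').
    exact: abmap_fact_eq.
  rewrite (@bracket_whisk S w _ _ _ _ l r u v u' v' erefl erefl uv E12).
  apply: (etrans (delta2_bracket2 (egen a) uv k)).
  apply: eq_addr; last apply: eq_opp; apply: abmap_fact_eq;
    rewrite ?factorsE.
  - by apply/esym/(etrans (@comp1l C _ _ _))/wordK.
  - by apply/esym/(etrans (@comp1r C _ _ _))/wordK.
  - by apply/esym/(etrans (@comp1l C _ _ _))/wordK.
  - by apply/esym/(etrans (@comp1r C _ _ _))/wordK.
rewrite dE raddfB addrCA; apply: eq_addr => //.
by rewrite addrC opprD addrACA subrr addr0 opprB.
Qed.

Lemma delta2_identity_bracket (w : FC) (z : Pi S w) :
  delta2 S w (identity_bracket w z) = 0.
Proof.
pose D1 := mk_additive (comp_zmod_morphism (identity_bracket w) (delta2 S w)).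
(* The zero map in bundled form, as [D1] followed by id - id, because [presab_ext] compares two
   additive maps. *)
pose D2 : {additive Pi S w -> F1 S w} := mk_additive (comp_zmod_morphism D1
  (mk_additive (sub_zmod_morphism (mk_additive (@id_zmod_morphism (F1 S w)))
    (mk_additive (@id_zmod_morphism (F1 S w)))))).
have D2E t : D2 t = 0 by apply: (@subrr (F1 S w)).
rewrite -(D2E z); move: z; apply: (@presab_ext _ _ _ D1 D2) => -[v e f].
rewrite [RHS]D2E -[LHS]/(delta2 S w (identity_bracket_at w (floor (ClosedCell e
  f)))).
rewrite (identity_bracket_floor e f (k := base_fact e)) //.
by rewrite (delta2_cbracket _ erefl); apply: eq_sub0; apply: abmap_fact_eq.
Qed.

Definition identity_to_h2 : abnat (Pi S) (h2 S) := corestrict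
  delta2_identity_bracket.

Lemma identity_to_h2_inj w : injective (identity_to_h2 w).
Proof.
move=> a b ab.
have e : identity_bracket w a = identity_bracket w b.
  exact: (congr1 (@ker_val _ _ _ _ _) ab).
by rewrite -[a]phi_identity_bracket e phi_identity_bracket.
Qed.

(** On the kernel of [delta2] the error term of [identity_bracket_phi] vanishes, so [phi] gives
    preimages. *)
Lemma identity_to_h2_surj : pointwise_surjective identity_to_h2.
Proof.
move=> w z; exists (phi w (ker_val z)); apply: val_inj.
rewrite -[LHS]/(identity_bracket w _).
by rewrite identity_bracket_phi ker_valP raddf0 subr0.
Qed.
End Identities.

(** * Homotopy bases *)

Section AutomorphismGroup.
Variables (K : cat21) (x y : K) (u : hom x y).
Hypothesis abelian : forall f g : cell u u, vcomp f g = vcomp g f.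

Lemma aut_add0 : left_id (vid u) (vcomp (c := K) (u := u) (v := u) (w := u)).
Proof. by move=> f; apply: vcomp1l. Qed.

Lemma aut_addA : associative (vcomp (c := K) (u := u) (v := u) (w := u)).
Proof. by move=> f g h; apply: vcompA. Qed.

Lemma aut_addN :
  left_inverse (vid u) (vinv (c := K) (u := u) (v := u))
    (vcomp (c := K) (u := u) (v := u) (w := u)).
Proof. by move=> f; apply: vcompVl. Qed.

Definition aut_group : zmodType :=
  HB.pack {classic (cell u u)}
    (GRing.isZmodule.Build {classic (cell u u)} aut_addA abelian aut_add0
      aut_addN).
End AutomorphismGroup.

Section FDT.
Variable S : polygraph2.
Local Notation W := (words S).
Local Notation C := (presented S).
Local Notation FC := (factorisations (presented S)).
Local Notation T := (free_cat21 S).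
Local Notation "u ;;; v" := (@Defs.comp C _ _ _ u v)
  (at level 50, left associativity).

(** * Evaluating identities in quotients of the abelian (2,1)-category *)

Section Projection.
Variable G : set (sphere (abelianised T)).
Local Notation K := (cells_mod G).

Definition proj (x y : W) (u v : @hom W x y) (f : @cell T _ _ u v) :
    @cell K x y u v :=
  @qcls (abelianised T) _ x y u v (@qcls T (@closed_comm T) x y u v f).

Section ProjTheory.
Variables (x y : W).
Implicit Types u v t : @hom W x y.

Lemma proj_surj u v (g : @cell K x y u v) : exists f, g = proj f.
Proof.
have [g1 ->] := qcls_surj g; have [f ->] := qcls_surj g1.
by exists f.
Qed.

Lemma proj_vcomp u v t (f : @cell T _ _ u v) (g : @cell T _ _ v t) :
  proj (vcomp f g) = vcomp (proj f) (proj g).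
Proof.
rewrite /proj -[RHS]/(qvcomp _ _) qvcompE; congr qcls.
exact: esym (qvcompE _ _ _).
Qed.

Lemma proj_vid u : proj (@vid T _ _ u) = @vid K _ _ u.
Proof. by []. Qed.

Lemma proj_vinv u v (f : @cell T _ _ u v) : proj (vinv f) = vinv (proj f).
Proof.
rewrite /proj -[RHS]/(qvinv _) qvinvE; congr qcls.
exact: esym (qvinvE _ _).
Qed.

Lemma proj_whisk x' y' (a : @hom W x' x) (b : @hom W y y') u v
    (u' v' : @hom W x' y') (eu : a ;; u ;; b = u') (ev : a ;; v ;; b = v')
    (f : @cell T _ _ u v) :
  proj (@whisk T _ _ _ _ _ _ _ _ _ _ eu ev f) =
    @whisk K _ _ _ _ _ _ _ _ _ _ eu ev (proj f).
Proof.
rewrite /proj -[RHS]/(qwhisk _ _ _) qwhiskE; congr qcls.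
exact: esym (qwhiskE _ _ _ _).
Qed.

Lemma proj_comm u (f g : @cell K x y u u) : vcomp f g = vcomp g f.
Proof.
have [f0 ->] := proj_surj f; have [g0 ->] := proj_surj g.
rewrite -!proj_vcomp /proj; congr qcls; apply/cell_congP/cell_rel.
exact: ClosedComm.
Qed.
End ProjTheory.

Section Theta.
Variables (x y : W) (q : @hom C x y).
Local Notation w := (Arrow q).
Local Notation A := (aut_group (@proj_comm x y (word q))).

Definition theta_gen (c : closed_cell w) : A :=
  proj (loop (w := w) (closed_2cell c) (closed_class c) (closed_class c)).

Lemma loop_vcomp (u v t : @hom W x y) (f : @cell T _ _ u v) (g : @cell T _ _ v
  t)
    Eu Ev Et :
  @loop S w _ _ (vcomp f g) Eu Et = vcomp (@loop S w _ _ f Eu Ev) (@loop S w _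
    _ g Ev Et).
Proof.
rewrite /loop -!vcompA; congr vcomp; congr vcomp; rewrite [in RHS]vcompA.
by rewrite vcompV vcomp1l.
Qed.

Lemma theta_gen_vcomp (u v : @hom W x y) (f : @cell T _ _ u v)
    (g : @cell T _ _ v u) (e : wclass u = acell w) (e' : wclass v = acell w) :
  theta_gen (@ClosedCell S w _ e (vcomp f g)) =
    vcomp (proj (@loop S w _ _ f e e')) (proj (@loop S w _ _ g e' e)).
Proof. by rewrite -proj_vcomp -loop_vcomp. Qed.

Lemma theta_rel r : identity_relation r -> freeab_lift theta_gen r = 0.
Proof.
case=> [v e f g|v v' e e' f g].
  rewrite raddfB raddfD !freeab_liftE.
  have -> : theta_gen (@ClosedCell S w _ e (vcomp f g)) =
    theta_gen (@ClosedCell S w _ e f) + theta_gen (@ClosedCell S w _ e g).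
    exact: theta_gen_vcomp.
  by rewrite subrr.
rewrite raddfB !freeab_liftE (theta_gen_vcomp f g e e') (theta_gen_vcomp g f e'
  e).
by rewrite proj_comm; apply: (@subrr A).
Qed.

(** Conjugation by [sigma] moves all closed cells over the class [q] to automorphisms of one word.
    These commute in the quotient, so the defining relations of [Pi S] hold among them. *)
Definition theta : {additive Pi S w -> A} := presab_lift theta_rel.

Lemma thetaE (u : @hom W x y) (e : wclass u = acell w) (f : @cell T _ _ u u) :
  theta (floor (@ClosedCell S w _ e f)) = proj (loop (w := w) f e e).
Proof. exact: presab_liftE. Qed.

(** Conjugation is invertible, so [theta] detects triviality of a closed cell at any word of the
    class. *)
Lemma theta_eq0 (u : @hom W x y) (e : wclass u = acell w) (f : @cell T _ _ u u)
  :
  theta (floor (@ClosedCell S w _ e f)) = 0 <-> proj f = @vid K _ _ u.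
Proof.
rewrite thetaE -[0]/(@vid K _ _ (word q)); split=> [l0|f0].
  apply: (@vcomp_cancel _ _ _ _ _ _ (vinv (proj (@sigma S _ _ u q e)))).
  have := congr1 (fun h => vcomp h (vinv (proj (@sigma S _ _ u q e)))) l0.
  rewrite /loop !proj_vcomp proj_vinv vcomp1l vcomp1r -!vcompA vcompV.
  by rewrite vcomp1r.
by rewrite /loop !proj_vcomp f0 proj_vinv vcomp1l vcompVl.
Qed.
End Theta.
End Projection.
Lemma floor_vid (w : FC) u (e : wclass u = acell w) :
  floor (ClosedCell e (@vid T _ _ u)) = 0.
Proof. by rewrite -(psi_closed _ e e e) psi_vid. Qed.

Lemma psi_vinv (w : FC) (u v : @hom W (asrc w) (atgt w)) (f : @cell T _ _ u v)
  Eu Ev :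
  psi (w := w) (vinv f) Ev Eu = - psi f Eu Ev.
Proof.
by apply/eqP; rewrite -addr_eq0 -(psi_vcomp _ _ _ Eu) vcompVl psi_vid.
Qed.

Lemma psi_sub (w : FC) (u v : @hom W (asrc w) (atgt w)) (f g : @cell T _ _ u v)
    Eu Ev (e : wclass u = acell w) :
  psi (w := w) f Eu Ev - psi g Eu Ev = floor (ClosedCell e (vcomp f (vinv g))).
Proof.
by rewrite -(psi_closed _ e Eu Eu) (psi_vcomp _ _ _ Ev) (psi_vinv _ Eu).
Qed.

(** All generators can be moved to the one word chosen for the class, where sums and differences are
    realised by composition and inversion. *)
Lemma floor_surj (w : FC) (z : Pi S w) :
  exists f, z = floor (ClosedCell (wordK (acell w)) f).
Proof.
have [r ->] : exists r, z = presab_cls (identity_relation (w := w)) r.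
  by exists (generic_quotient.repr z); apply/esym/generic_quotient.reprK.
elim/freeab_ind: r => [|r s [f fE] [g gE]|[v e f]].
- by exists (@vid T _ _ _); rewrite raddf0 floor_vid.
- exists (vcomp f (vinv g)); rewrite raddfB fE gE.
  by rewrite -(psi_sub f g (wordK _) (wordK _)) !(psi_closed _ (wordK _)).
- by exists (loop f e e); rewrite -[LHS](psi_closed f e e e).
Qed.

(** The basis consists of the spheres (c_i, identity) for closed cells c_i whose classes generate.
    It trivialises every closed cell by [theta], hence identifies f and g through the loop f
    g^-1. *)
Lemma fg_Pi_FDTab : finitely_generated (Pi S) -> FDTab S.
Proof.
move=> /fg_generators [n [w [d ds]]].
pose c i : @cell T _ _ (word (acell (w i))) (word (acell (w i))) :=
  sval (cid (floor_surj (d i))).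
have cE i : d i = floor (ClosedCell (wordK (acell (w i))) (c i)).
  by rewrite /c; case: cid.
pose ab := @qcls T (@closed_comm T).
pose G : set (sphere (abelianised T)) :=
  range (fun i => @Sphere (abelianised T) _ _ _ _ (ab _ _ _ _ (c i)) (ab _ _ _
    _ (@vid T _ _ _))).
exists G; split; first exact/finite_image/finite_setT_fin.
have c1 i : @proj G _ _ _ _ (c i) = proj G (@vid T _ _ _).
  rewrite /proj; apply/cell_congP/cell_rel.
  by exists i.
have closed1 (x y : W) (u : @hom W x y) (f : @cell T _ _ u u) :
    proj G f = @vid (cells_mod G) _ _ u.
  pose q := wclass u; have e : wclass u = acell (Arrow q) by [].
  apply/(@theta_eq0 G x y q u e f).
  (* Write the class of [f] in terms of generators: [theta] is additive and vanishes on each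
     translate, as a whiskering of the trivialised cell [c i]. *)
  have [z <-] := ds (Arrow q) (floor (@ClosedCell S (Arrow q) _ e f)).
  elim/free_abfunctor_ind: z => [|z t IHz IHt|i k].
  - by rewrite !raddf0.
  - by rewrite !raddfB IHz IHt subr0.
  rewrite free_liftE cE.
  rewrite -[abmap _ _ _]/(identity_act k (floor _)).
  rewrite (identity_actE (wordK (factl k)) (wordK (factr k))).
  have E := whisk_class_subproof (wordK (factl k)) (wordK (factr k))
    (ClosedCell (wordK (acell (w i))) (c i)).
  rewrite (whisk_closedE _ _ _ _ E); apply/(@theta_eq0 G x y q _ E).
  by rewrite proj_whisk c1 proj_vid whisk_vid.
move=> x y u v f g.
have [f0 ->] := proj_surj f; have [g0 ->] := proj_surj g.
have := closed1 _ _ _ (vcomp f0 (vinv g0)).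
rewrite proj_vcomp proj_vinv => /(congr1 (fun h => vcomp h (proj G g0))).
by rewrite -vcompA vcompVl vcomp1r vcomp1l.
Qed.

Lemma whisk_vinv (D : cat21) (x' x y y' : D) (a : hom x' x) (b : hom y y')
    (u v : hom x y) (u' v' : hom x' y') (eu : a ;; u ;; b = u')
    (ev : a ;; v ;; b = v') (f : cell u v) :
  whisk ev eu (vinv f) = vinv (whisk eu ev f).
Proof.
apply: (@vcomp_cancel _ _ _ _ _ _ (whisk eu ev f)).
by rewrite -(whisk_vcomp eu ev eu) !vcompV whisk_vid.
Qed.

(** * From homotopy bases to generators of identities among relations *)

Section Difference.
Variables (n : nat) (w0 : 'I_n -> FC) (d : forall i, Pi S (w0 i)).

Definition gen_mem (w : FC) (z : Pi S w) := exists t, free_abnat d w t = z.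

Lemma gen_mem0 w : @gen_mem w 0.
Proof. by exists 0; rewrite raddf0. Qed.

Lemma gen_memB w a b : @gen_mem w a -> gen_mem b -> gen_mem (a - b).
Proof. by case=> s <- [t <-]; exists (s - t); rewrite raddfB. Qed.

Lemma gen_memN w a : @gen_mem w a -> gen_mem (- a).
Proof. by rewrite -sub0r; apply: gen_memB; apply: gen_mem0. Qed.

Lemma gen_memD w a b : @gen_mem w a -> gen_mem b -> gen_mem (a + b).
Proof. by move=> ha hb; rewrite -[b]opprK; apply: gen_memB => //;
  apply: gen_memN. Qed.

(** Quantifying over [q] leaves the fibre free; the condition is vacuous unless [q] is the common
    class of [u] and [v]. *)
Definition equiv_mod (x y : W) (u v : @hom W x y) (f g : @cell T _ _ u v) :=
  forall (q : @hom C x y) (Eu : wclass u = acell (Arrow q)) (Ev : wclass v =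
    acell (Arrow q)),
    gen_mem (psi (w := Arrow q) f Eu Ev - psi (w := Arrow q) g Eu Ev).

Lemma equiv_mod_refl (x y : W) (u v : @hom W x y) (f : @cell T _ _ u v) :
  equiv_mod f f.
Proof. by move=> q Eu Ev; rewrite subrr; apply: gen_mem0. Qed.

Lemma equiv_mod_sym (x y : W) (u v : @hom W x y) (f g : @cell T _ _ u v) :
  equiv_mod f g -> equiv_mod g f.
Proof. by move=> fg q Eu Ev; rewrite -opprB; apply/gen_memN/fg. Qed.

Lemma equiv_mod_trans (x y : W) (u v : @hom W x y) (f g h : @cell T _ _ u v) :
  equiv_mod f g -> equiv_mod g h -> equiv_mod f h.
Proof.
move=> fg gh q Eu Ev.
rewrite -[psi (w := Arrow q) f Eu Ev](subrK (psi (w := Arrow q) g Eu Ev))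
  -addrA.
by apply: gen_memD; [apply: fg|apply: gh].
Qed.

Lemma equiv_mod_vcomp (x y : W) (u v t : @hom W x y) (f f' : @cell T _ _ u v)
    (g g' : @cell T _ _ v t) :
  equiv_mod f f' -> equiv_mod g g' -> equiv_mod (vcomp f g) (vcomp f' g').
Proof.
move=> ff gg q Eu Et.
have Ev : wclass v = acell (Arrow q) by rewrite -(cell_class f).
rewrite !(@psi_vcomp _ (Arrow q) _ _ _ _ _ Eu Ev Et) opprD addrACA.
by apply: gen_memD; [apply: ff|apply: gg].
Qed.

Lemma equiv_mod_vinv (x y : W) (u v : @hom W x y) (f f' : @cell T _ _ u v) :
  equiv_mod f f' -> equiv_mod (vinv f) (vinv f').
Proof.
move=> ff q Ev Eu; rewrite !(@psi_vinv (Arrow q) _ _ _ Eu Ev) -opprD.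
by apply/gen_memN/ff.
Qed.

(** The difference of the two values is the class of the whiskered loop f f'^-1, that is, a
    translate of the class of this loop; the generated subsystem is stable under translation. *)
Lemma equiv_mod_whisk (x' x y y' : W) (a : @hom W x' x) (b : @hom W y y')
    (u v : @hom W x y) (u' v' : @hom W x' y') (eu : a ;; u ;; b = u')
    (ev : a ;; v ;; b = v') (f f' : @cell T _ _ u v) :
  equiv_mod f f' -> equiv_mod (@whisk T _ _ _ _ _ _ _ _ _ _ eu ev f)
    (@whisk T _ _ _ _ _ _ _ _ _ _ eu ev f').
Proof.
move=> ff q Eu Ev.
have uv := esym (cell_class f).
rewrite (@psi_sub (Arrow q) _ _ _ _ Eu Ev Eu) -(@whisk_vinv T _ _ _ _ _ _ _ _ _
  _ eu ev).
rewrite -(@whisk_vcomp T _ _ _ _ _ _ _ _ _ _ _ _ eu ev eu).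
have kE : wclass a ;;; acell (Arrow (wclass u)) ;;; wclass b = acell (Arrow q).
  by rewrite -(wclass_whisk eu).
pose k : @hom FC (Arrow (wclass u)) (Arrow q) :=
  @Fact C (Arrow (wclass u)) (Arrow q) _ _ kE.
pose h := vcomp f (vinv f').
have E : wclass (a ;; u ;; b) = acell (Arrow q) by rewrite eu.
have -> : floor (@ClosedCell S (Arrow q) _ Eu (@whisk T _ _ _ _ _ _ _ _ _ _ eu
  eu h)) =
    abmap (Pi S) k (floor (@ClosedCell S (Arrow (wclass u)) _ erefl h)).
  rewrite -[RHS]/(identity_act k (floor _)).
  rewrite (@identity_actE S _ _ k a b erefl erefl).
  rewrite (@whisk_closedE S _ _ k a b erefl erefl _ _ _ E).
  exact: (@floor_whisk_eq S (Arrow q)).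
apply: free_abnat_surj_mor.
by rewrite -(@psi_sub (Arrow (wclass u)) u v f f' erefl uv erefl); apply: ff.
Qed.

Lemma equiv_mod_comm (x y : W) (u v : @hom W x y) (f g : @cell T _ _ u v) :
  closed_comm f g -> equiv_mod f g.
Proof.
case=> {u v f g} x0 y0 u f g q Eu Ev; rewrite (Prop_irrelevance Ev Eu).
rewrite !(@psi_vcomp _ (Arrow q) _ _ _ _ _ Eu Eu Eu) [X in _ - X]addrC subrr.
exact: gen_mem0.
Qed.

Lemma equiv_mod_ab (x y : W) (u v : @hom W x y) (f g : @cell T _ _ u v) :
  cell_cong (@closed_comm T) f g -> equiv_mod f g.
Proof.
elim=> {x y u v f g} *; [exact: equiv_mod_comm|exact: equiv_mod_refl|
  exact: equiv_mod_sym|exact: equiv_mod_trans|exact: equiv_mod_vcomp|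
  exact: equiv_mod_vinv|exact: equiv_mod_whisk].
Qed.

Variable G : set (sphere (abelianised T)).
Local Notation ab f := (@qcls T (@closed_comm T) _ _ _ _ f).

Definition ab_rep (x y : W) (u v : @hom W x y) (f : @cell (abelianised T) _ _ u
  v) :
  @cell T _ _ u v := rep f.

Hypothesis G_mem : forall s, G s ->
  equiv_mod (ab_rep (sph_src2 s)) (ab_rep (sph_tgt2 s)).

Lemma ab_rep_cls (x y : W) (u v : @hom W x y) (f : @cell T _ _ u v) :
  equiv_mod (ab_rep (ab f)) f.
Proof. exact/equiv_mod_ab/rep_cell_cong. Qed.

(** Cells of the abelianisation are classes, so the relation is read on representatives;
    [ab_rep_cls] absorbs the change of representative in each congruence rule. *)
Lemma equiv_mod_cells_mod (x y : W) (u v : @hom W x y)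
    (f g : @cell (abelianised T) _ _ u v) :
  cell_cong (fun x y u v f g => G (@Sphere (abelianised T) x y u v f g)) f g ->
  equiv_mod (ab_rep f) (ab_rep g).
Proof.
elim=> {x y u v f g}.
- by move=> x y u v f g /G_mem.
- by move=> *; apply: equiv_mod_refl.
- by move=> x y u v f g _; apply: equiv_mod_sym.
- by move=> x y u v f g h _ fg _; apply: equiv_mod_trans.
- move=> x y u v t f f' g g' _ ff _ gg.
  apply: equiv_mod_trans (ab_rep_cls _) _.
  apply: equiv_mod_trans (equiv_mod_sym (ab_rep_cls _)).
  exact: equiv_mod_vcomp.
- move=> x y u v f f' _ ff.
  apply: equiv_mod_trans (ab_rep_cls _) _.
  apply: equiv_mod_trans (equiv_mod_sym (ab_rep_cls _)).
  exact: equiv_mod_vinv.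
- move=> x' x y y' a b u v u' v' eu ev f f' _ ff.
  apply: equiv_mod_trans (ab_rep_cls _) _.
  apply: equiv_mod_trans (equiv_mod_sym (ab_rep_cls _)).
  exact: equiv_mod_whisk.
Qed.

(** An element is the class of a loop [f]. In the quotient [f] equals the identity, so psi(f) -
    psi(1), which is the class of [f], lies in the generated subsystem. *)
Lemma homotopy_basis_generates : homotopy_basis G -> pointwise_surjective
  (free_abnat d).
Proof.
move=> Gb [x y q] z; have [f ->] := floor_surj z.
have fid : equiv_mod f (@vid T _ _ _).
  have /cell_congP/equiv_mod_cells_mod e := Gb x y _ _ (proj G f) (proj G (@vid
    T _ _ _)).
  apply: equiv_mod_trans (equiv_mod_sym (ab_rep_cls _)) _.
  exact: equiv_mod_trans e (ab_rep_cls _).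
have := fid q (wordK q) (wordK q).
by rewrite psi_vid subr0 (@psi_closed S (Arrow q) _ f (wordK q)).
Qed.
End Difference.

Lemma FDTab_fg_Pi : FDTab S -> finitely_generated (Pi S).
Proof.
case=> G [/finite_set_enum [n [h GE]] Gb].
pose w i : FC := @Arrow C _ _ (wclass (sph_src1 (h i))).
pose d i : Pi S (w i) := floor (@ClosedCell S (w i) (sph_src1 (h i)) erefl
  (vcomp (ab_rep (sph_src2 (h i))) (vinv (ab_rep (sph_tgt2 (h i)))))).
apply/fg_generators; exists n, w, d; apply: homotopy_basis_generates Gb.
(* Once [q] is the class of the source, the difference is [d i] itself, reached by the generating
   symbol at the identity. *)
rewrite GE => _ [i _ <-] q Eu; case: q / Eu => Ev.
exists (fgen (Symbol (idc (w i)))).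
by rewrite free_abnat_gen (@psi_sub (w i) _ _ _ _ _ _ erefl).
Qed.
End FDT.

(** * Independence of the presentation *)

Section Transfer.
Variables (S : polygraph2) (C : category).
Hypothesis S_finite : finite_polygraph S.
Variable I : category_iso (presented S) C.
Local Notation F := (factorisations_functor (iso_from I)).

Lemma ffs_presentation : fully_faithful_surjective F.
Proof. exact/ffs_factorisations/ffs_iso_from. Qed.

Lemma fg_pullback_free J (s : J -> factorisations (presented S)) :
  finite_set [set: J] -> finitely_generated (pullback F (free_abfunctor s)).
Proof.
move=> J_finite; apply/(fg_pullback ffs_presentation).
exact: fg_of_finite J_finite (@free_generators _ _ s).
Qed.

(** The given resolution lives on C, so the complex of [S] is pulled back to C, where it stays
    projective and exact, and the two are compared there. *)
Lemma FP3_fg_h2 : homological_FP3 C ->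
  finitely_generated (along_presentation I (h2 S)).
Proof.
case: S_finite => fin0 fin1 fin2.
move=> [P3 [P2 [P1 [P0 [d3 [d2 [d1 [d0 [[f3 _] [[_ p2] [[_ p1] [[_ p0] [x32
  [x21 [x10 s0]]]]]]]]]]]]]]].
have proj := pullback_free_projective ffs_presentation.
have fg_ker : finitely_generated (kernel (pullback_abnat F (delta2 S))).
  apply: (@fg_kernel_comparison _ _ _ _ _ _ _ _ _ d3 d2 d1 d0
    _ (pullback_abnat F (delta1 S)) (pullback_constant F (augmentation S))) => //.
  - exact: proj.
  - exact: proj.
  - exact: proj.
  - exact/pullback_exact/exact_delta2_delta1.
  - by move=> x; apply: exact_delta1_augmentation.
  - by move=> x; apply: augmentation_surjective.
  - exact: fg_pullback_free.
exact: fg_surj (@ker_pullback_surjective _ _ F _ _ (delta2 S)) fg_ker.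
Qed.

(** A finitely generated free cover of [h2 S], followed by the inclusion into F2, is the missing
    differential [d3]. *)
Lemma fg_h2_FP3 : finitely_generated (h2 S) -> homological_FP3 C.
Proof.
case: S_finite => fin0 fin1 fin2 /fg_generators [n [w [d ds]]].
have proj := pullback_free_projective ffs_presentation.
pose d3 : abnat (free_abfunctor w) (F2 S) := abnat_comp (free_abnat d)
  (kernel_incl (delta2 S)).
exists (pullback F (free_abfunctor w)), (pullback F (F2 S)),
  (pullback F (F1 S)), (pullback F (F0 S)),
  (pullback_abnat F d3), (pullback_abnat F (delta2 S)),
  (pullback_abnat F (delta1 S)), (pullback_constant F (augmentation S)).
split; first by split; [apply/fg_pullback_free/finite_setT_fin|apply: proj].
do 3 (split; first by split; [apply: fg_pullback_free|apply: proj]).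
split; last split; last split.
- apply: pullback_exact => x z; split=> [z0|[t <-]]; last exact: ker_valP.
  have zk : z \in @ker_pred _ _ _ (delta2 S) x by apply/eqP.
  have [t tE] := ds x (Ker zk); exists t.
  exact: (congr1 (@ker_val _ _ _ _ _) tE).
- exact/pullback_exact/exact_delta2_delta1.
- by move=> x; apply: exact_delta1_augmentation.
- by move=> x; apply: augmentation_surjective.
Qed.
End Transfer.

Theorem theorem5p7p3 (C : category) (S : polygraph2)
    (S_finite : finite_polygraph S)
    (S_presents_C : category_iso (presented S) C) :
  [<-> homological_FP3 C;
       finitely_generated (along_presentation S_presents_C (h2 S));
       finitely_generated (along_presentation S_presents_C (Pi S));
       category_FDTab C].
Proof.
have ffs := ffs_presentation S_presents_C.
tfae.
- exact: FP3_fg_h2.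
- move=> /(fg_pullback ffs) h2_fg; apply/(fg_pullback ffs).
  exact: fg_bij (@identity_to_h2_inj S) (@identity_to_h2_surj S) h2_fg.
- move=> /(fg_pullback ffs) Pi_fg; exists S; split=> //.
  exact: fg_Pi_FDTab.
(* [S'] may differ from [S]: its own complex is used, with [Pi S'] mapped onto [h2 S'], and the
   conclusion is about C only. *)
- case=> S' [S'_finite [I'] /FDTab_fg_Pi Pi_fg].
  apply: (fg_h2_FP3 S'_finite I').
  exact: fg_surj (@identity_to_h2_surj S') Pi_fg.
Qed.
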